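(* Let $q\ge 7$ be an odd prime power and let $\Sigma_\infty$ be a hyperplane of $\mathrm{PG}(4,q)$. Let $\mathcal C$ be a set of $q^2$ affine points (called $\mathcal C$-points), and suppose there exists a set of affine planes, called $\mathcal C$-planes, satisfying: (A1) each $\mathcal C$-plane meets $\mathcal C$ in a $q$-arc; further, every plane of $\mathrm{PG}(4,q)$ meeting $\mathcal C$ in more than four points is a $\mathcal C$-plane; (A2) every pair of distinct points of $\mathcal C$ lies in exactly one $\mathcal C$-plane; (A3) every affine point of $\mathrm{PG}(4,q)$ is of one of three types: a point of $\mathcal C$, a point on no $\mathcal C$-plane, or a point on exactly two $\mathcal C$-planes. Then there exists a unique spread $\mathcal S$ of $\Sigma_\infty$ such that the $\mathcal C$-points, viewed as points of the Bruck–Bose plane $\mathcal P(\mathcal S)$, form a $q^2$-arc of $\mathcal P(\mathcal S)$. Moreover, $\mathcal S$ is regular, so $\mathcal P(\mathcal S)\cong \mathrm{PG}(2,q^2)$, and this $q^2$-arc can be completed to a conic of $\mathrm{PG}(2,q^2)$.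
   Context: $\Sigma_\infty$ is called the hyperplane at infinity; points of $\mathrm{PG}(4,q)\setminus\Sigma_\infty$ are affine points, and lines/planes not contained in $\Sigma_\infty$ are affine lines/affine planes. A $k$-arc in a projective plane is a set of $k$ points no three collinear. A spread of $\Sigma_\infty\cong\mathrm{PG}(3,q)$ is a set of $q^2+1$ pairwise disjoint lines covering all points of $\Sigma_\infty$; it is regular if for any three distinct lines of the spread the regulus they determine is contained in the spread. Bruck–Bose plane $\mathcal P(\mathcal S)$: its affine points are the affine points of $\mathrm{PG}(4,q)$, its affine lines are the affine planes of $\mathrm{PG}(4,q)$ meeting $\Sigma_\infty$ in a line of $\mathcal S$, incidence being inclusion; it is completed to a projective plane of order $q^2$ by a line at infinity whose points are the elements of $\mathcal S$ (an affine plane through $s\in\mathcal S$ is incident with the point $s$). $\mathcal P(\mathcal S)$ is Desarguesian iff $\mathcal S$ is regular. *)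

(* Defs.v *)
From HB Require Import structures.
From mathcomp Require Import all_boot all_order all_algebra.

Set Implicit Arguments.
Unset Strict Implicit.
Unset Printing Implicit Defensive.

Import GRing.Theory.
Local Open Scope ring_scope.

Section VspaceFinite.

Import VectorInternalTheory.

HB.instance Definition _ (K : finFieldType) (vT : vectType K) :=
  [Finite of {vspace vT} by <:].

End VspaceFinite.

(* The k-dimensional subspaces of PG(n, K), in projective dimension: points,
   lines, planes and solids are k = 0, 1, 2, 3. *)
Record flat (K : finFieldType) (n k : nat) := Flat {
  flat_space :> {vspace 'rV[K]_n.+1};
  _ : \dim flat_space == k.+1
}.

HB.instance Definition _ (K : finFieldType) (n k : nat) :=
  [isSub for @flat_space K n k].
HB.instance Definition _ (K : finFieldType) (n k : nat) :=
  [Finite of flat K n k by <:].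

Record geometry := Geometry {
  point : finType;
  line : finType;
  incident : point -> line -> bool
}.

Definition collinear (G : geometry) (x y z : point G) : Prop :=
  exists l : line G, [/\ incident x l, incident y l & incident z l].

Definition k_arc (G : geometry) (k : nat) (A : {set point G}) : Prop :=
  #|A| = k /\
  forall x y z : point G, x \in A -> y \in A -> z \in A ->
    x != y -> y != z -> x != z -> ~ collinear x y z.

Arguments k_arc : clear implicits.

Definition is_isomorphism (G H : geometry)
    (f : point G -> point H) (g : line G -> line H) : Prop :=
  [/\ bijective f, bijective g &
      forall (x : point G) (l : line G), incident (f x) (g l) = incident x l].

Definition PG (n : nat) (K : finFieldType) : geometry :=
  @Geometry (flat K n 0) (flat K n 1) (fun x l => (x <= l)%VS).

(* Nondegenerate conics. Representing quadratic forms by symmetric matrices is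
   adequate in odd characteristic only. *)
Definition conic (K : finFieldType) (O : {set point (PG 2 K)}) : Prop :=
  exists A : 'M[K]_3, [/\ A^T = A, \det A != 0 &
    O = [set x : flat K 2 0 |
          [forall v : 'rV[K]_3, (v \in (x : {vspace _})) ==>
                                (v *m A *m v^T == 0)]]].

Section BruckBose.

Variables (K : finFieldType) (Sigma : flat K 4 3).

Definition affine (k : nat) (U : flat K 4 k) : bool := ~~ (U <= Sigma)%VS.

Definition spread (S : {set flat K 4 1}) : Prop :=
  [/\ #|S| = (#|K| ^ 2 + 1)%N,
      forall s, s \in S -> (s <= Sigma)%VS,
      forall s t, s \in S -> t \in S -> s != t -> (s :&: t)%VS = 0%VS &
      forall x : flat K 4 0, (x <= Sigma)%VS ->
        exists2 s, s \in S & (x <= s)%VS].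

Definition meets (l m : flat K 4 1) : bool := (l :&: m)%VS != 0%VS.

(* The regulus determined by three pairwise skew lines of a solid: the lines
   meeting every transversal of the three. *)
Definition regulus (l1 l2 l3 : flat K 4 1) : {set flat K 4 1} :=
  [set m | [forall t : flat K 4 1,
     [&& meets t l1, meets t l2 & meets t l3] ==> meets t m]].

Definition regular (S : {set flat K 4 1}) : Prop :=
  forall s1 s2 s3, s1 \in S -> s2 \in S -> s3 \in S ->
    s1 != s2 -> s2 != s3 -> s1 != s3 -> regulus s1 s2 s3 \subset S.

Variable S : {set flat K 4 1}.

Definition bb_point : finType :=
  ({x : flat K 4 0 | affine x} + {s : flat K 4 1 | s \in S})%type.

(* None is the line at infinity. *)
Definition bb_line : finType :=
  option {P : flat K 4 2 |
    affine P && [exists s in S, (P :&: Sigma)%VS == s]}.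

Definition bb_incident (x : bb_point) (l : bb_line) : bool :=
  match x, l with
  | inl x, Some P => (val x <= val P)%VS
  | inr s, Some P => (val s <= val P)%VS
  | inl _, None => false
  | inr _, None => true
  end.

Definition bruck_bose : geometry := Geometry bb_incident.

(* The affine points of C, viewed as points of the Bruck-Bose plane. *)
Definition bb_set (C : {set flat K 4 0}) : {set point bruck_bose} :=
  [set x : bb_point | if x is inl y then val y \in C else false].

End BruckBose.

(* Main.v *)
Require Import Defs.
From HB Require Import structures.
From mathcomp Require Import all_boot all_order all_algebra.
From mathcomp Require Import all_field.
From mathcomp Require Import zify ring.

(* The points and C-planes form an affine plane of order q. Counting the second C-planes through the
   points of a C-plane pi outside C, and using that no solid contains three C-planes (the only place
   where 7 <= q is used in full), one finds that pi meets exactly q other C-planes in affine lines,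
   that all these lines have a common direction n, and that C-planes that are parallel in the affine
   plane have no common affine point. Hence two parallel classes share the direction n, and they project from n onto
   the two rulings of a hyperbolic paraboloid: C = {(x, y, x y, f(x, y))} in affine coordinates. The
   remaining C-planes become the lines y = m x + k, and a second direction shows that f is affine on
   the lines of two distinct slopes, so that f is quadratic and may be taken to be y^2 + c x^2. By
   (A3) c is a nonsquare. With theta^2 = c and v = y + x theta this is C = {(v, v^2)} over
   K = F(theta), a conic minus its point at infinity, and the lines of the wanted spread are the
   1-dimensional K-subspaces of K^2. *)

Set Implicit Arguments.
Unset Strict Implicit.
Unset Printing Implicit Defensive.

(** The argument runs in the vector space F^5: an affine point is the vector of its 1-space where a
    linear form [h] takes the value 1, a direction is a nonzero vector where [h] vanishes. The lines
    shared with one C-plane have a common direction because the only alternative, a common point of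
    [C], leaves (q - 1)(q - 2) points on the secants through that point, and too few planes to cover
    them.

    Uniqueness of the spread needs an argument of its own, since a line of a competing spread is
    only an F-subspace of K^2. The chords of {(v, v^2)} from the point of parameter k have the
    directions u with Y u / X u - X u = 2 k, so the arc property makes u |-> Y u / X u - X u
    injective on the vectors of each spread line with X u nonzero. For a line skew to X = 0 this
    already forces K-linearity. That X = 0 itself, the point at infinity of the conic, belongs to
    the spread follows by counting the lines that meet it. *)

Lemma injective_onto_bijective (T U : finType) (f : T -> U) :
  injective f -> (forall y, exists x, f x = y) -> bijective f.
Proof.
move=> f_inj f_surj; apply: inj_card_bij => //.
have E : codom f =i U by move=> y; rewrite !inE; apply/codomP; have [x <-] := f_surj y; exists x.
by rewrite -(eq_card E) leq_image_card.
Qed.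

Lemma card_le1_inj (T : finType) (A : {set T}) :
  (forall x y, x \in A -> y \in A -> x = y) -> #|A| <= 1.
Proof. by move=> AP; apply/card_le1_eqP => x y xA yA; apply: AP. Qed.

(** * Finite affine planes *)

Section AffinePlane.

Variables (T I : finType) (q : nat) (C : {set T}) (B : {set I}).
Variable blk : I -> {set T}.
Hypothesis q_gt1 : 1 < q.
Hypothesis card_C : #|C| = q ^ 2.
Hypothesis blkC : forall p, p \in B -> blk p \subset C.
Hypothesis card_blk : forall p, p \in B -> #|blk p| = q.
Hypothesis join : forall x y, x \in C -> y \in C -> x != y ->
  exists p, [/\ p \in B, x \in blk p & y \in blk p].
Hypothesis join_uniq : forall x y p r, x != y -> p \in B -> r \in B ->
  x \in blk p -> y \in blk p -> x \in blk r -> y \in blk r -> p = r.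

Lemma card_blkI p r : p \in B -> r \in B -> p != r -> #|blk p :&: blk r| <= 1.
Proof.
move=> pB rB pr; apply: card_le1_inj => x y /setIP[xp xr] /setIP[yp yr].
apply: contraNeq pr => xy; apply/eqP; exact: (join_uniq xy pB rB).
Qed.

(** Pairs of a point [y] other than [x] and a block joining the two number q^2 - 1, and each block
    through [x] accounts for q - 1 of them. *)
Lemma card_through x : x \in C -> #|[set p in B | x \in blk p]| = q.+1.
Proof.
move=> xC.
have E : \sum_(y in C :\ x) \sum_(p in B | (x \in blk p) && (y \in blk p)) 1
       = \sum_(p in B | x \in blk p) \sum_(y in blk p :\ x) 1.
  rewrite (exchange_big_dep (fun p => (p \in B) && (x \in blk p))) /=; last first.
    by move=> y p _ /and3P[-> -> _].
  apply: eq_bigr => p /andP[pB xp]; apply: eq_bigl => y.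
  rewrite pB xp /= !in_setD1; case: eqP => //= _.
  by apply/andP/idP => [[]//|yp]; split=> //; apply: (subsetP (blkC pB)).
have E2 : \sum_(y in C :\ x) \sum_(p in B | (x \in blk p) && (y \in blk p)) 1
       = #|C :\ x|.
  rewrite -[RHS]sum1_card; apply: eq_bigr => y /setD1P[yx yC].
  have xy : x != y by rewrite eq_sym.
  have [p [pB xp yp]] := join xC yC xy.
  rewrite (big_pred1 p) // => r; apply/idP/eqP => [/and3P[rB xr yr]|->].
    exact: (join_uniq xy).
  by rewrite pB xp yp.
have E3 : \sum_(p in B | x \in blk p) \sum_(y in blk p :\ x) 1
        = #|[set p in B | x \in blk p]| * q.-1.
  rewrite -sum_nat_const; apply: eq_big => [p|p /andP[pB xp]].
    by rewrite inE.
  by rewrite sum1_card; have := cardsD1 x (blk p); rewrite xp card_blk //; lia.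
have := cardsD1 x C; rewrite xC card_C; move: E; rewrite E2 E3 => ->.
set m := #|_|; rewrite expnS expn1; case: (q) q_gt1 => // k k1 /=; nia.
Qed.

Lemma playfair p x : p \in B -> x \in C -> x \notin blk p ->
  exists r, [/\ r \in B, x \in blk r, [disjoint blk p & blk r] &
    forall r', r' \in B -> x \in blk r' -> [disjoint blk p & blk r'] -> r' = r].
Proof.
move=> pB xC xp.
have xne y : y \in blk p -> x != y by apply: contraTneq => <-.
(* [f y] is the block joining [x] to [y]; for [y] in [blk p] the default [p] is never taken. *)
pose f y := odflt p [pick r in B | (x \in blk r) && (y \in blk r)].
have fP y : y \in blk p -> [/\ f y \in B, x \in blk (f y) & y \in blk (f y)].
  move=> yp; rewrite /f; case: pickP => [r /and3P[] //|no].
  have [r [rB xr yr]] := join xC (subsetP (blkC pB) _ yp) (xne _ yp).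
  by have := no r; rewrite /= rB xr yr.
pose X := [set r in B | x \in blk r].
pose Y := f @: blk p.
have YX : Y \subset X.
  by apply/subsetP => _ /imsetP[y yp ->]; have [fB xf _] := fP _ yp; rewrite !inE fB.
have cY : #|Y| = q.
  rewrite card_in_imset ?card_blk // => y z yp zp fyz.
  have [fB xf yf] := fP _ yp; have [_ _ zf] := fP _ zp; rewrite -fyz in zf.
  apply: contraNeq xp => yz.
  by rewrite (join_uniq yz pB fB).
have : #|X :\: Y| = 1 by rewrite cardsD (setIidPr YX) card_through // cY subSnn.
move/eqP/cards1P => [r rE]; have : r \in X :\: Y by rewrite rE inE.
rewrite !inE => /and3P[rY rB xr].
have dis r' : r' \in B -> x \in blk r' -> [disjoint blk p & blk r'] = (r' \notin Y).
  move=> r'B xr'; apply/idP/idP => [d|r'Y].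
    apply/negP => /imsetP[y yp r'E]; have [_ _ yr] := fP _ yp.
    by rewrite -r'E in yr; have := disjointFr d yp; rewrite yr.
  rewrite -setI_eq0; apply: contraNT r'Y => /set0Pn[y /setIP[yp yr']].
  apply/imsetP; exists y => //; have [fB xf yf] := fP _ yp.
  exact: (join_uniq (xne _ yp)).
exists r; split=> //; first by rewrite dis.
move=> r' r'B xr'; rewrite dis // => r'Y; apply/set1P; rewrite -rE !inE r'Y r'B //.
Qed.

(** The parallels to [p] partition the q^2 - q points off [p] into sets of size q. *)
Lemma card_parallel p : p \in B ->
  #|[set r in B | [disjoint blk p & blk r]]| = q.-1.
Proof.
move=> pB; set P := [set r in B | _].
have E : \sum_(x in C :\: blk p) \sum_(r in P | x \in blk r) 1
       = \sum_(r in P) \sum_(x in blk r) 1.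
  rewrite (exchange_big_dep (mem P)) /=; last by move=> ? ? _ /andP[].
  apply: eq_bigr => r; rewrite inE => /andP[rB d]; apply: eq_bigl => x.
  rewrite !inE rB d /=; apply/andP/idP => [[]//|xr]; split=> //.
  by rewrite (disjointFl d xr) (subsetP (blkC rB)).
have : \sum_(x in C :\: blk p) \sum_(r in P | x \in blk r) 1 = #|C :\: blk p|.
  rewrite -sum1_card; apply: eq_bigr => x /setDP[xC xp].
  have [r [rB xr d u]] := playfair pB xC xp.
  rewrite (big_pred1 r) // => r'; rewrite inE; apply/idP/eqP => [/andP[/andP[? ?] ?]|->].
    exact: u.
  by rewrite rB d xr.
rewrite E; under eq_bigr => r rP do
  [rewrite sum1_card card_blk; last by move: rP; rewrite inE => /andP[]].
rewrite sum_nat_const cardsD (setIidPr (blkC pB)) card_C card_blk //.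
set m := #|_|; rewrite expnS expn1; case: (q) q_gt1 => // k k1 /=; nia.
Qed.

End AffinePlane.

Import GRing.Theory.
Local Open Scope ring_scope.

(** * Dimensions of subspaces *)

Lemma dimv_cap_ge (F : fieldType) (vT : vectType F) (U V W : {vspace vT}) :
  (U <= W)%VS -> (V <= W)%VS -> (\dim U + \dim V <= \dim W + \dim (U :&: V)%VS)%N.
Proof. by move=> UW VW; rewrite -dimv_sum_cap leq_add2r dimvS // subv_add UW. Qed.

Lemma dimv_cap_lt (F : fieldType) (vT : vectType F) (U V : {vspace vT}) :
  ~~ (U <= V)%VS -> (\dim (U :&: V)%VS < \dim U)%N.
Proof.
move=> UV; rewrite ltn_neqAle dimvS ?capvSl // andbT; apply: contraNneq UV => E.
by apply/capv_idPl/eqP; rewrite eqEdim capvSl E /=.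
Qed.

Lemma vspace_neq_sub (F : fieldType) (vT : vectType F) (U V : {vspace vT}) :
  \dim U = \dim V -> U != V -> ~~ (U <= V)%VS.
Proof. by move=> d; apply: contraNN => s; rewrite eqEdim s d /=. Qed.

Lemma dimv_gt0_mem (F : fieldType) (vT : vectType F) (U : {vspace vT}) :
  (0 < \dim U)%N -> exists2 v, v \in U & v != 0.
Proof.
rewrite lt0n dimv_eq0 => U0; exists (vpick U); first exact: memv_pick.
by rewrite vpick0.
Qed.

Lemma dimv_line2 (F : fieldType) (vT : vectType F) (u v : vT) :
  u != 0 -> v \notin <[u]>%VS -> \dim (<[u]> + <[v]>) = 2%N.
Proof.
move=> u0 uv; have v0 : v != 0 by apply: contraNneq uv => ->; rewrite mem0v.
have : (<[u]> :&: <[v]>)%VS = 0%VS.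
  apply/eqP; rewrite -subv0; apply/subvP => w; rewrite memv_cap.
  case/andP=> wu /vlineP[k wE]; rewrite memv0 wE scaler_eq0 (negbTE v0) orbF.
  apply: contraNT uv => k0; rewrite -(scalerK k0 v) -wE; exact: memvZ.
by move/dimv_disjoint_sum=> ->; rewrite !dim_vline u0 v0.
Qed.

(** * The C-planes *)

Section Geometry.

Variables (F : finFieldType) (q : nat).
Hypothesis card_F : #|F| = q.
Notation V := 'rV[F]_5.
Variables (h : V -> F) (C : {set V}) (P : {set {vspace V}}).
Hypothesis h_lin : forall a u v, h (a *: u + v) = a * h u + h v.
Hypothesis q_ge7 : (7 <= q)%N.
Hypothesis card_C : #|C| = (q ^ 2)%N.
Hypothesis C_aff : forall v, v \in C -> h v = 1.
Hypothesis dimP : forall p, p \in P -> \dim p = 3%N.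
Definition blk (p : {vspace V}) := [set v in C | v \in p].
Hypothesis card_blk : forall p, p \in P -> #|blk p| = q.
Hypothesis arc : forall p u v w, p \in P -> u \in blk p -> v \in blk p -> w \in blk p ->
  u != v -> u != w -> v != w -> w - u \notin <[v - u]>%VS.
Hypothesis joinP : forall u v, u \in C -> v \in C -> u != v ->
  exists p, [/\ p \in P, u \in p & v \in p].
Hypothesis join_uniqP : forall u v p r, u != v -> u \in C -> v \in C -> p \in P -> r \in P ->
  u \in p -> v \in p -> u \in r -> v \in r -> p = r.
Hypothesis two_planes : forall v p, h v = 1 -> v \notin C -> p \in P -> v \in p ->
  exists r, [/\ r \in P, r != p & v \in r].
Hypothesis no_three_planes : forall v p r s, h v = 1 -> v \notin C ->
  p \in P -> r \in P -> s \in P -> v \in p -> v \in r -> v \in s ->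
  [|| p == r, p == s | r == s].

Implicit Types (p r s U : {vspace V}) (u v w n o e : V).

Lemma h0 : h 0 = 0.
Proof. by have := h_lin (-1) 0 0; rewrite scaler0 addr0 mulN1r addNr. Qed.
Lemma hZ a v : h (a *: v) = a * h v.
Proof. by have := h_lin a v 0; rewrite h0 !addr0. Qed.
Lemma hD u v : h (u + v) = h u + h v.
Proof. by have := h_lin 1 u v; rewrite scale1r mul1r. Qed.
Lemma hN v : h (- v) = - h v.
Proof. by rewrite -scaleN1r hZ mulN1r. Qed.
Lemma hB u v : h (u - v) = h u - h v.
Proof. by rewrite hD hN. Qed.

(** Each 1-space outside the kernel of [h] contains exactly one vector with [h v = 1], which
    represents it. Points at infinity appear as directions [n != 0] with [h n = 0], so that the
    affine line through [v] in direction [n] is the set of all [v + t *: n]. *)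
Definition afs (U : {vspace V}) := [set v in U | h v == 1].

Lemma in_afs U v : (v \in afs U) = (v \in U) && (h v == 1).
Proof. by rewrite inE. Qed.

Lemma aff_neq0 v : h v = 1 -> v != 0.
Proof. by move=> hv; apply/eqP => v0; move: hv (oner_neq0 F); rewrite v0 h0 => ->; rewrite eqxx. Qed.

Lemma blk_mem p v : (v \in blk p) = (v \in C) && (v \in p).
Proof. by rewrite inE. Qed.

Lemma afs_line U v n : h v = 1 -> h n = 0 -> v \in U -> n \in U -> n != 0 -> \dim U = 2%N ->
  afs U = [set v + t *: n | t : F].
Proof.
move=> hv hn vU nU n0 dU.
have vn : v \notin <[n]>%VS.
  by apply/negP => /vlineP[k vE]; move: hv; rewrite vE hZ hn mulr0 => /esym/eqP; rewrite oner_eq0.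
have UE : U = (<[n]> + <[v]>)%VS.
  apply/esym/eqP; rewrite eqEdim dU dimv_line2 // subv_add -!memvE nU vU //.
apply/setP => w; rewrite in_afs; apply/andP/imsetP => [[wU /eqP hw]|[t _ ->]].
  move: wU; rewrite UE => /memv_addP[_ /vlineP[a ->] [_ /vlineP[b ->] wE]].
  move: hw; rewrite wE hD !hZ hn hv mulr0 add0r mulr1 => b1.
  by exists a => //; rewrite b1 scale1r addrC.
by rewrite memvD ?memvZ // hD hZ hn hv mulr0 addr0.
Qed.

Lemma card_line (v n : V) : n != 0 -> #|[set v + t *: n | t : F]| = q.
Proof.
move=> n0; rewrite card_imset // => s t /addrI /eqP.
by rewrite -subr_eq0 -scalerBl scaler_eq0 (negbTE n0) orbF subr_eq0 => /eqP.
Qed.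

Lemma dir_exists U v : h v = 1 -> v \in U -> (1 < \dim U)%N ->
  exists n, [/\ n \in U, n != 0 & h n = 0].
Proof.
move=> hv vU dU.
have [w wU wv] : exists2 w, w \in U & w \notin <[v]>%VS.
  apply/subvPn; apply: contraTN dU => /dimvS; rewrite dim_vline; lia.
exists (w - h w *: v); split; first by rewrite memvB ?memvZ.
  by apply: contraNneq wv => /eqP; rewrite subr_eq0 => /eqP->; rewrite memvZ ?memv_line.
by rewrite hB hZ hv mulr1 subrr.
Qed.

(** Distinct planes share at most a line; if their common part lies at infinity there is no common
    affine point, whatever its dimension. *)
Lemma card_afs_cap p r : p \in P -> r \in P -> p != r ->
  [\/ #|afs (p :&: r)%VS| = 0%N, #|afs (p :&: r)%VS| = 1%N |
      #|afs (p :&: r)%VS| = q /\ \dim (p :&: r)%VS = 2%N].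
Proof.
move=> pP rP pr.
have d2 : (\dim (p :&: r)%VS <= 2)%N.
  have /dimv_cap_lt := vspace_neq_sub (etrans (dimP pP) (esym (dimP rP))) pr.
  by rewrite (dimP pP).
have [->|[v]] := set_0Vmem (afs (p :&: r)%VS); first by apply: Or31; rewrite cards0.
rewrite in_afs => /andP[vU /eqP hv].
have [d1|d1] := leqP (\dim (p :&: r)%VS) 1.
  apply: Or32; apply/eqP/cards1P; exists v; apply/setP => w; rewrite in_afs in_set1.
  apply/andP/eqP => [[wU /eqP hw]|->]; last by rewrite hv.
  have UE : (p :&: r)%VS = <[v]>%VS.
    by apply/esym/eqP; rewrite eqEdim -memvE vU dim_vline aff_neq0.
  by move: wU hw; rewrite UE => /vlineP[k ->]; rewrite hZ hv mulr1 => ->; rewrite scale1r.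
have {d1 d2}d2 : \dim (p :&: r)%VS = 2%N by apply/eqP; rewrite eqn_leq d2.
have [n [nU n0 hn]] := dir_exists hv vU (eq_leq (esym d2)).
by apply: Or33; split=> //; rewrite (afs_line hv hn) // card_line.
Qed.

(** An affine vector and two independent directions form a basis of [p]. Planes are placed in solids
    by means of this criterion. *)
Lemma plane_sub p u v n U : \dim p = 3%N -> h u = 1 -> h v = 0 -> h n = 0 -> v != 0 ->
  n \notin <[v]>%VS -> u \in p -> v \in p -> n \in p -> u \in U -> v \in U -> n \in U ->
  (p <= U)%VS.
Proof.
move=> dp hu hv hn v0 nv up vp np uU vU nU.
pose W := (<[u]> + (<[v]> + <[n]>))%VS.
have Wh w : w \in (<[v]> + <[n]>)%VS -> h w = 0.
  by case/memv_addP=> _ /vlineP[a ->] [_ /vlineP[b ->] ->]; rewrite hD !hZ hv hn !mulr0 addr0.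
have dW : \dim W = 3%N.
  rewrite dimv_disjoint_sum ?dim_vline ?aff_neq0 // ?dimv_line2 //.
  apply/eqP; rewrite -subv0; apply/subvP => w; rewrite memv_cap => /andP[/vlineP[k ->] /Wh].
  by rewrite hZ hu mulr1 => ->; rewrite scale0r mem0v.
have -> : p = W by apply/esym/eqP; rewrite eqEdim dW dp !subv_add -!memvE up vp np.
by rewrite !subv_add -!memvE uU vU nU.
Qed.

Lemma plane_sub_arc p u v w U : p \in P -> u \in blk p -> v \in blk p -> w \in blk p ->
  u != v -> u != w -> v != w -> u \in U -> v \in U -> w \in U -> (p <= U)%VS.
Proof.
move=> pP up vp wp uv uw vw uU vU wU.
move: (up) (vp) (wp); rewrite !blk_mem => /andP[uC u_p] /andP[vC v_p] /andP[wC w_p].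
have [hu hv hw] := And3 (C_aff uC) (C_aff vC) (C_aff wC).
apply: (plane_sub (u := u) (v := v - u) (n := w - u)); rewrite ?hB ?hu ?hv ?hw ?subrr //; try exact: memvB.
- exact: dimP.
- by rewrite subr_eq0 eq_sym.
- exact: (arc pP up vp wp uv uw vw).
Qed.

(** * The affine plane formed by C and the C-planes *)

Let blkC p : p \in P -> blk p \subset C.
Proof. by move=> _; apply/subsetP => v; rewrite blk_mem => /andP[]. Qed.
Let q_gt1 : (1 < q)%N. Proof. by lia. Qed.
Let join u v : u \in C -> v \in C -> u != v ->
  exists p, [/\ p \in P, u \in blk p & v \in blk p].
Proof.
by move=> uC vC /(joinP uC vC)[p [pP up vp]]; exists p; rewrite !blk_mem uC vC.
Qed.
Let join_uniq x y p r : x != y -> p \in P -> r \in P ->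
  x \in blk p -> y \in blk p -> x \in blk r -> y \in blk r -> p = r.
Proof.
move=> xy pP rP; rewrite !blk_mem => /andP[xC xp] /andP[yC yp] /andP[_ xr] /andP[_ yr].
exact: (join_uniqP xy).
Qed.

Lemma card_blk_cap p r : p \in P -> r \in P -> p != r -> (#|blk p :&: blk r| <= 1)%N.
Proof. exact: (card_blkI join_uniq). Qed.

Lemma card_planes_on v : v \in C -> #|[set p in P | v \in p]| = q.+1.
Proof.
move=> vC; rewrite -(card_through q_gt1 card_C blkC card_blk join join_uniq vC).
by congr #|pred_of_set _|; apply/setP => p; rewrite !inE vC.
Qed.

Definition meet p r := ~~ [disjoint blk p & blk r].

Lemma meetP p r : reflect (exists v, [/\ v \in C, v \in p & v \in r]) (meet p r).
Proof.
rewrite /meet -setI_eq0; apply: (iffP (set0Pn _)) => [[v]|[v [vC vp vr]]].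
  by rewrite in_setI !blk_mem => /andP[/andP[vC vp] /andP[_ vr]]; exists v.
by exists v; rewrite in_setI !blk_mem vC vp vr.
Qed.

Lemma meet_sym p r : meet p r = meet r p.
Proof. by rewrite /meet disjoint_sym. Qed.

Lemma blk_ex p : p \in P -> exists2 v, v \in C & v \in p.
Proof.
move=> pP; have /card_gt0P[v] : (0 < #|blk p|)%N by rewrite card_blk //; lia.
by rewrite blk_mem => /andP[]; exists v.
Qed.

Lemma meet_refl p : p \in P -> meet p p.
Proof. by move=> pP; have [v vC vp] := blk_ex pP; apply/meetP; exists v. Qed.

Lemma parallel_uniq p r s v : p \in P -> r \in P -> s \in P ->
  ~~ meet p r -> ~~ meet p s -> v \in C -> v \in r -> v \in s -> r = s.
Proof.
move=> pP rP sP /negPn pr /negPn ps vC vr vs.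
have vp : v \notin blk p by rewrite (disjointFl pr) // blk_mem vC vr.
have [t [_ _ _ u]] := playfair q_gt1 card_C blkC card_blk join join_uniq pP vC vp.
have vr' : v \in blk r by rewrite blk_mem vC.
have vs' : v \in blk s by rewrite blk_mem vC.
exact: etrans (u r rP vr' pr) (esym (u s sP vs' ps)).
Qed.

Lemma card_par p : p \in P -> #|[set r in P | ~~ meet p r]| = q.-1.
Proof.
move=> pP; rewrite -(card_parallel q_gt1 card_C blkC card_blk join join_uniq pP).
by congr #|pred_of_set _|; apply/setP => r; rewrite !inE negbK.
Qed.

(* [lin p] consists of the planes sharing an affine line with [p], [npt p] of those sharing a single
   affine point, not in [C]; [Aset] and [Cset] split [lin p] according to whether the shared line
   contains a point of [C]. *)
Definition lin p := [set r in P | (r != p) && (#|afs (p :&: r)%VS| == q)].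
Definition npt p := [set r in P | ~~ meet p r && (#|afs (p :&: r)%VS| == 1%N)].

Definition Aset p := [set r in lin p | meet p r].
Definition Cset p := [set r in lin p | ~~ meet p r].

Lemma card_ac p : (#|lin p| = #|Aset p| + #|Cset p|)%N.
Proof.
rewrite -(cardsID [set r | meet p r] (lin p)); congr (_ + _)%N.
  by congr #|pred_of_set _|; apply/setP => r; rewrite !inE andbC.
by congr #|pred_of_set _|; apply/setP => r; rewrite !inE andbC.
Qed.

(** * Counting the C-planes that meet a given one *)

Definition nonC p := afs p :\: C.

Lemma card_afs p : p \in P -> #|afs p| = (q ^ 2)%N.
Proof.
move=> pP; have [v vC vp] := blk_ex pP; have hv := C_aff vC.
have dp := dimP pP.
have [n [np n0 hn]] := dir_exists hv vp (ltnW (eq_leq (esym dp))).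
have [w wp wv] : exists2 w, w \in p & w \notin (<[n]> + <[v]>)%VS.
  apply/subvPn; apply: contraTN isT => /dimvS; rewrite dp dimv_line2 //.
  by apply/negP => /vlineP[k vE]; move: hv; rewrite vE hZ hn mulr0 => /esym/eqP; rewrite oner_eq0.
pose m := w - h w *: v.
have hm : h m = 0 by rewrite hB hZ hv mulr1 subrr.
have mp : m \in p by rewrite memvB ?memvZ.
have mn : m \notin <[n]>%VS.
  apply: contra wv => mn; rewrite -(subrK (h w *: v) w) memv_add //.
  by rewrite memvZ ?memv_line.
pose f (st : F * F) := v + (st.1 *: n + st.2 *: m).
have f_inj : injective f.
  move=> [s t] [s' t'] /addrI /= /eqP; rewrite -subr_eq0 opprD addrACA -!scalerBl.
  have [->|tt] := eqVneq t t'.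
    by rewrite subrr scale0r addr0 scaler_eq0 (negbTE n0) orbF subr_eq0 => /eqP->.
  rewrite addr_eq0 -scaleNr => /eqP E; case/negP: mn; apply/vlineP.
  exists (- (t - t')^-1 * (s - s')); rewrite -scalerA E scalerA mulrNN mulVf ?scale1r //.
  by rewrite subr_eq0.
have -> : afs p = [set f st | st : F * F].
  apply/setP => x; rewrite in_afs; apply/andP/imsetP => [[xp /eqP hx]|[[s t] _ ->]]; last first.
    by rewrite memvD ?memvD ?memvZ //= hD hD !hZ hn hm hv !mulr0 !addr0.
  have : x \in (<[v]> + (<[n]> + <[m]>))%VS.
    apply: (subvP (plane_sub dp hv hn hm n0 mn vp np mp _ _ _)) xp.
    - by rewrite (subvP (addvSl _ _)) ?memv_line.
    - by rewrite (subvP (addvSr _ _)) // (subvP (addvSl _ _)) ?memv_line.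
    by rewrite (subvP (addvSr _ _)) // (subvP (addvSr _ _)) ?memv_line.
  case/memv_addP=> _ /vlineP[a ->] [_ /memv_addP[_ /vlineP[b ->] [_ /vlineP[c ->] ->]] xE].
  exists (b, c) => //; rewrite xE /f /=; congr (_ + _).
  by move: hx; rewrite xE !hD !hZ hn hm hv !mulr0 !addr0 mulr1 => ->; rewrite scale1r.
by rewrite card_imset // card_prod card_F expnS expn1.
Qed.

Lemma card_nonC p : p \in P -> #|nonC p| = (q ^ 2 - q)%N.
Proof.
move=> pP; rewrite cardsD card_afs // -(card_blk pP); congr (_ - #|pred_of_set _|)%N.
apply/setP => v; rewrite !inE; case vC: (v \in C); rewrite ?andbF //.
by rewrite (C_aff vC) eqxx !andbT.
Qed.

(** A common line loses one point to [C] for a plane in [Aset p] and none for a plane in [Cset p]. A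
    single common point counts only if it is outside [C], hence the condition [~~ meet p r] in
    [npt]. *)
Lemma card_nonC_cap p r : p \in P -> r \in P -> r != p ->
  #|nonC p :&: afs r| = ((r \in Aset p) * q.-1 + (r \in Cset p) * q + (r \in npt p))%N.
Proof.
move=> pP rP rp; have pr : p != r by rewrite eq_sym.
have -> : nonC p :&: afs r = afs (p :&: r)%VS :\: (blk p :&: blk r).
  apply/setP => v; rewrite !inE memv_cap.
  by case: (v \in C); case: (v \in p); case: (v \in r); case: (h v == 1).
have sub : blk p :&: blk r \subset afs (p :&: r)%VS.
  apply/subsetP => v; rewrite in_setI !blk_mem in_afs memv_cap.
  by case/andP=> /andP[vC ->] /andP[_ ->]; rewrite C_aff /=.
rewrite cardsD (setIidPr sub) !inE rP rp /=.
have := card_blk_cap pP rP pr; have := subset_leq_card sub.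
have : (#|blk p :&: blk r| == 0%N) = ~~ meet p r by rewrite /meet negbK -setI_eq0 cards_eq0.
set m := #|blk p :&: blk r|.
case: (card_afs_cap pP rP pr) => [|| [+ _]] => ->; move: q_ge7;
  clear; case: (meet p r) => /=; do ?case: eqP => //=; lia.
Qed.

(** No point outside [C] is on three planes, so the planes of [X] meet [nonC p] in pairwise disjoint
    sets. *)
Lemma sum_nonC p (X : {set {vspace V}}) : p \in P -> X \subset P :\ p ->
  (\sum_(r in X) #|nonC p :&: afs r| = #|[set v in nonC p | [exists r in X, v \in r]]|)%N.
Proof.
move=> pP XP; have XP' r : r \in X -> r != p /\ r \in P.
  by move/(subsetP XP); rewrite !inE => /andP[].
transitivity (\sum_(r in X) \sum_(v in nonC p | v \in r) 1)%N.
  apply: eq_bigr => r _; rewrite -sum1_card; apply: eq_bigl => v; rewrite !inE.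
  by case: (h v == 1); rewrite ?andbF ?andbT.
rewrite (exchange_big_dep (fun v => (v \in nonC p) && [exists r in X, v \in r])) /=; last first.
  by move=> r v rX /andP[-> vr]; apply/existsP; exists r; rewrite rX.
rewrite -sum1_card; apply: eq_big => [v|v /andP[vT /existsP[r /andP[rX vr]]]].
  by rewrite !inE.
have [rp rP] := XP' _ rX; move: vT; rewrite !inE => /andP[vC /andP[vp hv]].
rewrite (big_pred1 r) // => s; rewrite !inE vC vp hv /=.
apply/andP/eqP => [[sX vs]|->]; last by [].
have [sp sP] := XP' _ sX.
have := no_three_planes (eqP hv) vC pP rP sP vp vr vs.
by rewrite eq_sym (negbTE rp) eq_sym (negbTE sp) /= => /eqP.
Qed.

(** By [two_planes] every point of [nonC p] is on a second plane, so the traces of the other planes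
    partition [nonC p]. *)
Lemma count_eq p : p \in P ->
  (#|Aset p| * q.-1 + #|Cset p| * q + #|npt p| = q ^ 2 - q)%N.
Proof.
move=> pP; rewrite -(card_nonC pP).
have -> : nonC p = [set v in nonC p | [exists r in P :\ p, v \in r]].
  apply/setP => v; rewrite [in RHS]inE; case vT: (v \in nonC p) => //=.
  move: vT; rewrite !inE => /andP[vC /andP[vp /eqP hv]].
  have [r [rP rp vr]] := two_planes hv vC pP vp.
  by apply/esym/existsP; exists r; rewrite !inE rp rP.
rewrite -sum_nonC // (eq_bigr (fun r => ((r \in Aset p) * q.-1 + (r \in Cset p) * q
   + (r \in npt p))%N)) => [|r]; last first.
  by rewrite in_setD1 => /andP[rp rP]; rewrite card_nonC_cap.
rewrite !big_split /= -!big_distrl /=.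
have cnt (X : {set {vspace V}}) : X \subset P :\ p -> (\sum_(r in P :\ p) (r \in X) = #|X|)%N.
  move=> XP; rewrite -sum1_card big_mkcond [in RHS]big_mkcond; apply: eq_bigr => r _.
  by case rX: (r \in X); rewrite ?(subsetP XP _ rX) //; case: ifP.
rewrite !cnt //; apply/subsetP => r; rewrite !inE.
- move=> /andP[-> /andP[m _]]; rewrite andbT; apply: contraNneq m => ->; exact: meet_refl.
- by case/andP=> /andP[-> /andP[-> _]].
- by case/andP=> /andP[-> /andP[-> _]].
Qed.

(** [Cset p] and [npt p] are disjoint and consist of parallels to [p], of which there are q - 1. *)
Lemma card_bc p : p \in P -> (#|Cset p| + #|npt p| <= q.-1)%N.
Proof.
move=> pP; rewrite -(card_par pP) -cardsUI (_ : Cset p :&: npt p = set0) ?cards0 ?addn0.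
  by apply/subset_leq_card/subsetP => r; rewrite !inE => /orP[/andP[/andP[-> _] ->]|/andP[-> /andP[->]]].
apply/setP => r; rewrite !inE; apply/negP.
by case/andP=> /andP[/and3P[_ _ /eqP->] _] /and3P[_ _ /eqP q1]; move: q_ge7; rewrite q1.
Qed.

(** With a, c, b the sizes of [Aset p], [Cset p], [npt p], the count reads (a + c)(q - 1) + (c + b)
    = q (q - 1), and c + b <= q - 1. *)
Lemma card_lin_ge p : p \in P -> (q.-1 <= #|lin p|)%N.
Proof.
move=> pP; rewrite card_ac; have := count_eq pP; have := card_bc pP.
move: #|Aset p| #|Cset p| #|npt p| q_ge7 => a b c; rewrite expnS expn1.
case: q => // k _; nia.
Qed.


(* Otherwise the shared lines would all pass through one point [X] of [C], and the points of
   the secants through [X] would be too numerous to be covered by the remaining planes. *)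
Lemma lin_dir p : p \in P ->
  exists n, [/\ n != 0, h n = 0, n \in p & forall r, r \in lin p -> n \in r].
Proof.
move=> pP.
have linP r : r \in lin p -> [/\ r \in P, r != p, \dim (p :&: r)%VS = 2%N &
    exists2 n, n != 0 /\ h n = 0 & forall v, (v \in p) && (v \in r) && (h v == 0) = (v \in <[n]>%VS)].
  rewrite !inE => /and3P[rP rp /eqP cE]; have pr : p != r by rewrite eq_sym.
  have [c0|c1|[_ d2]] := card_afs_cap pP rP pr.
  - by move: q_ge7; rewrite -cE c0.
  - by move: q_ge7; rewrite -cE c1.
  have /card_gt0P[v] : (0 < #|afs (p :&: r)%VS|)%N by rewrite cE (leq_trans _ q_ge7).
  rewrite in_afs => /andP[vU /eqP hv].
  have [n [nU n0 hn]] := dir_exists hv vU (eq_leq (esym d2)).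
  split=> //; exists n => // w; rewrite -memv_cap; apply/andP/idP => [[wU /eqP hw]|].
    apply: contraT => wn.
    have dW : (<[n]> + <[w]>)%VS = (p :&: r)%VS.
      by apply/eqP; rewrite eqEdim d2 dimv_line2 // subv_add -!memvE nU wU.
    move: vU; rewrite -dW => /memv_addP[_ /vlineP[a ->] [_ /vlineP[b ->] vE]].
    by move: hv (oner_neq0 F); rewrite vE hD !hZ hn hw !mulr0 addr0 => ->; rewrite eqxx.
  by case/vlineP=> k ->; rewrite memvZ // hZ hn mulr0 eqxx.
have [r1 r1L] : exists r, r \in lin p.
  by apply/card_gt0P; apply: leq_trans (card_lin_ge pP); case: (q) q_ge7 => // -[].
have [r1P r1p d1 [n1 [n10 hn1] n1E]] := linP r1 r1L.
have /andP[/andP[n1p n1r] _] : (n1 \in p) && (n1 \in r1) && (h n1 == 0).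
  by rewrite n1E memv_line.
have [/forall_inP all1|/forall_inPn[r2 r2L n1r2]] := boolP [forall r in lin p, n1 \in r].
  by exists n1.
have [r2P r2p d2 [n2 [n20 hn2] n2E]] := linP r2 r2L.
have r12 : r1 != r2 by apply: contraNneq n1r2 => <-.
(* The lines that [r] and [s] share with [p] lie in one plane, so they meet, possibly at
   infinity. *)
have capge r s : r \in lin p -> s \in lin p ->
    exists w, [/\ w != 0, w \in p, w \in r & w \in s].
  move=> /linP[_ _ dr _] /linP[_ _ ds _].
  have := dimv_cap_ge (capvSl p r) (capvSl p s); rewrite dr ds (dimP pP) => dc.
  have [|w] := @dimv_gt0_mem _ _ (p :&: r :&: (p :&: s))%VS; first by move: dc; clear; lia.
  by rewrite !memv_cap => /andP[/andP[wp wr] /andP[_ ws]] w0; exists w.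
(* An affine meeting point lies on three planes, hence in [C]. *)
have affine w r s : r \in lin p -> s \in lin p -> r != s -> w != 0 ->
    w \in p -> w \in r -> w \in s -> h w != 0 ->
    exists X, [/\ X \in C, X \in p, X \in r & X \in s].
  move=> rL sL rs w0 wp wr ws hw; have [rP rp _ _] := linP r rL; have [sP sp _ _] := linP s sL.
  exists ((h w)^-1 *: w); split; rewrite ?memvZ //; apply: contraT => XC.
  have hX : h ((h w)^-1 *: w) = 1 by rewrite hZ mulVf.
  have := no_three_planes hX XC pP rP sP; rewrite !memvZ // => /(_ isT isT isT).
  by rewrite eq_sym (negbTE rp) eq_sym (negbTE sp) (negbTE rs).
have n1_line w : w \in p -> w \in r1 -> h w = 0 -> w != 0 -> forall s, w \in s -> n1 \in s.
  move=> wp wr hw w0 s ws.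
  have : w \in <[n1]>%VS by rewrite -n1E wp wr hw eqxx.
  case/vlineP=> k wE; have k0 : k != 0 by apply: contraNneq w0 => k0; rewrite wE k0 scale0r.
  by rewrite -(scalerK k0 n1) -wE memvZ.
have [X [XC Xp Xr1 Xr2]] : exists X, [/\ X \in C, X \in p, X \in r1 & X \in r2].
  have [w [w0 wp wr1 wr2]] := capge _ _ r1L r2L.
  apply: (affine w) => //; apply: contraNneq n1r2 => hw; exact: (n1_line w).
have uniqX r Y : r \in lin p -> Y \in C -> Y \in p -> Y \in r -> X \in r -> Y = X.
  move=> /linP[rP rp _ _] YC Yp Yr Xr; apply: contraNeq rp => YX.
  by apply/eqP/esym; apply: (join_uniqP YX).
(* A line missing [X] would meet the lines of [r1] and [r2] at infinity, since an affine meeting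
   point is in [C] and so equal to [X]. It would then have both directions [n1] and [n2]. *)
have all_X r : r \in lin p -> X \in r.
  move=> rL; have [rP rp dr [n [n0 hn] nE]] := linP r rL.
  apply: contraT => Xr.
  have rr1 : r1 != r by apply: contraNneq Xr => <-.
  have rr2 : r2 != r by apply: contraNneq Xr => <-.
  have common s : s \in lin p -> s != r -> X \in s -> exists w, [/\ w != 0, w \in p, w \in s, w \in r & h w = 0].
    move=> sL sr Xs; have [w [w0 wp ws wr]] := capge _ _ sL rL.
    exists w; split=> //; apply/eqP; apply: contraT => hw.
    have [Y [YC Yp Ys Yr]] := affine w s r sL rL sr w0 wp ws wr hw.
    by rewrite -(uniqX s Y sL YC Yp Ys Xs) Yr in Xr.
  have [w1 [w10 w1p w1r1 w1r hw1]] := common _ r1L rr1 Xr1.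
  have n1r' := n1_line _ w1p w1r1 hw1 w10 _ w1r.
  have [w2 [w20 w2p w2r2 w2r hw2]] := common _ r2L rr2 Xr2.
  have : w2 \in <[n]>%VS by rewrite -nE w2p w2r hw2 eqxx.
  have : n1 \in <[n]>%VS by rewrite -nE n1p n1r' hn1 eqxx.
  case/vlineP=> a aE /vlineP[b bE]; case/negP: n1r2.
  have b0 : b != 0 by apply: contraNneq w20 => b0; rewrite bE b0 scale0r.
  by rewrite aE -(scalerK b0 n) -bE !memvZ.
have C0 : #|Cset p| = 0%N.
  apply: eq_card0 => r; apply/negP => /setIdP[rL /negP[]].
  by apply/meetP; exists X; rewrite XC Xp all_X.
(* The shared lines cover a (q - 1) points of [nonC p], where a is the size of [Aset p]. The points
   of [Y] left over number [#|npt p|], at most q - 1. *)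
pose Y := [set v in nonC p | ~~ [exists r in lin p, v \in r]].
have cY : (#|Y| <= q.-1)%N.
  have Lsub : lin p \subset P :\ p.
    by apply/subsetP => r; rewrite !inE => /and3P[-> ->].
  have := sum_nonC pP Lsub.
  rewrite (eq_bigr (fun=> q.-1)) => [|r rL]; last first.
    have [rP rp _ _] := linP _ rL; rewrite card_nonC_cap // !inE.
    move: (rL); rewrite inE => /and3P[-> -> /eqP->]; rewrite /= eqxx.
    have -> : meet p r by apply/meetP; exists X; rewrite XC Xp all_X.
    by rewrite /= mul1n mul0n !addn0.
  rewrite sum_nat_const card_ac C0 addn0 => E1.
  have := cardsID [set v | [exists r in lin p, v \in r]] (nonC p).
  rewrite (_ : _ :\: _ = Y); last by apply/setP => v; rewrite !inE andbC.
  rewrite (_ : _ :&: _ = [set v in nonC p | [exists r in lin p, v \in r]]); last first.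
    by apply/setP => v; rewrite !inE.
  rewrite -E1 card_nonC //.
  have := count_eq pP; have := card_bc pP; rewrite C0; move: #|Aset p| #|npt p| #|Y| q_ge7.
  by clear=> a b y; rewrite expnS expn1; case: q => // k; nia.
(* These are the points other than [X] and [Q] on the secants from [X] to [Q]. They all lie in [Y],
   because a shared line through such a point also contains [X], hence [Q]; and there are more than
   q - 1 of them. *)
pose f (Qt : V * F) := X + Qt.2 *: (Qt.1 - X).
pose D := setX (blk p :\ X) (~: [set 0; 1 : F]).
have XbP : X \in blk p by rewrite blk_mem XC.
have cD : #|D| = (q.-1 * (q - 2))%N.
  rewrite cardsX; congr (_ * _)%N.
    by have := cardsD1 X (blk p); rewrite XbP card_blk // => ->.
  by rewrite cardsCs setCK cards2 card_F eq_sym oner_neq0.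
have fD : f @: D \subset Y.
  apply/subsetP => _ /imsetP[[Q t] + ->]; rewrite !inE /f /= negb_or.
  case/andP=> /andP[QX /andP[QC Qp]] /andP[t0 t1].
  have hf : h (X + t *: (Q - X)) = 1 by rewrite hD hZ hB !C_aff // subrr mulr0 addr0.
  have fp : X + t *: (Q - X) \in p by rewrite memvD // memvZ // memvB.
  rewrite hf eqxx fp !andbT; apply/andP; split.
    apply/negP => fC.
    have fb : X + t *: (Q - X) \in blk p by rewrite blk_mem fC.
    have Qb : Q \in blk p by rewrite blk_mem QC.
    have XQ : X != Q by rewrite eq_sym.
    have Xf : X != X + t *: (Q - X).
      by rewrite -subr_eq0 opprD addrA subrr sub0r oppr_eq0 scaler_eq0 (negbTE t0) subr_eq0.
    have Qf : Q != X + t *: (Q - X).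
      rewrite -subr_eq0 opprD addrA -{1}[Q - X]scale1r -scalerBl scaler_eq0 !subr_eq0.
      by rewrite eq_sym (negbTE t1).
    have := arc pP XbP Qb fb XQ Xf Qf.
    by rewrite addrAC subrr add0r memvZ ?memv_line.
  apply/negP => /existsP[r /andP[rL fr]]; have Xr := all_X _ rL.
  case/eqP: QX; apply: (uniqX r) => //.
  have : Q - X \in r.
    by rewrite -(scalerK t0 (Q - X)) memvZ // -[_ *: _](addKr X) addrC memvB.
  by move=> QXr; rewrite -(subrK X Q) memvD.
have f_inj : {in D &, injective f}.
  move=> [Q s] [R t]; rewrite !inE /f /= !negb_or.
  case/andP=> /andP[QX /andP[QC Qp]] /andP[s0 _] /andP[/andP[RX /andP[RC Rp]] /andP[t0 _]].
  move/addrI => E; have QR : Q = R.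
    apply/eqP; apply: contraT => QR.
    have Qb : Q \in blk p by rewrite blk_mem QC.
    have Rb : R \in blk p by rewrite blk_mem RC.
    rewrite eq_sym in QX; rewrite eq_sym in RX.
    have := arc pP XbP Qb Rb QX RX QR.
    by rewrite -(scalerK t0 (R - X)) -E !memvZ ?memv_line.
  move: E; rewrite QR => /eqP; rewrite -subr_eq0 -scalerBl scaler_eq0 (subr_eq0 R) (negbTE RX).
  by rewrite orbF subr_eq0 => /eqP->.
have := leq_trans (subset_leq_card fD) cY; rewrite card_in_imset // cD.
by move: q_ge7; clear; case: q => // k k7 /=; nia.
Qed.

(** * No solid contains three C-planes *)

Lemma card_bigcup_le (I T : finType) (A : {pred I}) (B : I -> {set T}) :
  (#|\bigcup_(i in A) B i| <= \sum_(i in A) #|B i|)%N.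
Proof.
elim/big_rec2: _ => [|i n X _ IH]; first by rewrite cards0.
by rewrite (leq_trans (leq_card_setU _ _)) // leq_add2l.
Qed.

(** Three points of the arc [blk r] already span [r]. *)
Lemma card_blk_solid_le r U : r \in P -> ~~ (r <= U)%VS -> (#|[set v in blk r | v \in U]| <= 2)%N.
Proof.
move=> rP; apply: contraNT; rewrite -ltnNge => /card_gt2P[u [v [w []]]].
move=> [/setIdP[ub uU] /setIdP[vb vU] /setIdP[wb wU]] [uv vw wu].
by apply: (plane_sub_arc rP ub vb wb); rewrite // eq_sym.
Qed.

Lemma card_Aset_le p : p \in P -> (#|Aset p| <= q)%N.
Proof.
move=> pP; have := count_eq pP; move: #|Aset p| #|Cset p| #|npt p| q_ge7.
by clear=> a b c; rewrite expnS expn1; case: q => // k; nia.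
Qed.

(* Through a point of [C] outside the solid there are only [q + 1] planes, each with at most two
   points in the solid, while three planes have [3 q - 3] points: this is where [7 <= q] is used. *)
Lemma no_three_in_solid U p r s : \dim U = 4%N -> p \in P -> r \in P -> s \in P ->
  p != r -> p != s -> r != s -> (p <= U)%VS -> (r <= U)%VS -> (s <= U)%VS -> False.
Proof.
move=> dU pP rP sP pr ps rs pU rU sU.
pose CU := [set v in C | v \in U].
have blkU t : t \in P -> (t <= U)%VS -> blk t \subset CU.
  by move=> tP tU; apply/subsetP => v; rewrite !inE => /andP[-> vt]; rewrite (subvP tU).
(* If the solid contains all of [C], it contains every plane of [P], and two planes with a common
   point in [C] then share a line. Two points of [p] would give 2 q planes in [Aset p], which has at
   most q elements. *)
have [/forall_inP CsU|/forall_inPn[v vC vU]] := boolP [forall v in C, v \in U].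
  have allU t : t \in P -> (t <= U)%VS.
    move=> tP; apply/idPn => /(card_blk_solid_le tP).
    rewrite (_ : [set v in blk t | v \in U] = blk t) ?card_blk //.
      by apply/negP; rewrite -ltnNge (leq_trans _ q_ge7).
    by apply/setP => v; rewrite !inE; case vC: (v \in C); rewrite //= (CsU v vC) andbT.
  have AsetE t : t \in P -> t != p -> meet p t -> t \in Aset p.
    move=> tP tp ptm; rewrite !inE tP tp ptm andbT.
    have pt : p != t by rewrite eq_sym.
    have /meetP[v [vC vp vt]] := ptm.
    have := dimv_cap_ge pU (allU t tP); rewrite dU (dimP pP) (dimP tP).
    move=> d6; have d2 : (1 < \dim (p :&: t)%VS)%N by move: d6; clear; lia.
    have d2' : \dim (p :&: t)%VS = 2%N.
      apply/eqP; rewrite eqn_leq d2 andbT.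
      have /dimv_cap_lt := vspace_neq_sub (etrans (dimP pP) (esym (dimP tP))) pt.
      by rewrite (dimP pP).
    have vU : v \in (p :&: t)%VS by rewrite memv_cap vp.
    have [m [mU m0 hm]] := dir_exists (C_aff vC) vU d2.
    by rewrite (afs_line (C_aff vC) hm vU mU m0 d2') card_line ?eqxx.
  have /card_gt1P[x [y [xb yb xy]]] : (1 < #|blk p|)%N by rewrite card_blk.
  move: (xb) (yb); rewrite !blk_mem => /andP[xC xp] /andP[yC yp].
  pose N z := [set t in P | z \in t] :\ p.
  have cN z : z \in C -> z \in p -> #|N z| = q.
    move=> zC zp; have := card_planes_on zC; rewrite (cardsD1 p) -/(N z).
    by rewrite inE pP zp => -[].
  have sub : N x :|: N y \subset Aset p.
    apply/subsetP => t; rewrite in_setU => /orP[] /setD1P[tp] /setIdP[tP zt];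
      apply: AsetE => //; apply/meetP; solve [by exists x | by exists y].
  have dis : N x :&: N y = set0.
    apply/setP => t; rewrite [in RHS]inE; apply/negP => /setIP[/setD1P[tp /setIdP[tP xt]]].
    case/setD1P=> _ /setIdP[_ yt]; case/eqP: tp; exact: (join_uniqP xy).
  have := leq_trans (subset_leq_card sub) (card_Aset_le pP).
  rewrite cardsU dis cards0 subn0 !cN //; move: q_ge7; clear; lia.
have cU : (3 * q <= #|CU| + 3)%N.
  have sub : (blk p :|: blk r) :|: blk s \subset CU by rewrite !subUset !blkU.
  have c1 := card_blk_cap pP rP pr.
  have c2 : (#|(blk p :|: blk r) :&: blk s| <= 2)%N.
    rewrite setIUl (leq_trans (leq_card_setU _ _)) // -[2%N]/(1 + 1)%N.
    by rewrite leq_add // card_blk_cap.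
  have c0 : (#|blk p :&: blk r| <= q)%N.
    by rewrite -[X in (_ <= X)%N](card_blk pP) subset_leq_card // subsetIl.
  have := subset_leq_card sub; rewrite cardsU (cardsU (blk p)) (card_blk pP) (card_blk rP) (card_blk sP).
  move: c1 c2 c0; move: #|blk p :&: blk r| #|_ :&: _| #|CU| q_ge7; clear; lia.
(* Together with [cU] this gives 3 q - 3 <= 2 q + 2, that is q <= 5. *)
have : (#|CU| <= q.+1 * 2)%N.
  rewrite -(card_planes_on vC) -sum_nat_const.
  apply: leq_trans (leq_trans (card_bigcup_le (mem [set t in P | v \in t]) (fun t => [set w in blk t | w \in U])) _).
    apply/subset_leq_card/subsetP => w /setIdP[wC wU].
    have wv : w != v by apply: contraNneq vU => <-.
    have [t [tP wt vt]] := joinP wC vC wv.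
    by apply/bigcupP; exists t; rewrite inE ?tP // blk_mem wC wt wU.
  apply: leq_sum => t; rewrite inE => /andP[tP vt]; apply: card_blk_solid_le => //.
  by apply: contra vU => /subvP->.
move: cU q_ge7; move: #|CU|; clear; lia.
Qed.

(** * Parallel classes with a common direction *)

Lemma meet_affine_line p r v n : p \in P -> r \in P -> v \in C -> v \in p -> v \in r ->
  n != 0 -> h n = 0 -> n \in p -> n \in r -> p != r -> r \in Aset p.
Proof.
move=> pP rP vC vp vr n0 hn np nr pr.
have m : meet p r by apply/meetP; exists v.
rewrite !inE rP m andbT [r == p]eq_sym pr /=.
have [c|c|[-> _ //]] := card_afs_cap pP rP pr; exfalso.
  by move/eqP: c; rewrite cards_eq0 => /eqP/setP/(_ v); rewrite in_afs in_set0 memv_cap vp vr C_aff //= eqxx.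
move/eqP/cards1P: c => [x xE].
have: v \in [set x] by rewrite -xE in_afs memv_cap vp vr C_aff /=.
have: v + n \in [set x] by rewrite -xE in_afs memv_cap !memvD // hD hn addr0 C_aff /=.
by rewrite !in_set1 => /eqP <- /eqP /(canLR (addKr _)) /esym/eqP; rewrite addNr (negbTE n0).
Qed.

Lemma lin_sym p r : p \in P -> r \in lin p -> p \in lin r.
Proof. by move=> pP; rewrite !inE pP eq_sym capvC => /and3P[_ -> ->]. Qed.

(* The lines shared with the planes of [Cset p] contain no point of [C], so the [q] points of [C]
   on [p] are on the remaining lines of direction [n], at most two on each. *)
Lemma card_Aset_ge2 p : p \in P -> (1 < #|Aset p|)%N.
Proof.
move=> pP; have [n [n0 hn np lin_n]] := lin_dir pP.
pose L := [set v in afs p | [exists k in blk p, v - k \in <[n]>%VS]].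
(* Each of the q points of the arc contributes the q points of its line of direction [n], and a
   point of [L] is counted at most twice. *)
have cL : (q * q <= 2 * #|L|)%N.
  rewrite -[X in (X * _ <= _)%N](card_blk pP) -sum_nat_const.
  have -> : (\sum_(k in blk p) q = \sum_(k in blk p) \sum_(v in L | (v - k)%R \in <[n]>%VS) 1)%N.
    apply: eq_bigr => k kb; rewrite sum1dep_card -(card_line k n0).
    move: (kb); rewrite blk_mem => /andP[kC kp].
    congr #|pred_of_set _|; apply/setP => v; rewrite in_set.
    apply/imsetP/andP => [[t _ ->]|[_ /vlineP[t E]]]; last by exists t; rewrite // -E addrC subrK.
    have kt : k + t *: n - k \in <[n]>%VS by rewrite addrAC subrr add0r memvZ ?memv_line.
    split=> //; rewrite inE in_afs memvD ?memvZ // hD hZ hn mulr0 addr0 C_aff // eqxx /=.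
    by apply/existsP; exists k; rewrite kb.
  rewrite (exchange_big_dep (mem L)) /=; last by move=> ? ? _ /andP[].
  rewrite mulnC -sum_nat_const; clearbody L; apply: leq_sum => v vL; rewrite sum1dep_card leqNgt.
  apply/negP => /card_gt2P[a [b [c [[]]]]]; rewrite !inE vL /=.
  case/andP=> /andP[aC ap] va /andP[/andP[bC bp] vb] /andP[/andP[cC cp] vc] [ab bc ca].
  have [aB bB cB] : [/\ a \in blk p, b \in blk p & c \in blk p] by rewrite !blk_mem aC bC cC.
  have ac : a != c by rewrite eq_sym.
  have := arc pP aB bB cB ab ac bc; case/negP.
  have dE x y : x - y = (v - y) - (v - x) by rewrite opprB [RHS]addrC addrA subrK.
  have /vlineP[t tE] : b - a \in <[n]>%VS.
    by rewrite dE memvB.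
  have t0 : t != 0 by apply: contraNneq ab => t0; rewrite eq_sym -subr_eq0 tE t0 scale0r.
  have /vlineP[u uE] : c - a \in <[n]>%VS.
    by rewrite dE memvB.
  rewrite uE tE (_ : u *: n = (u / t) *: (t *: n)); last by rewrite scalerA mulfVK.
  by rewrite memvZ ?memv_line.
have Csub : Cset p \subset P :\ p.
  by apply/subsetP => r; rewrite !inE => /andP[/and3P[-> ->]].
have cC := sum_nonC pP Csub.
rewrite (eq_bigr (fun=> q)) in cC; last first.
  move=> r rC; have := subsetP Csub _ rC; rewrite !inE => /andP[rp rP].
  rewrite card_nonC_cap // rC mul1n; move: rC; rewrite !inE => /andP[/and3P[-> -> /eqP->] m].
  by rewrite (negbTE m) /= andbF mul0n add0n gtn_eqF ?addn0.
have : (#|L| + #|Cset p| * q <= q ^ 2)%N.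
  rewrite -(card_afs pP) -[X in (_ + X)%N]sum_nat_const cC -cardsUI.
  rewrite (_ : L :&: _ = set0) ?cards0 ?addn0.
    by apply/subset_leq_card/subsetP => v; rewrite !inE => /orP[/andP[]//|/andP[/andP[_ //]]].
  apply/setP => v; rewrite [in RHS]inE; apply/negP => /setIP[/setIdP[_ /existsP[k /andP[kb vk]]]].
  case/setIdP=> _ /existsP[r /andP[rC vr]].
  move: rC => /setIdP[rL /negP[]]; move: kb; rewrite blk_mem => /andP[kC kp].
  apply/meetP; exists k; split=> //.
  rewrite -[k](subKr v) memvB //; case/vlineP: vk => t ->; rewrite memvZ //; exact: lin_n.
(* So far [Cset p] has at most q / 2 elements, while [lin p] has at least q - 1. *)
have := card_lin_ge pP; rewrite card_ac.
move: cL q_ge7; rewrite expnS expn1; move: #|L| #|Aset p| #|Cset p|; clear => l a c.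
case: q => // k; nia.
Qed.

Lemma Aset_sym p r : p \in P -> r \in Aset p -> p \in Aset r.
Proof. by move=> pP /setIdP[rL m]; rewrite inE lin_sym // meet_sym. Qed.

Lemma AsetP p r : r \in Aset p -> [/\ r \in P, r != p & exists v, [/\ v \in C, v \in p & v \in r]].
Proof. by case/setIdP=> + /meetP m; rewrite !inE => /and3P[-> ->]. Qed.

(** All three planes contain the direction [n] of [p]. A common point [w] of [r] and [s] in [C] is
    off [p], since otherwise [w + n] would be a point outside [C] on three planes; but then [p], [r]
    and [s] lie in the solid [p + <[w]>]. *)
Lemma Aset_disjoint p r s : p \in P -> r \in Aset p -> s \in Aset p -> r != s -> ~~ meet r s.
Proof.
move=> pP rA sA rs; have [n [n0 hn np lin_n]] := lin_dir pP.
have [rP rp [u [uC up ur]]] := AsetP rA; have [sP sp [v [vC vp vs]]] := AsetP sA.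
have nr : n \in r by apply: lin_n; case/setIdP: rA.
have ns : n \in s by apply: lin_n; case/setIdP: sA.
apply/negP => /meetP[w [wC wr ws]].
have uniq x y t : x \in C -> y \in C -> x \in p -> y \in p -> t \in P -> t != p ->
    x \in t -> y \in t -> x = y.
  move=> xC yC xp yp tP tp xt yt; apply: contraNeq tp => xy; apply/eqP.
  exact: (join_uniqP xy).
have wp : w \notin p.
  apply/negP => wp.
  have hwn : h (w + n) = 1 by rewrite hD hn addr0 C_aff.
  have wnC : w + n \notin C.
    apply/negP => wnC; have : w = w + n by apply: (uniq w (w + n) r); rewrite ?memvD.
    by move/(canLR (addKr _))/esym/eqP; rewrite addNr (negbTE n0).
  have := no_three_planes hwn wnC pP rP sP; rewrite !memvD // => /(_ isT isT isT).
  by rewrite eq_sym (negbTE rp) eq_sym (negbTE sp) (negbTE rs).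
have sub t x : t \in P -> x \in C -> x \in p -> x \in t -> n \in t -> w \in t -> (t <= p + <[w]>)%VS.
  move=> tP xC xp xt nt wt.
  have wx0 : h (w - x) = 0 by rewrite hB !C_aff // subrr.
  have xU : x \in (p + <[w]>)%VS by rewrite (subvP (addvSl _ _)).
  have wU : w \in (p + <[w]>)%VS by rewrite (subvP (addvSr _ _)) ?memv_line.
  apply: (plane_sub (u := x) (v := n) (n := w - x)) => //; try exact: memvB; try exact: C_aff.
  - exact: dimP.
  - apply: contra wp => /vlineP[t' E]; rewrite -(subrK x w) E memvD ?memvZ //.
  - by rewrite (subvP (addvSl _ _)).
apply: (@no_three_in_solid (p + <[w]>)%VS p r s) => //; rewrite 1?[p == _]eq_sym //.
- rewrite dimv_disjoint_sum ?(dimP pP) ?dim_vline ?(aff_neq0 (C_aff wC)) //.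
  apply/eqP; rewrite -subv0; apply/subvP => x; rewrite memv_cap => /andP[xp /vlineP[k xE]].
  rewrite memv0 xE scaler_eq0; apply/orP; left; apply: contraNT wp => k0.
  by rewrite -(scalerK k0 w) -xE memvZ.
- exact: addvSl.
- exact: (sub r u).
- exact: (sub s v).
Qed.

(* If [r] in [Aset p], the planes of [Aset r] are parallel to [p] and share the direction [n];
   a further affine common point would put [p], [r] and such a plane into one solid. *)
Lemma parallel_empty p : p \in P -> #|Aset p| = q /\ Cset p = set0 /\ npt p = set0.
Proof.
move=> pP.
have [r rA] : exists r, r \in Aset p by apply/card_gt0P/ltnW/card_Aset_ge2.
have [rP rp [u [uC up ur]]] := AsetP rA.
have [n [n0 hn nr lin_n]] := lin_dir rP.
have pA := Aset_sym pP rA.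
have np : n \in p by apply: lin_n; case/setIdP: pA.
have [s sA sp] : exists2 s, s \in Aset r & s != p.
  have /card_gt1P[s [t [sA tA st]]] := card_Aset_ge2 rP.
  by have [tp|] := eqVneq t p; [exists s; rewrite // -tp|exists t].
have [sP sr [v [vC vr vs]]] := AsetP sA.
have ps : ~~ meet p s by apply: (Aset_disjoint rP) => //; rewrite eq_sym.
have ns : n \in s by apply: lin_n; case/setIdP: sA.
(* A common affine point together with [n] makes [p :&: s] a line and [p + s] a solid, which
   contains [r] by way of [u], [v] and [n]. *)
have empty : afs (p :&: s)%VS = set0.
  apply/eqP; apply: contraT => /set0Pn[x]; rewrite in_afs memv_cap => /andP[/andP[xp xs] /eqP hx].
  have pneqs : p != s by rewrite eq_sym.
  have d2 : \dim (p :&: s)%VS = 2%N.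
    apply/eqP; rewrite eqn_leq; apply/andP; split.
      have /dimv_cap_lt := vspace_neq_sub (etrans (dimP pP) (esym (dimP sP))) pneqs.
      by rewrite (dimP pP).
    have dnx : \dim (<[n]> + <[x]>) = 2%N.
      apply: dimv_line2 => //.
      by apply/negP => /vlineP[k xE]; move: hx; rewrite xE hZ hn mulr0 => /esym/eqP; rewrite oner_eq0.
    have sub : (<[n]> + <[x]> <= p :&: s)%VS by rewrite subv_add -!memvE !memv_cap np ns xp.
    by have := dimvS sub; rewrite dnx.
  exfalso; apply: (@no_three_in_solid (p + s)%VS p r s) => //; rewrite 1?[p == _]eq_sym //.
  - by have := dimv_sum_cap p s; rewrite d2 (dimP pP) (dimP sP) => /(@addIn 2 _ 4).
  - by rewrite eq_sym.
  - exact: addvSl.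
  - have uU : u \in (p + s)%VS by rewrite (subvP (addvSl _ _)).
    have vU : v \in (p + s)%VS by rewrite (subvP (addvSr _ _)).
    apply: (plane_sub (u := u) (v := n) (n := v - u)) => //; try exact: memvB; try exact: C_aff.
    + exact: dimP.
    + by rewrite hB !C_aff // subrr.
    + apply: contra ps => /vlineP[k vE]; apply/meetP; exists v; split=> //.
      by rewrite -(subrK u v) vE memvD ?memvZ.
    + by rewrite (subvP (addvSl _ _)).
  - exact: addvSr.
(* [s] is a parallel to [p] outside [Cset p] and [npt p], which sharpens [card_bc] by one. *)
have bc : (#|Cset p| + #|npt p| < q.-1)%N.
  rewrite -(card_par pP) [X in (_ < X)%N](cardsD1 s) inE sP ps add1n ltnS.
  rewrite -cardsUI (_ : Cset p :&: npt p = set0) ?cards0 ?addn0.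
    apply/subset_leq_card/subsetP => t tX; rewrite in_setD1 in_set.
    have -> : t != s.
      have q0 : (0 == q)%N = false by move: q_ge7; clear; case: q.
      by apply: contraTneq tX => ->; rewrite !inE empty cards0 q0 !andbF.
    by move: tX; rewrite !inE => /orP[/andP[/andP[-> _] ->]|/andP[-> /andP[->]]].
  apply/setP => t; rewrite !inE; apply/negP.
  by case/andP=> /andP[/and3P[_ _ /eqP->] _] /and3P[_ _ /eqP q1]; move: q_ge7; rewrite q1.
(* In (a + c)(q - 1) + (c + b) = q (q - 1), the term c + b is divisible by q - 1 and now smaller
   than it, hence 0. *)
have : #|Aset p| = q /\ (#|Cset p| + #|npt p| = 0)%N.
  have := count_eq pP; move: bc q_ge7; move: #|Aset p| #|Cset p| #|npt p|; clear => a c b.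
  rewrite expnS expn1; case: q => // k /= bc k6 E.
  have {}E : ((a + c) * k + (c + b) = k.+1 * k)%N by nia.
  by case: (ltngtP (a + c)%N k.+1) => ac; nia.
by case=> -> /eqP; rewrite addn_eq0 !cards_eq0 => /andP[/eqP-> /eqP->].
Qed.

(** Two independent common directions and a common affine point would span the whole plane. *)
Lemma dir_prop p r v n n' : p \in P -> r \in P -> p != r -> h v = 1 -> v \in p -> v \in r ->
  n != 0 -> h n = 0 -> n \in p -> n \in r -> h n' = 0 -> n' \in p -> n' \in r -> n' \in <[n]>%VS.
Proof.
move=> pP rP pr hv vp vr n0 hn np nr hn' np' nr'; apply: contraNT pr => nn'.
rewrite eqEdim (dimP pP) (dimP rP) andbT.
exact: (plane_sub (dimP pP) hv hn hn' n0 nn').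
Qed.

Lemma memv_line_sym n n' : n' != 0 -> n' \in <[n]>%VS -> n \in <[n']>%VS.
Proof.
move=> n'0 /vlineP[k E]; have k0 : k != 0 by apply: contraNneq n'0 => k0; rewrite E k0 scale0r.
by rewrite -(scalerK k0 n) -E memvZ ?memv_line.
Qed.

(** Both [r] and [r'] are in [lin p], so the two directions agree with the one from [lin_dir]. *)
Lemma dir_unique p r r' v v' n n' : p \in P -> r \in P -> r' \in P -> p != r -> p != r' ->
  v \in C -> v \in p -> v \in r -> v' \in C -> v' \in p -> v' \in r' ->
  n != 0 -> h n = 0 -> n \in p -> n \in r -> n' != 0 -> h n' = 0 -> n' \in p -> n' \in r' ->
  n \in <[n']>%VS.
Proof.
move=> pP rP r'P pr pr' vC vp vr v'C v'p v'r n0 hn np nr n'0 hn' n'p n'r.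
have [m [m0 hm mp lin_m]] := lin_dir pP.
have rA := meet_affine_line pP rP vC vp vr n0 hn np nr pr.
have rA' := meet_affine_line pP r'P v'C v'p v'r n'0 hn' n'p n'r pr'.
have mr : m \in r by apply: lin_m; case/setIdP: rA.
have mr' : m \in r' by apply: lin_m; case/setIdP: rA'.
have := dir_prop pP rP pr (C_aff vC) vp vr n0 hn np nr hm mp mr.
have := dir_prop pP r'P pr' (C_aff v'C) v'p v'r n'0 hn' n'p n'r hm mp mr'.
by move=> mn' /(memv_line_sym m0)/vlineP[k ->]; rewrite memvZ.
Qed.

(** [Aset p] consists of q planes with disjoint arcs of q points each, which exhaust the q^2 points
    of [C]. *)
Lemma Aset_cover p v : p \in P -> v \in C -> exists2 r, r \in Aset p & v \in r.
Proof.
move=> pP vC; have [cA _] := parallel_empty pP.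
have : \bigcup_(r in Aset p) blk r = C.
  apply/eqP; rewrite eqEcard; apply/andP; split.
    by apply/bigcupsP => r /AsetP[rP _ _]; apply: blkC.
  rewrite card_C -[X in (X <= _)%N]mulnn -{1}cA -sum_nat_const.
  have tI : trivIset [set blk r | r in Aset p].
    apply/trivIsetP => _ _ /imsetP[r rA ->] /imsetP[s sA ->] rs.
    have {}rs : r != s by apply: contraNneq rs => ->.
    by have := Aset_disjoint pP rA sA rs; rewrite negbK.
  have <- : cover [set blk r | r in Aset p] = \bigcup_(r in Aset p) blk r.
    by rewrite cover_imset.
  rewrite -(eqP tI) big_imset /=; last first.
    move=> r s rA sA E; apply/eqP; apply: contraT => rs.
    have := Aset_disjoint pP rA sA rs; rewrite negbK E -setI_eq0 setIid.
    have [sP _ _] := AsetP sA.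
    by rewrite -cards_eq0 card_blk // => /eqP q0; move: q_ge7; rewrite q0.
  by apply: leq_sum => r /AsetP[rP _ _]; rewrite card_blk.
by move/setP/(_ v); rewrite vC => /bigcupP[r rA]; rewrite blk_mem => /andP[_ vr]; exists r.
Qed.

(** Two parallel classes of the affine plane formed by [C], all of whose planes contain the
    direction [n]. Parallelism is spelled out: each class covers [C] with disjoint arcs, and a plane
    of one class meets every plane of the other in [C]. *)
Definition grid n (K1 K2 : {set {vspace V}}) := [/\ n != 0, h n = 0,
  forall r, r \in K1 :|: K2 -> r \in P /\ n \in r,
  forall v, v \in C -> exists r s, [/\ r \in K1, s \in K2, v \in r & v \in s] &
  [/\ forall r s v, r \in K1 -> s \in K1 -> v \in C -> v \in r -> v \in s -> r = s,
      forall r s v, r \in K2 -> s \in K2 -> v \in C -> v \in r -> v \in s -> r = s &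
      forall r s, r \in K1 -> s \in K2 ->
        r != s /\ exists v, [/\ v \in C, v \in r & v \in s]]].

Lemma grid_sym n K1 K2 : grid n K1 K2 -> grid n K2 K1.
Proof.
case=> n0 hn KP cov [u1 u2 m]; split=> //.
- by move=> r; rewrite setUC; apply: KP.
- by move=> v /cov[r [s [? ? ? ?]]]; exists s, r.
- split=> // r s r2 s1; have [sr [v [? ? ?]]] := m s r s1 r2.
  by rewrite eq_sym; split=> //; exists v.
Qed.

(** For [r] in [Aset p] the classes are [Aset r], which contains [p], and [Aset p]. Their directions
    agree because [p] and [r] share only one. *)
Lemma grid_exists p : p \in P -> exists n K1 K2, grid n K1 K2 /\ p \in K1.
Proof.
move=> pP.
have [r rA] : exists r, r \in Aset p by apply/card_gt0P/ltnW/card_Aset_ge2.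
have [rP rp [u [uC up ur]]] := AsetP rA.
have pA := Aset_sym pP rA.
have [n [n0 hn np lin_n]] := lin_dir pP.
have [m [m0 hm mr lin_m]] := lin_dir rP.
have nr : n \in r by apply: lin_n; case/setIdP: rA.
have mp : m \in p by apply: lin_m; case/setIdP: pA.
have /vlineP[k nE] : n \in <[m]>%VS.
  by apply: (dir_prop pP rP _ (C_aff uC)) => //; rewrite eq_sym.
exists n, (Aset r), (Aset p); split=> //; split=> //.
- move=> s /setUP[] sA; have [sP _ _] := AsetP sA; split=> //.
    by rewrite nE memvZ // lin_m //; case/setIdP: sA.
  by rewrite lin_n //; case/setIdP: sA.
- move=> v vC; have [s sA vs] := Aset_cover rP vC; have [t tA vt] := Aset_cover pP vC.
  by exists s, t.
- have uniq q0 s t v : q0 \in P -> s \in Aset q0 -> t \in Aset q0 -> v \in C -> v \in s -> v \in t -> s = t.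
    move=> q0P sA tA vC vs vt; apply/eqP; apply: contraT => st.
    by case/negP: (Aset_disjoint q0P sA tA st); apply/meetP; exists v.
  split=> [s t v|s t v|s t sA tA]; [exact: uniq | exact: uniq |].
  have [sP sr sm] := AsetP sA; have [tP tp tm] := AsetP tA.
  have [tr|tr] := eqVneq t r.
    by rewrite tr sr; split=> //; case: sm => v [? ? ?]; exists v.
  have st : meet s t.
    apply: contraT => st; case/eqP: sr; case: sm => v [vC vr vs].
    apply: (@parallel_uniq t s r v) => //; rewrite 1?meet_sym //.
    by rewrite meet_sym; apply: (Aset_disjoint pP).
  split; last exact/meetP.
  apply: contraNneq (Aset_disjoint pP tA rA tr) => <-; rewrite meet_sym.
  by apply/meetP.
Qed.

(** Both planes of the grid on [v] contain [n], so both would contain [v + t *: n]. Hence [C]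
    projects injectively from [n]. *)
Lemma grid_mod n K1 K2 r v t : grid n K1 K2 -> r \in K1 -> v \in C -> v + t *: n \in C -> t = 0.
Proof.
case=> n0 hn KP cov [u1 u2 m] rK vC vtC; apply/eqP; apply: contraT => t0.
have [s [s' [s1 s2 vs vs']]] := cov v vC.
have [sP ns] : s \in P /\ n \in s by apply: KP; rewrite inE s1.
have [s'P ns'] : s' \in P /\ n \in s' by apply: KP; rewrite inE s2 orbT.
have [ss' _] := m s s' s1 s2; case/eqP: ss'.
apply: (@join_uniqP v (v + t *: n)) => //; rewrite ?memvD ?memvZ //.
by rewrite -subr_eq0 opprD addrA subrr sub0r oppr_eq0 scaler_eq0 negb_or t0.
Qed.

(** By [grid_mod] the q points of [blk p] have distinct coordinates along [e], so every element of
    [F] occurs as one. *)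
Lemma grid_row n K1 K2 p o e : grid n K1 K2 -> p \in K1 -> o \in C -> o \in p ->
  e \in p -> h e = 0 -> e \notin <[n]>%VS ->
  (forall v, v \in C -> v \in p -> exists y t, v = o + (y *: e + t *: n)) /\
  (forall y, exists t, o + (y *: e + t *: n) \in C).
Proof.
move=> G pK oC op ep he en; have [n0 hn KP cov [u1 u2 m]] := G.
have [pP np] : p \in P /\ n \in p by apply: KP; rewrite inE pK.
have dec v : v \in C -> v \in p -> exists y t, v = o + (y *: e + t *: n).
  move=> vC vp.
  have : v \in (<[o]> + (<[n]> + <[e]>))%VS.
    apply: (subvP (plane_sub (dimP pP) (C_aff oC) hn he n0 en op np ep _ _ _)) vp.
    - by rewrite (subvP (addvSl _ _)) ?memv_line.
    - by rewrite (subvP (addvSr _ _)) // (subvP (addvSl _ _)) ?memv_line.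
    by rewrite (subvP (addvSr _ _)) // (subvP (addvSr _ _)) ?memv_line.
  case/memv_addP=> _ /vlineP[a ->] [_ /memv_addP[_ /vlineP[b ->] [_ /vlineP[c ->] ->]] E].
  exists c, b; have := C_aff vC; rewrite E !hD !hZ hn he (C_aff oC) !mulr0 !addr0 mulr1 => ->.
  by rewrite scale1r [b *: n + _]addrC.
split=> // y.
pose yc v := odflt 0 [pick y | [exists t, v == o + (y *: e + t *: n)]].
have ycP v : v \in C -> v \in p -> exists t, v = o + (yc v *: e + t *: n).
  move=> vC vp; rewrite /yc; case: pickP => [z /existsP[t /eqP->]|no]; first by exists t.
  have [z [t E]] := dec v vC vp; have /existsP[] := no z.
  by exists t; rewrite E.
have inj : {in blk p &, injective yc}.
  move=> v w; rewrite !blk_mem => /andP[vC vp] /andP[wC wp] E.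
  have [t vE] := ycP v vC vp; have [s wE] := ycP w wC wp.
  have wE' : w = v + (s - t) *: n by rewrite vE wE E -!addrA -scalerDl [t + _]addrC subrK.
  by move: (wC); rewrite wE' => /(grid_mod G pK vC) ->; rewrite scale0r addr0.
have : yc @: blk p = [set: F].
  by apply/eqP; rewrite eqEcard subsetT cardsT card_F card_in_imset // (card_blk pP) leqnn.
move/setP/(_ y); rewrite in_setT => /imsetP[v]; rewrite blk_mem => /andP[vC vp] ->.
by have [t E] := ycP v vC vp; exists t; rewrite -E.
Qed.

Lemma plane_dir p o n : p \in P -> o \in p -> h o = 1 ->
  exists e, [/\ e \in p, h e = 0 & e \notin <[n]>%VS].
Proof.
move=> pP op ho.
have [w wp wU] : exists2 w, w \in p & w \notin (<[n]> + <[o]>)%VS.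
  apply/subvPn; apply/negP => /dimvS; rewrite (dimP pP) => d3.
  have [d2 _] := dimv_add_leqif <[n]>%VS <[o]>%VS.
  by move: (leq_trans d3 d2); rewrite !dim_vline; case: (n != 0); case: (o != 0).
exists (w - h w *: o); split; first by rewrite memvB ?memvZ.
  by rewrite hB hZ ho mulr1 subrr.
apply: contra wU => wn; rewrite -(subrK (h w *: o) w) memv_add //.
by rewrite memvZ ?memv_line.
Qed.

Lemma dim_cap2 p r o n : p \in P -> r \in P -> p != r -> h o = 1 -> o \in p -> o \in r ->
  n != 0 -> h n = 0 -> n \in p -> n \in r -> \dim (p :&: r)%VS = 2%N.
Proof.
move=> pP rP pr ho op or n0 hn np nr; apply/eqP; rewrite eqn_leq; apply/andP; split.
  have /dimv_cap_lt := vspace_neq_sub (etrans (dimP pP) (esym (dimP rP))) pr.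
  by rewrite (dimP pP).
have dno : \dim (<[n]> + <[o]>) = 2%N.
  apply: dimv_line2 => //.
  by apply/negP => /vlineP[k oE]; move: ho; rewrite oE hZ hn mulr0 => /esym/eqP; rewrite oner_eq0.
have sub : (<[n]> + <[o]> <= p :&: r)%VS by rewrite subv_add -!memvE !memv_cap np nr op.
by have := dimvS sub; rewrite dno.
Qed.

(** * Coordinates adapted to a grid *)

Definition comb (e1 e2 e3 n : V) x y z t := x *: e1 + y *: e2 + z *: e3 + t *: n.

Definition indep (e1 e2 e3 n : V) :=
  forall x y z t, comb e1 e2 e3 n x y z t = 0 -> [/\ x = 0, y = 0, z = 0 & t = 0].

Lemma indep_inj e1 e2 e3 n x y z t x' y' z' t' : indep e1 e2 e3 n ->
  comb e1 e2 e3 n x y z t = comb e1 e2 e3 n x' y' z' t' ->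
  [/\ x = x', y = y', z = z' & t = t'].
Proof.
move=> I /eqP; rewrite -subr_eq0.
have -> : comb e1 e2 e3 n x y z t - comb e1 e2 e3 n x' y' z' t' =
  comb e1 e2 e3 n (x - x') (y - y') (z - z') (t - t').
  by apply/rowP => i; rewrite !mxE; ring.
by move/eqP/I=> [/subr0_eq-> /subr0_eq-> /subr0_eq-> /subr0_eq->].
Qed.

(** The combinations of [o] and the four directions are q^5 distinct vectors. *)
Lemma indep_span o e1 e2 e3 n v : h o = 1 -> h e1 = 0 -> h e2 = 0 -> h e3 = 0 -> h n = 0 ->
  indep e1 e2 e3 n -> exists x y z t, v = h v *: o + comb e1 e2 e3 n x y z t.
Proof.
move=> ho h1 h2 h3 hn I.
have hc x y z t : h (comb e1 e2 e3 n x y z t) = 0.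
  by rewrite !hD !hZ h1 h2 h3 hn !mulr0 !addr0.
pose g (a : F * F * F * F * F) := a.1.1.1.1 *: o + comb e1 e2 e3 n a.1.1.1.2 a.1.1.2 a.1.2 a.2.
have g_inj : injective g.
  move=> [[[[a x] y] z] t] [[[[a' x'] y'] z'] t']; rewrite /g /= => E.
  have := congr1 h E; rewrite !h_lin !hc ho !mulr1 !addr0 => aE.
  by move: E; rewrite aE => /addrI /(indep_inj I)[-> -> -> ->].
have [|k _ kK] := inj_card_bij g_inj.
  by rewrite !card_prod card_mx mul1n !expnS expn0 muln1 !mulnA.
have := kK v; case: (k v) => [[[[a x] y] z] t]; rewrite /g /= => E.
exists x, y, z, t; rewrite -{1}E; congr (_ *: _ + _).
by rewrite -E h_lin hc ho mulr1 addr0.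
Qed.

(* Modulo [n], the planes of [K1] and [K2] project to the two rulings of the hyperbolic paraboloid
   [z = x y] of the affine 3-space. *)
Lemma grid_coords n K1 K2 : grid n K1 K2 -> exists o e1 e2 e3,
  [/\ o \in C, [/\ h e1 = 0, h e2 = 0 & h e3 = 0], indep e1 e2 e3 n &
   exists f : F -> F -> F, [/\ forall x y, o + comb e1 e2 e3 n x y (x * y) (f x y) \in C,
     forall v, v \in C -> exists x y, v = o + comb e1 e2 e3 n x y (x * y) (f x y),
     forall x, exists2 r, r \in K1 & forall y, o + comb e1 e2 e3 n x y (x * y) (f x y) \in r &
     forall y, exists2 s, s \in K2 & forall x, o + comb e1 e2 e3 n x y (x * y) (f x y) \in s]].
Proof.
move=> G; have G' := grid_sym G; have [n0 hn KP cov [u1 u2 m]] := G.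
have KP1 r : r \in K1 -> r \in P /\ n \in r by move=> rK; apply: KP; rewrite inE rK.
have KP2 r : r \in K2 -> r \in P /\ n \in r by move=> rK; apply: KP; rewrite inE rK orbT.
have [o oC] : exists o, o \in C by apply/card_gt0P; rewrite card_C expn_gt0; case: (q) q_ge7.
have ho := C_aff oC.
have [p [s [pK sK op os]]] := cov o oC.
have [[pP np] [sP ns]] := (KP1 _ pK, KP2 _ sK).
have [ps _] := m p s pK sK.
(* Modulo [n], the plane [s] of [K2] becomes the x-axis and the plane [p] of [K1] the y-axis. *)
have [e1 [e1s he1 e1n]] := plane_dir n sP os ho.
have [e2 [e2p he2 e2n]] := plane_dir n pP op ho.
have e1p : e1 \notin p.
  by apply: contra e1n => e1p; apply: (dir_prop pP sP ps ho op os n0 hn np ns he1 e1p e1s).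
have e2s : e2 \notin s.
  by apply: contra e2n => e2s; apply: (dir_prop pP sP ps ho op os n0 hn np ns he2 e2p e2s).
have ind2 x y t : x *: e1 + y *: e2 + t *: n = 0 -> [/\ x = 0, y = 0 & t = 0].
  move=> E; have x0 : x = 0.
    apply/eqP; apply: contraT => x0; case/negP: e1p.
    rewrite -(scalerK x0 e1) memvZ // (_ : x *: e1 = - (y *: e2 + t *: n)) ?memvN ?memvD ?memvZ //.
    by apply/eqP; rewrite -addr_eq0 addrA E.
  have y0 : y = 0.
    apply/eqP; apply: contraT => y0; case/negP: e2n; apply/vlineP; exists (y^-1 * - t).
    rewrite -scalerA -(scalerK y0 e2); congr (_ *: _); apply/eqP.
    by rewrite scaleNr -addr_eq0 -E x0 scale0r add0r.
  split=> //; apply/eqP; move/eqP: E; rewrite x0 y0 !scale0r !add0r scaler_eq0.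
  by rewrite (negbTE n0) orbF.
have [s_dec s_ex] := grid_row G' sK oC os e1s he1 e1n.
have [p_dec p_ex] := grid_row G pK oC op e2p he2 e2n.
have ex_r x : exists r t, [/\ r \in K1, o + (x *: e1 + t *: n) \in C & o + (x *: e1 + t *: n) \in r].
  by have [t tC] := s_ex x; have [r [_ [rK _ tr _]]] := cov _ tC; exists r, t.
have ex_s y : exists s t, [/\ s \in K2, o + (y *: e2 + t *: n) \in C & o + (y *: e2 + t *: n) \in s].
  by have [t tC] := p_ex y; have [_ [s' [_ sK' _ ts]]] := cov _ tC; exists s', t.
have in_s x t : o + (x *: e1 + t *: n) \in s by rewrite !memvD ?memvZ.
have in_p y t : o + (y *: e2 + t *: n) \in p by rewrite !memvD ?memvZ.
have [r1 [t1 [r1K a1C a1r]]] := ex_r 1; have [s1 [t2 [s1K b1C b1s]]] := ex_s 1.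
have [[r1P nr1] [s1P ns1]] := (KP1 _ r1K, KP2 _ s1K).
have [rs1 [w [wC wr ws]]] := m r1 s1 r1K s1K.
(* Normalised so that the planes over (1, 0, 0) and (0, 1, 0) meet exactly in the point with
   coordinates (1, 1, 1, 0). *)
pose e3 := w - o - e1 - e2.
have wE : w = o + (e1 + e2 + e3) by apply/rowP => i; rewrite !mxE; ring.
have he3 : h e3 = 0 by rewrite !hB (C_aff wC) ho he1 he2 subrr !subr0.
clearbody e3.
have r1p : r1 != p.
  apply: contraNneq e1p => E; rewrite (_ : e1 = o + (1 *: e1 + t1 *: n) - o - t1 *: n).
    by rewrite !memvB ?memvZ // -E.
  by apply/rowP => i; rewrite !mxE; ring.
have s1s : s1 != s.
  apply: contraNneq e2s => E; rewrite (_ : e2 = o + (1 *: e2 + t2 *: n) - o - t2 *: n).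
    by rewrite !memvB ?memvZ // -E.
  by apply/rowP => i; rewrite !mxE; ring.
have r1s : r1 != s by have [] := m r1 s r1K sK.
(* Otherwise [w], and with it [r1], would lie in the solid [p + s]. *)
have e3U : e3 \notin (p + s)%VS.
  apply/negP => e3U.
  have pU x : x \in p -> x \in (p + s)%VS by apply: (subvP (addvSl _ _)).
  have sU x : x \in s -> x \in (p + s)%VS by apply: (subvP (addvSr _ _)).
  have wU : w \in (p + s)%VS by rewrite wE; exact: memvD (pU _ op) (memvD (memvD (sU _ e1s) (pU _ e2p)) e3U).
  apply: (@no_three_in_solid (p + s)%VS p s r1) => //.
  - have := dimv_sum_cap p s; rewrite (dim_cap2 pP sP ps ho op os n0 hn np ns).
    by rewrite (dimP pP) (dimP sP) => /(@addIn 2 _ 4).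
  - by rewrite eq_sym.
  - by rewrite eq_sym.
  - exact: addvSl.
  - exact: addvSr.
  have hw0 : h (w - (o + (1 *: e1 + t1 *: n))) = 0 by rewrite hB !C_aff // subrr.
  apply: (plane_sub (dimP r1P) (C_aff a1C) hn hw0 n0 _ a1r nr1 _ (sU _ (in_s _ _)) (pU n np)).
  - apply/negP => /vlineP[k kE].
    have wE' : w = o + (1 *: e1 + t1 *: n) + k *: n by rewrite -kE addrC subrK.
    move: (wC); rewrite wE' => /(grid_mod G r1K a1C) k0.
    case/eqP: s1s; apply: (u2 _ _ w) => //.
    by rewrite wE' k0 scale0r addr0.
  - by rewrite memvB.
  - by rewrite memvB // sU.
have I : indep e1 e2 e3 n.
  move=> x y z t; rewrite /comb => E; have z0 : z = 0.
    apply/eqP; apply: contraT => z0; case/negP: e3U.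
    rewrite -(scalerK z0 e3) memvZ //.
    rewrite (_ : z *: e3 = - (x *: e1 + y *: e2 + t *: n)).
      by rewrite memvN !memvD ?memvZ // ?(subvP (addvSr p s) _ e1s) ?(subvP (addvSl p s) _ e2p)
        ?(subvP (addvSl p s) _ np).
    by apply/eqP; rewrite -addr_eq0 addrA addrC addrA [_ + z *: e3]addrC addrA [z *: e3 + _]addrC;
      apply/eqP; rewrite -[RHS]E; apply/rowP => i; rewrite !mxE; ring.
  move: E; rewrite z0 scale0r addr0 => /ind2[-> -> ->].
  by [].
have notn x y z t : comb e1 e2 e3 n x y z t \in <[n]>%VS -> [/\ x = 0, y = 0 & z = 0].
  case/vlineP=> k E; have : comb e1 e2 e3 n x y z (t - k) = 0.
    apply/eqP; rewrite -(subrr (k *: n)) -{1}E; apply/eqP/rowP => i; rewrite !mxE; ring.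
  by case/I.
have inj x y z t x' y' z' t' : o + comb e1 e2 e3 n x y z t = o + comb e1 e2 e3 n x' y' z' t' ->
    [/\ x = x', y = y' & z = z'].
  by move/addrI/(indep_inj I) => [-> -> -> _].
pose Q x y z t := o + comb e1 e2 e3 n x y z t.
have QD x y z t k : Q x y z t + k *: n = Q x y z (t + k).
  by apply/rowP => i; rewrite !mxE; ring.
have wQ : w = Q 1 1 1 0 by rewrite wE; apply/rowP => i; rewrite !mxE; ring.
have sQ x t : o + (x *: e1 + t *: n) = Q x 0 0 t by apply/rowP => i; rewrite !mxE; ring.
have pQ y t : o + (y *: e2 + t *: n) = Q 0 y 0 t by apply/rowP => i; rewrite !mxE; ring.
have Cmod x y z t t' : Q x y z t \in C -> Q x y z t' \in C -> t = t'.
  move=> tC; rewrite (_ : Q x y z t' = Q x y z t + (t' - t) *: n) => [t'C|].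
    by have /subr0_eq := grid_mod G pK tC t'C.
  by rewrite QD addrC subrK.
have lineE x y z t x' y' z' t' k l : Q x y z t + (k *: (Q x' y' z' t' - Q x y z t) + l *: n) =
    Q (x + k * (x' - x)) (y + k * (y' - y)) (z + k * (z' - z)) (t + k * (t' - t) + l).
  by apply/rowP => i; rewrite !mxE; ring.
have diffE x y z t x' y' z' t' : Q x' y' z' t' - Q x y z t =
    comb e1 e2 e3 n (x' - x) (y' - y) (z' - z) (t' - t).
  by apply/rowP => i; rewrite !mxE; ring.
(* Modulo [n], a plane of the grid is the line through any two of its points with distinct
   projections. *)
have dec12 (K K' : {set {vspace V}}) r x y z t x' y' z' t' v : grid n K K' -> r \in K ->
    Q x y z t \in C -> Q x y z t \in r -> Q x' y' z' t' \in C -> Q x' y' z' t' \in r ->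
    ~ [/\ x' - x = 0, y' - y = 0 & z' - z = 0] -> v \in C -> v \in r ->
    exists k l, v = Q (x + k * (x' - x)) (y + k * (y' - y)) (z + k * (z' - z)) l.
  move=> GK rK aC ar bC br ne vC vr.
  have eh : h (Q x' y' z' t' - Q x y z t) = 0 by rewrite hB !C_aff // subrr.
  have er : Q x' y' z' t' - Q x y z t \in r by rewrite memvB.
  have en : Q x' y' z' t' - Q x y z t \notin <[n]>%VS.
    by apply/negP; rewrite diffE => /notn.
  have [dec _] := grid_row GK rK aC ar er eh en.
  by have [k [l ->]] := dec v vC vr; rewrite lineE; do 2!eexists.
have a1Q : Q 1 0 0 t1 \in C by rewrite -sQ.
have b1Q : Q 0 1 0 t2 \in C by rewrite -pQ.
have wQC : Q 1 1 1 0 \in C by rewrite -wQ.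
have [wQr wQs] : Q 1 1 1 0 \in r1 /\ Q 1 1 1 0 \in s1 by rewrite -wQ.
have a1Qr : Q 1 0 0 t1 \in r1 by rewrite -sQ.
have b1Qs : Q 0 1 0 t2 \in s1 by rewrite -pQ.
have Hx x r' a : r' \in K1 -> Q x 0 0 a \in C -> Q x 0 0 a \in r' ->
    exists g b, [/\ Q g 1 g b \in C, Q g 1 g b \in r' & Q g 1 g b \in s1].
  move=> rK aC ar; have [_ [v [vC vr vs]]] := m r' s1 rK s1K.
  have [|k [l E]] := dec12 _ _ s1 0 1 0 t2 1 1 1 0 v G' s1K b1Q b1Qs wQC wQs _ vC vs.
    by case=> /eqP; rewrite subr0 oner_eq0.
  exists k, l; move: E; rewrite subr0 subrr mulr0 mulr1 add0r addr0 => <-.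
  by [].
have Hy y s' a : s' \in K2 -> Q 0 y 0 a \in C -> Q 0 y 0 a \in s' ->
    exists g b, [/\ Q 1 g g b \in C, Q 1 g g b \in s' & Q 1 g g b \in r1].
  move=> sK' aC ar; have [_ [v [vC vr vs]]] := m r1 s' r1K sK'.
  have [|k [l E]] := dec12 _ _ r1 1 0 0 t1 1 1 1 0 v G r1K a1Q a1Qr wQC wQr _ vC vr.
    by case=> _ /eqP; rewrite subr0 oner_eq0.
  exists k, l; move: E; rewrite !subr0 subrr mulr0 mulr1 add0r addr0 => <-.
  by [].
have meetE x y r' s' a b g c l d v : r' \in K1 -> s' \in K2 ->
    Q x 0 0 a \in C -> Q x 0 0 a \in r' -> Q 0 y 0 b \in C -> Q 0 y 0 b \in s' ->
    Q g 1 g c \in C -> Q g 1 g c \in r' -> Q 1 l l d \in C -> Q 1 l l d \in s' ->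
    v \in C -> v \in r' -> v \in s' ->
    exists k k' t, [/\ x + k * (g - x) = k', k = y + k' * (l - y), k * g = k' * l & v = Q k' k (k * g) t].
  move=> rK sK' aC ar bC bs cC cr dC ds vC vr vs.
  have [|k [t E]] := dec12 _ _ r' _ _ _ _ _ _ _ _ v G rK aC ar cC cr _ vC vr.
    by case=> _ /eqP; rewrite subr0 oner_eq0.
  have [|k' [t' E']] := dec12 _ _ s' _ _ _ _ _ _ _ _ v G' sK' bC bs dC ds _ vC vs.
    by case=> /eqP; rewrite subr0 oner_eq0.
  move: E E'; rewrite !subr0 !add0r !mulr1 => E E'.
  have [kE kE' kE''] := inj _ _ _ _ _ _ _ _ (etrans (esym E) E').
  by exists k, k', t; split; rewrite // -kE.
have r1u x a b : Q x 0 0 a \in C -> Q x 0 0 b \in r1 -> x = 1.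
  move=> aC br; have ar : Q x 0 0 a \in r1.
    by have := memvD br (memvZ (a - b) nr1); rewrite QD addrC subrK.
  have E : Q x 0 0 a = Q 1 0 0 t1.
    apply: contraNeq r1s => ne; apply/eqP; apply: (join_uniqP ne) => //; rewrite -?sQ //.
  by case/inj: E.
have Hx1 x r' a g b : r' \in K1 -> Q x 0 0 a \in C -> Q x 0 0 a \in r' ->
    Q g 1 g b \in C -> Q g 1 g b \in r' -> Q g 1 g b \in s1 -> g = x.
  move=> rK aC ar bC br b_s1.
  have r1x : g = 1 -> x = 1.
    move=> r1E; rewrite r1E in bC br; have b0 := Cmod _ _ _ _ _ bC wQC.
    have E : r' = r1 by apply: (u1 _ _ w) => //; rewrite wQ -b0.
    by apply: (r1u x a a) => //; rewrite -E.
  have [x1|x1] := eqVneq x 1.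
    have E : r' = r1.
      rewrite x1 in aC ar; have t1E := Cmod _ _ _ _ _ aC a1Q.
      by apply: (u1 _ _ (Q x 0 0 a)) => //; rewrite x1 // t1E -sQ.
    rewrite E in br; rewrite x1.
    have : Q g 1 g b = Q 1 1 1 0.
      apply: contraNeq rs1 => ne; apply/eqP.
      by apply: (join_uniqP ne) => //; rewrite -wQ.
    by case/inj.
  apply/eqP; apply: contraT => rx.
  have r1' : g != 1 by apply: contraNneq x1 => /r1x->.
  (* Eliminating [l] from the equations of [meetE] gives k (1 - g + y (g - x)) = y (1 - x). For this
     [y] the coefficient of k vanishes while the right side does not, so [r'] and [s'] could not
     meet. *)
  pose y := (1 - g) / (x - g).
  have xr : x - g != 0 by rewrite subr_eq0 eq_sym.
  have [s' [b' [sK' bC' bs']]] := ex_s y; rewrite pQ in bC' bs'.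
  have [l [d [dC ds _]]] := Hy y s' b' sK' bC' bs'.
  have [_ [v [vC vr vs]]] := m r' s' rK sK'.
  have [k [k' [t [E1 E2 E3 _]]]] := meetE x y r' s' a b' g b l d v rK sK' aC ar bC' bs' bC br dC ds vC vr vs.
  have : y * (1 - x) = k * (1 - g + y * (g - x)).
    have -> : k * (1 - g + y * (g - x)) = k - k * g + y * (x + k * (g - x)) - y * x by ring.
    by rewrite E1 E3 {1}E2; ring.
  have -> : 1 - g + y * (g - x) = 0 by rewrite /y -mulrA -[g - x]opprB mulrN mulVf // mulrN1 subrr.
  rewrite mulr0 => /eqP; rewrite !mulf_eq0 invr_eq0 (negbTE xr) orbF !subr_eq0.
  by rewrite [1 == g]eq_sym (negbTE r1') [1 == x]eq_sym (negbTE x1).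
have Hxx x r' a : r' \in K1 -> Q x 0 0 a \in C -> Q x 0 0 a \in r' ->
    exists b, Q x 1 x b \in C /\ Q x 1 x b \in r'.
  move=> rK aC ar; have [g [b [bC br bs]]] := Hx x r' a rK aC ar.
  by exists b; rewrite -{1 3}(Hx1 x r' a g b rK aC ar bC br bs) -(Hx1 x r' a g b rK aC ar bC br bs).
have [x0 x00 x01] : exists2 x : F, x != 0 & x != 1.
  have : (0 < #|~: [set 0%R; 1%R : F]|)%N.
    by rewrite cardsCs setCK cards2 card_F subn_gt0 (leq_trans _ q_ge7) // ltnS; case: (_ != _).
  by case/card_gt0P=> x; rewrite !inE negb_or => /andP[? ?]; exists x.
(* One plane of [K1], over a value [x0] other than 0 and 1, suffices here, since its projection is
   already known. *)
have Hyy y s' b : s' \in K2 -> Q 0 y 0 b \in C -> Q 0 y 0 b \in s' ->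
    exists d, Q 1 y y d \in C /\ Q 1 y y d \in s'.
  move=> sK' bC bs; have [l [d [dC ds dr]]] := Hy y s' b sK' bC bs.
  have [r' [a [rK aC ar]]] := ex_r x0; rewrite sQ in aC ar.
  have [c [cC cr]] := Hxx x0 r' a rK aC ar.
  have [_ [v [vC vr vs]]] := m r' s' rK sK'.
  have [k [k' [t [E1 E2 E3 _]]]] := meetE x0 y r' s' a b x0 c l d v rK sK' aC ar bC bs cC cr dC ds vC vr vs.
  move: E1; rewrite subrr mulr0 addr0 => E1.
  have kl : k = l by apply: (mulIf x00); rewrite E3 -E1 mulrC.
  suff -> : y = l by exists d.
  have : (y - l) * (1 - x0) = 0.
    by transitivity (y + x0 * (l - y) - l); [ring | rewrite E1 -E2 kl subrr].
  move/eqP; rewrite mulf_eq0 [1 - _ == 0]subr_eq0 [1 == _]eq_sym (negbTE x01) orbF subr_eq0.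
  by move/eqP.
have meetxy x y r' s' a b v : r' \in K1 -> s' \in K2 ->
    Q x 0 0 a \in C -> Q x 0 0 a \in r' -> Q 0 y 0 b \in C -> Q 0 y 0 b \in s' ->
    v \in C -> v \in r' -> v \in s' -> exists t, v = Q x y (x * y) t.
  move=> rK sK' aC ar bC bs vC vr vs.
  have [c [cC cr]] := Hxx x r' a rK aC ar.
  have [d [dC ds]] := Hyy y s' b sK' bC bs.
  have [k [k' [t [E1 E2 E3 ->]]]] := meetE x y r' s' a b x c y d v rK sK' aC ar bC bs cC cr dC ds vC vr vs.
  move: E1 E2; rewrite !subrr !mulr0 !addr0 => <- ->; exists t.
  by rewrite [y * x]mulrC.
(* The coordinate along [n] of the only point of [C] over (x, y, x y); such a point will be seen to
   exist, so the default is never taken. *)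
pose f x y := odflt 0 [pick t | Q x y (x * y) t \in C].
have fP x y t : Q x y (x * y) t \in C -> f x y = t.
  move=> tC; rewrite /f; case: pickP => [t' t'C|/(_ t)]; last by rewrite tC.
  exact: Cmod t'C tC.
have vr_x v r' : v \in C -> r' \in K1 -> v \in r' -> exists x a, Q x 0 0 a \in C /\ Q x 0 0 a \in r'.
  move=> _ rK _; have [_ [u [uC ur us]]] := m r' s rK sK.
  by have [x [a uE]] := s_dec u uC us; exists x, a; rewrite -sQ -uE.
have vs_y v s' : v \in C -> s' \in K2 -> v \in s' -> exists y b, Q 0 y 0 b \in C /\ Q 0 y 0 b \in s'.
  move=> _ sK' _; have [_ [u [uC ur us]]] := m p s' pK sK'.
  by have [y [b uE]] := p_dec u uC ur; exists y, b; rewrite -pQ -uE.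
have PC x y r' s' a b : r' \in K1 -> s' \in K2 ->
    Q x 0 0 a \in C -> Q x 0 0 a \in r' -> Q 0 y 0 b \in C -> Q 0 y 0 b \in s' ->
    [/\ Q x y (x * y) (f x y) \in C, Q x y (x * y) (f x y) \in r' & Q x y (x * y) (f x y) \in s'].
  move=> rK sK' aC ar bC bs; have [_ [v [vC vr vs]]] := m r' s' rK sK'.
  have [t vE] := meetxy x y r' s' a b v rK sK' aC ar bC bs vC vr vs.
  by rewrite (fP x y t) -vE.
exists o, e1, e2, e3; split=> //; exists f; split.
- move=> x y; have [r' [a [rK aC ar]]] := ex_r x; have [s' [b [sK' bC bs]]] := ex_s y.
  by rewrite sQ in aC ar; rewrite pQ in bC bs; case: (PC x y r' s' a b).
- move=> v vC; have [r' [s' [rK sK' vr vs]]] := cov v vC.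
  have [x [a [aC ar]]] := vr_x v r' vC rK vr; have [y [b [bC bs]]] := vs_y v s' vC sK' vs.
  have [t vE] := meetxy x y r' s' a b v rK sK' aC ar bC bs vC vr vs.
  by exists x, y; rewrite (fP x y t) -?vE.
- move=> x; have [r' [a [rK aC ar]]] := ex_r x; exists r' => // y.
  have [s' [b [sK' bC bs]]] := ex_s y.
  by rewrite sQ in aC ar; rewrite pQ in bC bs; case: (PC x y r' s' a b).
move=> y; have [s' [b [sK' bC bs]]] := ex_s y; exists s' => // x.
have [r' [a [rK aC ar]]] := ex_r x.
by rewrite sQ in aC ar; rewrite pQ in bC bs; case: (PC x y r' s' a b).
Qed.

(** * Coordinates *)

Section Paraboloid.

Variables (n o e1 e2 e3 : V) (f : F -> F -> F) (R S : F -> {vspace V}).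
Let Pt x y := o + comb e1 e2 e3 n x y (x * y) (f x y).
Hypothesis n0 : n != 0.
Hypothesis hn : h n = 0.
Hypothesis he : [/\ h e1 = 0, h e2 = 0 & h e3 = 0].
Hypothesis ind : indep e1 e2 e3 n.
Hypothesis PtC : forall x y, Pt x y \in C.
Hypothesis CPt : forall v, v \in C -> exists x y, v = Pt x y.
Hypothesis RP : forall x, [/\ R x \in P, n \in R x & forall y, Pt x y \in R x].
Hypothesis SP : forall y, [/\ S y \in P, n \in S y & forall x, Pt x y \in S y].
Hypothesis RS : forall x y, R x != S y.

Lemma Pt_inj x y x' y' : Pt x y = Pt x' y' -> x = x' /\ y = y'.
Proof. by move/addrI/(indep_inj ind)=> [-> -> _ _]. Qed.

Lemma in_line_n x y z t : comb e1 e2 e3 n x y z t \in <[n]>%VS -> [/\ x = 0, y = 0 & z = 0].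
Proof.
case/vlineP=> k E; have : comb e1 e2 e3 n x y z (t - k) = 0.
  apply/eqP; rewrite -(subrr (k *: n)) -{1}E; apply/eqP/rowP => i; rewrite !mxE; ring.
by case/ind.
Qed.

Lemma Pt_sub x y x' y' : Pt x' y' - Pt x y =
  comb e1 e2 e3 n (x' - x) (y' - y) (x' * y' - x * y) (f x' y' - f x y).
Proof. by apply/rowP => i; rewrite !mxE; ring. Qed.

Lemma hPt_sub x y x' y' : h (Pt x' y' - Pt x y) = 0.
Proof. by rewrite hB !C_aff // subrr. Qed.

(** The point [Pt x y + n] is outside [C] and already on the two planes [R x] and [S y]. *)
Lemma plane_RS p x y : p \in P -> n \in p -> Pt x y \in p -> p = R x \/ p = S y.
Proof.
move=> pP np Pp; have [rP nr Pr] := RP x; have [sP ns Ps] := SP y.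
have nC : Pt x y + n \notin C.
  apply/negP => /CPt[x' [y' E]].
  have E' : comb e1 e2 e3 n (x' - x) (y' - y) (x' * y' - x * y) (f x' y' - f x y) = n.
    by rewrite -Pt_sub -E addrC addrA addNr add0r.
  have [//|/subr0_eq xE /subr0_eq yE _] := @in_line_n (x' - x) (y' - y) (x' * y' - x * y) (f x' y' - f x y).
    by rewrite E' memv_line.
  by move: n0; rewrite -E' -Pt_sub xE yE subrr eqxx.
have hv : h (Pt x y + n) = 1 by rewrite hD hn addr0 C_aff.
have := no_three_planes hv nC pP rP sP (memvD Pp np) (memvD (Pr y) nr) (memvD (Ps x) ns).
by rewrite (negbTE (RS _ _)) orbF => /orP[] /eqP; [left | right].
Qed.

Lemma planeR p x y y' : p \in P -> y != y' -> Pt x y \in p -> Pt x y' \in p -> n \in p.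
Proof.
move=> pP yy Pp Pp'; have [rP nr Pr] := RP x.
have ne : Pt x y != Pt x y' by apply: contraNneq yy => /Pt_inj[_ ->].
by rewrite (join_uniqP ne (PtC _ _) (PtC _ _) pP rP).
Qed.

Lemma planeS p x x' y : p \in P -> x != x' -> Pt x y \in p -> Pt x' y \in p -> n \in p.
Proof.
move=> pP xx Pp Pp'; have [rP nr Pr] := SP y.
have ne : Pt x y != Pt x' y by apply: contraNneq xx => /Pt_inj[->].
by rewrite (join_uniqP ne (PtC _ _) (PtC _ _) pP rP).
Qed.

(** Otherwise [p] is [R x] or [S y], and it has two points of [C] in common with [S y'] or [R x']
    respectively. *)
Lemma notin_n p x y x' y' : p \in P -> x != x' -> y != y' -> Pt x y \in p -> Pt x' y' \in p ->
  n \notin p.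
Proof.
move=> pP xx yy Pp Pp'; apply/negP => np.
have [rP nr Pr] := RP x; have [sP ns Ps] := SP y.
have other r s : r \in P -> s \in P -> r != s -> Pt x y \in r -> Pt x y \in s ->
    forall v, v \in C -> v \in r -> v \in s -> v = Pt x y.
  move=> rP' sP' rs Pr' Ps' v vC vr vs; apply: contraNeq rs => ne.
  by apply/eqP; apply: (join_uniqP ne).
have [pE|pE] := plane_RS pP np Pp; have [rP' nr' Pr'] := RP x'; have [sP' ns' Ps'] := SP y'.
  have : Pt x y' = Pt x' y'.
    have pS : p != S y' by rewrite pE RS.
    apply: contraNeq pS => ne; apply/eqP; apply: (join_uniqP ne) => //.
    by rewrite pE.
  by case/Pt_inj=> E _; rewrite E eqxx in xx.
have : Pt x' y = Pt x' y'.
  have pS : p != R x' by rewrite pE eq_sym RS.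
  apply: contraNeq pS => ne; apply/eqP; apply: (join_uniqP ne) => //.
  by rewrite pE.
by case/Pt_inj=> _ E; rewrite E eqxx in yy.
Qed.

Lemma three_scalars : exists2 x : F, x != 0 & x != 1.
Proof.
have : (0 < #|~: [set 0%R; 1%R : F]|)%N.
  by rewrite cardsCs setCK cards2 card_F subn_gt0 (leq_trans _ q_ge7) // ltnS; case: (_ != _).
by case/card_gt0P=> x; rewrite !inE negb_or => /andP[? ?]; exists x.
Qed.

Lemma plane_span p x1 y1 x2 y2 x3 y3 v : p \in P ->
  Pt x1 y1 \in p -> Pt x2 y2 \in p -> Pt x3 y3 \in p -> x1 != x2 -> x1 != x3 -> x2 != x3 ->
  v \in p -> exists a b, v = h v *: Pt x1 y1 + a *: (Pt x2 y2 - Pt x1 y1) + b *: (Pt x3 y3 - Pt x1 y1).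
Proof.
move=> pP p1 p2 p3 x12 x13 x23 vp.
have ne x y x' y' : x != x' -> Pt x y != Pt x' y' by apply: contraNneq => /Pt_inj[->].
pose U := (<[Pt x1 y1]> + <[Pt x2 y2 - Pt x1 y1]> + <[Pt x3 y3 - Pt x1 y1]>)%VS.
have U1 : Pt x1 y1 \in U.
  by rewrite (subvP (addvSl _ _)) // (subvP (addvSl _ _)) ?memv_line.
have U2 : Pt x2 y2 - Pt x1 y1 \in U.
  by rewrite (subvP (addvSl _ _)) // (subvP (addvSr _ _)) ?memv_line.
have U3 : Pt x3 y3 - Pt x1 y1 \in U by rewrite (subvP (addvSr _ _)) ?memv_line.
have sub : (p <= U)%VS.
  apply: (plane_sub_arc pP (u := Pt x1 y1) (v := Pt x2 y2) (w := Pt x3 y3)); rewrite ?blk_mem ?PtC ?ne //.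
    by rewrite -(subrK (Pt x1 y1) (Pt x2 y2)); exact: memvD U2 U1.
  by rewrite -(subrK (Pt x1 y1) (Pt x3 y3)); exact: memvD U3 U1.
move: (subvP sub v vp) => /memv_addP[_ /memv_addP[_ /vlineP[a ->] [_ /vlineP[b ->] ->]] [_ /vlineP[c ->] ->]].
by exists b, c; rewrite !hD !hZ !hPt_sub C_aff // !mulr0 !addr0 mulr1.
Qed.

(* Such a plane is not parallel to [n], so it projects from [n] onto a plane of the affine
   3-space; of the conics cut out on [z = x y], only the parabolas have enough affine points. *)
Lemma plane_line p : p \in P -> n \notin p ->
  exists m k, m != 0 /\ forall x, Pt x (m * x + k) \in p.
Proof.
move=> pP np.
(* As [n] is not in [p], the q points of the arc have distinct first coordinates, so every [x]
   occurs. *)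
have ex x : exists y, Pt x y \in p.
  pose xc v := odflt 0 [pick x | [exists y, v == Pt x y]].
  have xcP x' y' : xc (Pt x' y') = x'.
    rewrite /xc; case: pickP => [x'' /existsP[y'' /eqP/Pt_inj[->]]//|/(_ x')/existsP[]].
    by exists y'.
  have : xc @: blk p = [set: F].
    apply/eqP; rewrite eqEcard subsetT cardsT card_F card_in_imset ?(card_blk pP) ?leqnn //.
    move=> v w; rewrite !blk_mem => /andP[/CPt[x' [y' ->]] p'] /andP[/CPt[x'' [y'' ->]] p''].
    rewrite !xcP => xE; rewrite xE in p' *; congr Pt; apply/eqP; apply: contraNT np => yy.
    exact: planeR yy p' p''.
  move/setP/(_ x); rewrite in_setT => /imsetP[v]; rewrite blk_mem => /andP[/CPt[x' [y' ->]] p'].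
  by rewrite xcP => ->; exists y'.
have [tau tauP] := fin_all_exists ex.
have tau_inj : injective tau.
  move=> x x' E; apply/eqP; apply: contraNT np => xx; apply: (planeS pP xx (tauP x)).
  by rewrite E.
have [x0 x00 x01] := three_scalars.
have x10 : (1 : F) != x0 by rewrite eq_sym.
have x00' : 0 != x0 by rewrite eq_sym.
have o10 : 0 != 1 :> F by rewrite eq_sym oner_neq0.
(* (a, b, c) is the cross product of the chords (1, u2, u3) and (v1, v2, v3) of the projected arc
   from its point at x = 0, so that [rel] is the equation of the projected plane. *)
pose u2 := tau 1 - tau 0; pose u3 := tau 1; pose v1 := x0; pose v2 := tau x0 - tau 0; pose v3 := x0 * tau x0.
pose a := u2 * v3 - u3 * v2; pose b := u3 * v1 - v3; pose c := v2 - v1 * u2.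
have rel x : a * x + b * (tau x - tau 0) + c * (x * tau x) = 0.
  have [s [t E]] := plane_span pP (tauP 0) (tauP 1) (tauP x0) o10 x00' x10 (tauP x).
  move: E; rewrite C_aff // scale1r => E.
  have E' : comb e1 e2 e3 n (x - 0) (tau x - tau 0) (x * tau x - 0 * tau 0) (f x (tau x) - f 0 (tau 0))
    = comb e1 e2 e3 n (s + t * x0) (s * u2 + t * v2) (s * u3 + t * v3)
        (s * (f 1 (tau 1) - f 0 (tau 0)) + t * (f x0 (tau x0) - f 0 (tau 0))).
    rewrite -Pt_sub E addrAC [Pt 0 _ + _]addrC addrK !Pt_sub.
    by apply/rowP => i; rewrite !mxE /u2 /u3 /v2 /v3; ring.
  have [xE yE zE _] := indep_inj ind E'; move: xE zE; rewrite mul0r !subr0 => xE zE.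
  by rewrite yE zE xE /a /b /c /v1; ring.
(* The two chords would be proportional modulo [n]; being independent in [p], they would put a
   nonzero multiple of [n] there. *)
have bc : ~ (b = 0 /\ c = 0).
  case=> b0 c0; case/negP: np.
  have p1 : Pt 1 (tau 1) - Pt 0 (tau 0) \in p by rewrite memvB.
  have p0 : Pt x0 (tau x0) - Pt 0 (tau 0) \in p by rewrite memvB.
  have arc1 : Pt x0 (tau x0) - Pt 0 (tau 0) \notin <[(Pt 1 (tau 1) - Pt 0 (tau 0))%R]>%VS.
    by apply: (arc pP); rewrite ?blk_mem ?PtC ?tauP //; apply/eqP => /Pt_inj[/eqP];
      rewrite ?(negbTE o10) ?(negbTE x00') ?(negbTE x10).
  pose k := x0 * (f 1 (tau 1) - f 0 (tau 0)) - (f x0 (tau x0) - f 0 (tau 0)).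
  have E : x0 *: (Pt 1 (tau 1) - Pt 0 (tau 0)) - (Pt x0 (tau x0) - Pt 0 (tau 0)) = k *: n.
    have -> : k *: n = comb e1 e2 e3 n 0 (- c) b k.
      by rewrite b0 c0 /comb oppr0 !scale0r !add0r.
    by rewrite !Pt_sub; apply/rowP => i; rewrite !mxE /c /b /u2 /u3 /v1 /v2 /v3 /k; ring.
  have k0 : k != 0.
    apply: contraNneq arc1 => k0; move/eqP: E; rewrite k0 scale0r subr_eq0 => /eqP <-.
    by rewrite memvZ ?memv_line.
  by rewrite -(scalerK k0 n) -E memvZ // memvB ?memvZ.
(* For c != 0 the relation reads (c x + b) tau x = b tau 0 - a x. At the pole - b / c the right side
   has to vanish as well, so [tau] is constant away from the pole, against injectivity. *)
have c0 : c = 0.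
  apply/eqP; apply: contraT => c0; exfalso.
  have r0 := rel (- b / c).
  have cbc : c * (- b / c) = - b by rewrite mulrC divfK.
  have K : a * (- b / c) = b * tau 0.
    have : a * (- b / c) + b * (tau (- b / c) - tau 0) + c * (- b / c) * tau (- b / c) = 0.
      by rewrite -mulrA.
    rewrite cbc => E; apply/eqP; rewrite -subr_eq0; apply/eqP; rewrite -[RHS]E; ring.
  have tauE x : x != - b / c -> tau x = - a / c.
    move=> xb; have cb : c * x + b != 0.
      apply: contraNneq xb => /eqP; rewrite addr_eq0 => /eqP E; apply/eqP.
      by apply: (mulfI c0); rewrite cbc.
    apply: (mulfI cb); have : (c * x + b) * tau x = b * tau 0 - a * x.
      by apply/eqP; rewrite -subr_eq0; apply/eqP; rewrite -[RHS](rel x); ring.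
    by move=> ->; rewrite -K; field.
  have no2 x y : x != y -> x != - b / c -> y = - b / c.
    move=> xy xb; apply/eqP; apply: contraT => yb; case/eqP: xy.
    by apply: tau_inj; rewrite !tauE.
  have [z|z] := eqVneq (0 : F) (- b / c).
    have E := no2 1 x0 x10; rewrite -z in E.
    by move: x00'; rewrite E ?eqxx // oner_neq0.
  have E1 := no2 _ _ o10 z; have E2 := no2 _ _ x00' z.
  by move: x10; rewrite E1 E2 eqxx.
have b0 : b != 0 by apply/eqP => b0; apply: bc.
exists (- a / b), (tau 0).
have tauE x : tau x = - a / b * x + tau 0.
  apply: (mulfI b0); apply/eqP; rewrite -subr_eq0; apply/eqP.
  by rewrite -[RHS](rel x) c0; field.
split; last by move=> x; rewrite -tauE.
apply/eqP => m0; have : tau 1 = tau 0 by rewrite (tauE 1) m0 mul0r add0r.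
by move/tau_inj/eqP; rewrite eq_sym (negbTE o10).
Qed.


(** * The second direction and the quadratic form *)

Implicit Types (K : {set {vspace V}}).
Hypothesis two0 : (2 : F) != 0.

Lemma h_comb x y z t : h (comb e1 e2 e3 n x y z t) = 0.
Proof. by case: he => h1 h2 h3; rewrite !hD !hZ h1 h2 h3 hn !mulr0 !addr0. Qed.

Lemma h_o : h o = 1.
Proof. by have := C_aff (PtC 0 0); rewrite hD h_comb addr0. Qed.

Lemma PtE x y : Pt x y = o + comb e1 e2 e3 n x y (x * y) (f x y).
Proof. by []. Qed.

Lemma line_uniq p x y y' : p \in P -> n \notin p -> Pt x y \in p -> Pt x y' \in p -> y = y'.
Proof. by move=> pP np p1 p2; apply/eqP; apply: contraNT np => yy; exact: planeR yy p1 p2. Qed.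

(** Modulo [n], the points of [C] on [p] form a parabola over the line y = m x + k. If the first
    coordinate of [n2] were nonzero, [n2] would be the direction of a chord of this parabola, and
    since [n] is not in [p], two points of [C] would differ by a multiple of [n2], which [grid_mod]
    excludes. So [n2] is along the axis of the parabola. *)
Lemma second_dir p n2 K1 K2 : p \in K1 -> n \notin p -> grid n2 K1 K2 ->
  exists c d, c != 0 /\ n2 = comb e1 e2 e3 n 0 0 c d.
Proof.
move=> pK np G; have [n20 hn2 KP cov [u1 u2 mt]] := G.
have [pP n2p] : p \in P /\ n2 \in p by apply: KP; rewrite inE pK.
have [m [k [m0 line]]] := plane_line pP np.
have [he1 he2 he3] := he.
have [x [y [z [t n2E]]]] := indep_span n2 h_o he1 he2 he3 hn ind.
rewrite hn2 scale0r add0r in n2E.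
have [x0 x00 x01] := three_scalars.
have o10 : 0 != 1 :> F by rewrite eq_sym oner_neq0.
have x00' : 0 != x0 by rewrite eq_sym.
have x01' : 1 != x0 by rewrite eq_sym.
have [a [b E]] := plane_span pP (line 0) (line 1) (line x0) o10 x00' x01' n2p.
have {E} : n2 = comb e1 e2 e3 n (a + b * x0) (m * (a + b * x0))
   (a * (m * 1 + k) + b * (x0 * (m * x0 + k)))
   (a * (f 1 (m * 1 + k) - f 0 (m * 0 + k)) + b * (f x0 (m * x0 + k) - f 0 (m * 0 + k))).
  by rewrite E hn2 scale0r add0r !Pt_sub; apply/rowP => i; rewrite !mxE; ring.
rewrite n2E => /(indep_inj ind)[xE yE _ _].
rewrite -xE in yE.
have x_eq0 : x = 0.
  apply/eqP; apply: contraT => xn0.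
  (* The chord between the parameters u and u' has slope m (u + u') + k, which has to be z / x; [u]
     is chosen so that u' differs from it. *)
  have [u uE] : exists u : F, 2 * u != (z / x - k) / m.
    have [E0|] := eqVneq (2 * 0) ((z / x - k) / m); last by exists 0.
    by exists 1; rewrite -E0 mulr0 mulr1.
  pose u' := (z / x - k) / m - u.
  have uu : u' != u by rewrite subr_eq eq_sym -mulr2n -mulr_natl.
  have n2u : Pt u' (m * u' + k) - Pt u (m * u + k) - ((u' - u) / x) *: n2 \in p.
    by rewrite memvB ?memvZ // memvB.
  pose w := f u' (m * u' + k) - f u (m * u + k) - (u' - u) / x * t.
  have wE : Pt u' (m * u' + k) - Pt u (m * u + k) - ((u' - u) / x) *: n2 = w *: n.
    have -> : w *: n = comb e1 e2 e3 n ((u' - u) - (u' - u) / x * x) (m * (u' - u) - (u' - u) / x * y)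
       (u' * (m * u' + k) - u * (m * u + k) - (u' - u) / x * z) w.
      have -> : (u' - u) - (u' - u) / x * x = 0 by field.
      have -> : m * (u' - u) - (u' - u) / x * y = 0 by rewrite yE; field.
      have -> : u' * (m * u' + k) - u * (m * u + k) - (u' - u) / x * z = 0.
        by rewrite /u'; field; rewrite ?m0 ?xn0.
      by rewrite /comb !scale0r !add0r.
    by rewrite Pt_sub n2E; apply/rowP => i; rewrite !mxE /w; ring.
  have w0 : w = 0.
    by apply/eqP; apply: contraNT np => w0; rewrite -(scalerK w0 n) -wE memvZ.
  have E : Pt u' (m * u' + k) = Pt u (m * u + k) + ((u' - u) / x) *: n2.
    move: wE; rewrite w0 scale0r => /subr0_eq <-.
    by rewrite [RHS]addrC subrK.
  have := PtC u' (m * u' + k); rewrite E => /(grid_mod G pK (PtC _ _))/eqP.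
  by rewrite mulf_eq0 invr_eq0 (negbTE xn0) orbF subr_eq0 (negbTE uu).
exists z, t; rewrite yE x_eq0 mulr0; split=> //.
apply: contraNneq np => z0; move: n2E n20 n2p; rewrite yE x_eq0 mulr0 z0 /comb !scale0r !add0r => ->.
rewrite scaler_eq0 negb_or => /andP[t0 _] np.
by rewrite -(scalerK t0 n) memvZ.
Qed.

(** A plane of the new grid through [n] is [R x] or [S y] and shares a line of direction [n] with
    the other of the two. It also shares a line of direction [n2] with a plane of its own grid, so
    [dir_unique] puts [n] in [<[n2]>], hence in [p]. *)
Lemma grid_notin p r n2 K1 K2 : p \in K1 -> n \notin p -> grid n2 K1 K2 ->
  r \in K1 :|: K2 -> n \notin r.
Proof.
move=> pK np G rK; have [n20 hn2 KP cov [u1 u2 mt]] := G.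
have [pP n2p] : p \in P /\ n2 \in p by apply: KP; rewrite inE pK.
have [rP n2r] := KP r rK.
apply: contra np => nr.
have [r' [rr' r'P n2r' [v' [v'C v'r v'r']]]] : exists r', [/\ r != r', r' \in P, n2 \in r' &
    exists v, [/\ v \in C, v \in r & v \in r']].
  have [v [vC _]] := blk_ex rP; have [s [t [sK tK _ _]]] := cov v vC.
  have [sP n2s] : s \in P /\ n2 \in s by apply: KP; rewrite inE sK.
  have [tP n2t] : t \in P /\ n2 \in t by apply: KP; rewrite inE tK orbT.
  case/setUP: rK => rK.
    by exists t; have [rt ex] := mt r t rK tK; split.
  have [sr [w [wC ws wr]]] := mt s r sK rK.
  by exists s; split=> //; [rewrite eq_sym | exists w].
have [v vC vr] := blk_ex rP; have [x [y vE]] := CPt vC; rewrite vE in vC vr.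
have [[RxP nR PR] [SyP nS PS]] := (RP x, SP y).
have n_n2 s : s \in P -> n \in s -> Pt x y \in s -> r != s -> n \in p.
  move=> sP ns Ps rs.
  have /vlineP[k ->] : n \in <[n2]>%VS by apply: (dir_unique rP sP r'P rs rr' vC vr Ps v'C v'r v'r').
  by rewrite memvZ.
by have [E|E] := plane_RS rP nr vr; [apply: (n_n2 (S y)) | apply: (n_n2 (R x))];
  rewrite // E // eq_sym.
Qed.

(** Distinct planes of one class have no common point of [C], so their lines have the same slope;
    the class has a plane on each [Pt 0 k]. *)
Lemma grid_slope p n2 K1 K2 : p \in K1 -> n \notin p -> grid n2 K1 K2 ->
  exists m, m != 0 /\ forall k, exists2 r, r \in K1 & forall x, Pt x (m * x + k) \in r.
Proof.
move=> pK np G; have [n20 hn2 KP cov [u1 u2 mt]] := G.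
have [pP n2p] : p \in P /\ n2 \in p by apply: KP; rewrite inE pK.
have [m [kp [m0 line]]] := plane_line pP np.
exists m; split=> // k; have [r [_ [rK _ Pr _]]] := cov _ (PtC 0 k).
have [rP n2r] : r \in P /\ n2 \in r by apply: KP; rewrite inE rK.
have nr : n \notin r by apply: (grid_notin pK np G); rewrite inE rK.
have [m' [k' [m'0 line']]] := plane_line rP nr; exists r => // x.
have k'E : k' = k by have := line_uniq rP nr (line' 0) Pr; rewrite mulr0 add0r.
have [rp|rp] := eqVneq r p.
  have kE : kp = k by rewrite rp in Pr; have := line_uniq pP np (line 0) Pr; rewrite mulr0 add0r.
  by rewrite rp -kE.
suff -> : m = m' by rewrite -k'E.
apply/eqP; apply: contraT => mm; case/eqP: rp.
have d0 : m - m' != 0 by rewrite subr_eq0.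
apply: (u1 _ _ (Pt ((k' - kp) / (m - m')) (m * ((k' - kp) / (m - m')) + kp))) => //.
have -> : m * ((k' - kp) / (m - m')) + kp = m' * ((k' - kp) / (m - m')) + k' by field.
exact: line'.
Qed.

(** Subtracting [d / c * (x * y)] from [f] amounts to projecting from [n2]. As [r] contains [n2], it
    projects to a line, along which [g] is affine. *)
Lemma affine_on_line r n2 c d m k x : r \in P -> n2 \in r -> c != 0 -> n2 = comb e1 e2 e3 n 0 0 c d ->
  (forall x, Pt x (m * x + k) \in r) ->
  let g x y := f x y - d / c * (x * y) in
  g x (m * x + k) = g 0 k + x * (g 1 (m + k) - g 0 k).
Proof.
move=> rP n2r c0 n2E line g.
have [->|x0] := eqVneq x 0; first by rewrite mulr0 mul0r !add0r addr0.
have [->|x1] := eqVneq x 1; first by rewrite mulr1 mul1r [RHS]addrC subrK.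
have o10 : 0 != 1 :> F by rewrite eq_sym oner_neq0.
have x0' : 0 != x by rewrite eq_sym.
have x1' : 1 != x by rewrite eq_sym.
have hn2 : h n2 = 0 by rewrite n2E h_comb.
have [a [b E]] := plane_span rP (line 0) (line 1) (line x) o10 x0' x1' n2r.
have {E} : n2 = comb e1 e2 e3 n (a + b * x) (m * (a + b * x))
   (a * (m * 1 + k) + b * (x * (m * x + k)))
   (a * (f 1 (m * 1 + k) - f 0 (m * 0 + k)) + b * (f x (m * x + k) - f 0 (m * 0 + k))).
  by rewrite E hn2 scale0r add0r !Pt_sub; apply/rowP => i; rewrite !mxE; ring.
rewrite n2E mulr0 add0r !mulr1 => /(indep_inj ind)[/esym xE _ cE dE].
have aE : a = - (b * x) by apply/eqP; rewrite -addr_eq0 xE.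
rewrite aE in cE dE.
have b0 : b != 0 by apply: contraNneq c0 => b0; rewrite cE b0 !mul0r oppr0 mul0r addr0.
have {}cE : c = b * (m * (x * x - x)) by rewrite cE; ring.
have mx0 : m * (x * x - x) != 0 by apply: contraNneq c0 => z; rewrite cE z mulr0.
rewrite /g dE cE.
have [m0 xx0] : m != 0 /\ x * x - x != 0 by apply/andP; rewrite -negb_or -mulf_eq0.
by field; rewrite m0 b0 xx0.
Qed.

(** In the coordinates X = y - m x and Y = y - m' x, the function is affine in Y for fixed X and in
    X for fixed Y. *)
Lemma biaffine (g A B A' B' : F -> F) (G : F -> F -> F) m m' : m != m' ->
  (forall x k, G x (m * x + k) = A k + x * B k) ->
  (forall x k, G x (m' * x + k) = A' k + x * B' k) ->
  exists c0 c1 c2 c3, forall x y,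
    G x y = c0 + c1 * (y - m * x) + c2 * (y - m' * x) + c3 * ((y - m * x) * (y - m' * x)).
Proof.
move=> mm HA HB.
have d0 : m - m' != 0 by rewrite subr_eq0.
pose H X Y := G ((Y - X) / (m - m')) ((m * Y - m' * X) / (m - m')).
have HX X Y : H X Y = A X + (Y - X) / (m - m') * B X.
  by rewrite -HA; congr G; field.
have HY X Y : H X Y = A' Y + (Y - X) / (m - m') * B' Y.
  by rewrite -HB; congr G; field.
have E X Y : H X Y = H X 0 + Y * (H X 1 - H X 0) by rewrite !HX; field.
have E' X Y : H X Y = H 0 Y + X * (H 1 Y - H 0 Y) by rewrite !HY; field.
exists (H 0 0), (H 1 0 - H 0 0), (H 0 1 - H 0 0), (H 1 1 - H 1 0 - H 0 1 + H 0 0) => x y.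
have -> : G x y = H (y - m * x) (y - m' * x) by rewrite /H; congr G; field.
by rewrite E (E' _ 0) (E' _ 1); ring.
Qed.

(** The plane on [Pt 0 0] and [Pt 1 1] does not contain [n], and its grid gives two slopes m and m'.
    By [biaffine] the quadratic part of [f] is, up to a multiple of x y, a multiple of (y - m x)(y -
    m' x), whence c = m m'. If the factor e were 0, [R 0] would contain three collinear points of
    [C]. *)
Lemma f_quadratic : exists (a b1 b2 d e c : F),
  [/\ e != 0, c != 0 & forall x y, f x y = a + b1 * x + b2 * y + d * (x * y) + e * (y ^+ 2 + c * x ^+ 2)].
Proof.
have o10 : 0 != 1 :> F by rewrite eq_sym oner_neq0.
have PQ : Pt 0 0 != Pt 1 1 by apply: contraNneq o10 => /Pt_inj[->].
have [p [pP p0 p1]] := joinP (PtC 0 0) (PtC 1 1) PQ.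
have np : n \notin p by apply: (notin_n pP o10 o10 p0 p1).
have [n2 [K1 [K2 [G pK]]]] := grid_exists pP.
have G' := grid_sym G; have [n20 hn2 KP cov [u1 u2 mt]] := G.
have [_ [s [_ sK _ s0]]] := cov _ (PtC 0 0).
have [sP n2s] : s \in P /\ n2 \in s by apply: KP; rewrite inE sK orbT.
have ns : n \notin s by apply: (grid_notin pK np G); rewrite inE sK orbT.
have [c [d [c0 n2E]]] := second_dir pK np G.
have [m [m0 slope]] := grid_slope pK np G.
have [m' [m'0 slope']] := grid_slope sK ns G'.
have mm : m != m'.
  apply/negP => /eqP mm; have [r rK rl] := slope 0; have [t tK tl] := slope' 0.
  have [rt _] := mt r t rK tK; case/eqP: rt.
  have [rP _] : r \in P /\ n2 \in r by apply: KP; rewrite inE rK.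
  have [tP _] : t \in P /\ n2 \in t by apply: KP; rewrite inE tK orbT.
  have ne : Pt 0 (m * 0 + 0) != Pt 1 (m * 1 + 0) by apply: contraNneq o10 => /Pt_inj[->].
  by apply: (join_uniqP ne) => //; rewrite mm.
pose g x y := f x y - d / c * (x * y).
have [c0' [c1 [c2 [c3 gE]]]] : exists c0 c1 c2 c3, forall x y,
    g x y = c0 + c1 * (y - m * x) + c2 * (y - m' * x) + c3 * ((y - m * x) * (y - m' * x)).
  apply: (@biaffine id (fun k => g 0 k) (fun k => g 1 (m + k) - g 0 k) (fun k => g 0 k)
    (fun k => g 1 (m' + k) - g 0 k)) => // x k.
    have [r rK rl] := slope k.
    have [rP n2r] : r \in P /\ n2 \in r by apply: KP; rewrite inE rK.
    exact: affine_on_line rP n2r c0 n2E rl.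
  have [r rK rl] := slope' k.
  have [rP n2r] : r \in P /\ n2 \in r by apply: KP; rewrite inE rK orbT.
  exact: affine_on_line rP n2r c0 n2E rl.
have fE x y : f x y = c0' + (- (c1 * m + c2 * m')) * x + (c1 + c2) * y
    + (d / c - c3 * (m + m')) * (x * y) + c3 * (y ^+ 2 + m * m' * x ^+ 2).
  by rewrite -[f x y](subrK (d / c * (x * y))) -/(g x y) gE; ring.
exists c0', (- (c1 * m + c2 * m')), (c1 + c2), (d / c - c3 * (m + m')), c3, (m * m').
split; rewrite ?mulf_neq0 //.
apply/eqP => c30; have [x0 x00 x01] := three_scalars.
have [RP0 _ RPt] := RP 0.
have ne y y' : y != y' -> Pt 0 y != Pt 0 y' by apply: contraNneq => /Pt_inj[_ ->].
have := arc RP0 (u := Pt 0 0) (v := Pt 0 1) (w := Pt 0 x0).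
rewrite !blk_mem !PtC !RPt => /(_ isT isT isT).
rewrite !ne 1?[_ == x0]eq_sym // => /(_ isT isT isT)/negP[].
apply/vlineP; exists x0; rewrite !Pt_sub !fE c30.
by apply/rowP => i; rewrite !mxE; ring.
Qed.

Lemma R_coord x a b c t : o + comb e1 e2 e3 n a b c t \in R x -> a = x /\ c = x * b.
Proof.
move=> vR; have [rP nr Pr] := RP x.
have eh : h (Pt x 1 - Pt x 0) = 0 by rewrite hPt_sub.
have en : Pt x 1 - Pt x 0 \notin <[n]>%VS.
  by apply/negP; rewrite Pt_sub => /in_line_n[_ /eqP]; rewrite subr0 oner_eq0.
have : o + comb e1 e2 e3 n a b c t \in (<[Pt x 0%R]> + (<[n]> + <[(Pt x 1 - Pt x 0)%R]>))%VS.
  apply: (subvP (plane_sub (dimP rP) (C_aff (PtC x 0)) hn eh n0 en (Pr 0) nr (memvB (Pr 1) (Pr 0)) _ _ _)) vR.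
  - by rewrite (subvP (addvSl _ _)) ?memv_line.
  - by rewrite (subvP (addvSr _ _)) // (subvP (addvSl _ _)) ?memv_line.
  by rewrite (subvP (addvSr _ _)) // (subvP (addvSr _ _)) ?memv_line.
case/memv_addP=> _ /vlineP[k1 ->] [_ /memv_addP[_ /vlineP[k2 ->] [_ /vlineP[k3 ->] ->]] E].
have k11 : k1 = 1.
  have : h (o + comb e1 e2 e3 n a b c t) = 1 by rewrite hD h_comb h_o addr0.
  by rewrite E !hD !hZ hn eh C_aff // !mulr0 !addr0 mulr1.
move: E; rewrite k11 scale1r Pt_sub => E.
have /addrI/(indep_inj ind)[-> -> -> _] : o + comb e1 e2 e3 n a b c t =
   o + comb e1 e2 e3 n x k3 (x * k3) (f x 0 + k2 + k3 * (f x 1 - f x 0)).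
  by rewrite E; apply/rowP => i; rewrite !mxE; ring.
by [].
Qed.

Lemma S_coord y a b c t : o + comb e1 e2 e3 n a b c t \in S y -> b = y /\ c = a * y.
Proof.
move=> vS; have [sP ns Ps] := SP y.
have eh : h (Pt 1 y - Pt 0 y) = 0 by rewrite hPt_sub.
have en : Pt 1 y - Pt 0 y \notin <[n]>%VS.
  by apply/negP; rewrite Pt_sub => /in_line_n[/eqP]; rewrite subr0 oner_eq0.
have : o + comb e1 e2 e3 n a b c t \in (<[Pt 0%R y]> + (<[n]> + <[(Pt 1 y - Pt 0 y)%R]>))%VS.
  apply: (subvP (plane_sub (dimP sP) (C_aff (PtC 0 y)) hn eh n0 en (Ps 0) ns (memvB (Ps 1) (Ps 0)) _ _ _)) vS.
  - by rewrite (subvP (addvSl _ _)) ?memv_line.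
  - by rewrite (subvP (addvSr _ _)) // (subvP (addvSl _ _)) ?memv_line.
  by rewrite (subvP (addvSr _ _)) // (subvP (addvSr _ _)) ?memv_line.
case/memv_addP=> _ /vlineP[k1 ->] [_ /memv_addP[_ /vlineP[k2 ->] [_ /vlineP[k3 ->] ->]] E].
have k11 : k1 = 1.
  have : h (o + comb e1 e2 e3 n a b c t) = 1 by rewrite hD h_comb h_o addr0.
  by rewrite E !hD !hZ hn eh C_aff // !mulr0 !addr0 mulr1.
move: E; rewrite k11 scale1r Pt_sub => E.
have /addrI/(indep_inj ind)[-> -> -> _] : o + comb e1 e2 e3 n a b c t =
   o + comb e1 e2 e3 n k3 y (k3 * y) (f 0 y + k2 + k3 * (f 1 y - f 0 y)).
  by rewrite E; apply/rowP => i; rewrite !mxE; ring.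
by [].
Qed.

(* If [c = mu^2], the direction [(0, 0, -mu, 2 mu^2)] is that of the lines of only one parallel
   class of planes, so that the point [X] lies on a single plane. *)
Lemma nonsquare (a b1 b2 d e c mu : F) : e != 0 -> c != 0 ->
  (forall x y, f x y = a + b1 * x + b2 * y + d * (x * y) + e * (y ^+ 2 + c * x ^+ 2)) ->
  mu ^+ 2 != c.
Proof.
move=> e0 c0 fE; apply/eqP => mu2.
have mu0 : mu != 0 by apply: contraNneq c0 => mu0; rewrite -mu2 mu0 expr0n.
have o10 : 0 != 1 :> F by rewrite eq_sym oner_neq0.
have oN1 : 0 != -1 :> F by rewrite eq_sym oppr_eq0 oner_neq0.
have N11 : 1 != -1 :> F by rewrite -subr_eq0 opprK.
have muN : 0 != - mu by rewrite eq_sym oppr_eq0.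
(* The midpoint of [Pt 1 (- mu)] and [Pt (-1) mu], both on the plane over the line y = - mu x. *)
pose X := o + comb e1 e2 e3 n 0 0 (- mu) (a - d * mu + e * (2 * mu ^+ 2)).
have hX : h X = 1 by rewrite hD h_comb h_o addr0.
have XC : X \notin C.
  apply/negP => /CPt[x [y /addrI/(indep_inj ind)[<- <- /eqP]]].
  by rewrite mulr0 eq_sym (negbTE muN).
have ne x y x' y' : x != x' -> Pt x y != Pt x' y' by apply: contraNneq => /Pt_inj[->].
have [p [pP p0 p1]] := joinP (PtC 0 0) (PtC 1 (- mu)) (ne _ _ _ _ o10).
have np : n \notin p by apply: (notin_n pP o10 muN p0 p1).
have [m [k [m0 line]]] := plane_line pP np.
have k0 : k = 0 by have := line_uniq pP np (line 0) p0; rewrite mulr0 add0r.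
have mE : m = - mu by have := line_uniq pP np (line 1) p1; rewrite k0 mulr1 addr0.
have pN : Pt (-1) mu \in p by have := line (-1); rewrite k0 mE mulrN1 opprK addr0.
have Xp : X \in p.
  have -> : X = Pt 0 0 + 2^-1 *: (Pt 1 (- mu) - Pt 0 0) + 2^-1 *: (Pt (-1) mu - Pt 0 0).
    rewrite !Pt_sub !fE.
    have x0E : 2^-1 * (1 - 0) + 2^-1 * (- 1 - 0) = 0 :> F by ring.
    have y0E : 2^-1 * (- mu - 0) + 2^-1 * (mu - 0) = 0 by ring.
    have zE : 2^-1 * (1 * - mu - 0 * 0) + 2^-1 * (-1 * mu - 0 * 0) = - mu.
      by transitivity (- (2^-1 * 2 * mu)); [ring | rewrite mulVf // mul1r].
    transitivity (o + comb e1 e2 e3 n (2^-1 * (1 - 0) + 2^-1 * (- 1 - 0))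
       (2^-1 * (- mu - 0) + 2^-1 * (mu - 0)) (2^-1 * (1 * - mu - 0 * 0) + 2^-1 * (-1 * mu - 0 * 0))
       (a - d * mu + e * (2 * mu ^+ 2))); first by rewrite x0E y0E zE.
    rewrite -mu2 PtE fE.
    have -> : a - d * mu + e * (2 * mu ^+ 2) = (a + b1 * 0 + b2 * 0 + d * (0 * 0) + e * (0 ^+ 2 + mu ^+ 2 * 0 ^+ 2)) +
      2^-1 * (a + b1 * 1 + b2 * - mu + d * (1 * - mu) + e * ((- mu) ^+ 2 + mu ^+ 2 * 1 ^+ 2)
        - (a + b1 * 0 + b2 * 0 + d * (0 * 0) + e * (0 ^+ 2 + mu ^+ 2 * 0 ^+ 2)))
      + 2^-1 * (a + b1 * -1 + b2 * mu + d * (-1 * mu) + e * (mu ^+ 2 + mu ^+ 2 * (-1) ^+ 2)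
        - (a + b1 * 0 + b2 * 0 + d * (0 * 0) + e * (0 ^+ 2 + mu ^+ 2 * 0 ^+ 2))) by field.
    by apply/rowP => i; rewrite !mxE; ring.
  exact: memvD (memvD p0 (memvZ _ (memvB p1 p0))) (memvZ _ (memvB pN p0)).
have [r [rP rp Xr]] := two_planes hX XC pP Xp.
have [nr|nr] := boolP (n \in r).
  have [v vC vr] := blk_ex rP; have [x [y vE]] := CPt vC; rewrite vE in vr.
  have [rE|rE] := plane_RS rP nr vr; rewrite rE in Xr.
    have [x0 /eqP] := R_coord Xr; by rewrite mulr0 eq_sym (negbTE muN).
  have [y0 /eqP] := S_coord Xr; by rewrite mul0r eq_sym (negbTE muN).
(* For the plane over y = m' x + k', passing through [X] forces k' = 0 and leaves two equations in
   m' and the parameter [s]. *)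
have [m' [k' [m'0 line']]] := plane_line rP nr.
have [s [t]] := plane_span rP (line' 0) (line' 1) (line' (-1)) o10 oN1 N11 Xr.
rewrite hX scale1r PtE !Pt_sub => E.
have /addrI/(indep_inj ind)[/esym xE /esym yE zE wE] : X = o + comb e1 e2 e3 n (s - t) (k' + m' * (s - t))
   (s * (m' + k') + t * (m' - k'))
   (f 0 k' + s * (f 1 (m' + k') - f 0 k') + t * (f (-1) (k' - m') - f 0 k')).
  rewrite E mulr0 add0r mulr1 mulrN1 [- m' + k']addrC.
  by apply/rowP => i; rewrite !mxE; ring.
rewrite xE mulr0 addr0 in yE; move/subr0_eq: xE => st; rewrite -st yE in zE wE.
have E1 : 2 * (s * m') = - mu by rewrite zE; ring.
have E2 : s * (m' ^+ 2 + mu ^+ 2) = mu ^+ 2.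
  apply: (mulfI two0); apply: (mulfI e0); move: wE; rewrite !fE -mu2 => wE.
  apply/eqP; rewrite -subr_eq0; apply/eqP.
  have : d * (2 * (s * m') + mu) = 0 by rewrite E1 addNr mulr0.
  move=> D0; rewrite -[RHS]oppr0 -[in RHS]D0; apply/eqP; rewrite -subr_eq0; apply/eqP.
  move/eqP: wE; rewrite -subr_eq0 => /eqP wE; rewrite -[RHS]oppr0 -[in RHS]wE; ring.
(* Eliminating [s] gives an equation for m' with the double root - mu, so the second plane through
   [X] would be [p] again. *)
have : mu * (m' + mu) ^+ 2 = 0.
  have E3 : 2 * (s * m') * (m' ^+ 2 + mu ^+ 2) = 2 * m' * mu ^+ 2 by rewrite -[in RHS]E2; ring.
  move: E3; rewrite E1 => /eqP; rewrite -subr_eq0 => /eqP E3.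
  by rewrite -[RHS]oppr0 -[in RHS]E3; ring.
move/eqP; rewrite mulf_eq0 (negbTE mu0) sqrf_eq0 addr_eq0 => /eqP m'E.
case/eqP: rp; apply: (join_uniqP (ne 0 0 1 (- mu) o10)) => //.
  by have := line' 0; rewrite yE mulr0 addr0.
by have := line' 1; rewrite yE m'E mulr1 addr0.
Qed.

End Paraboloid.

(** The coefficients of 1, x, y and x y in [f] are absorbed by adding multiples of [n] to [o], [e1],
    [e2] and [e3], and the factor [e] by rescaling [n]. *)
Theorem canonical_form : (2 : F) != 0 -> exists o e1 e2 e3 n (c : F),
  [/\ [/\ h o = 1, h e1 = 0, h e2 = 0, h e3 = 0 & h n = 0], indep e1 e2 e3 n,
    forall mu : F, mu ^+ 2 != c &
    forall v, (v \in C) <-> exists x y, v = o + comb e1 e2 e3 n x y (x * y) (y ^+ 2 + c * x ^+ 2)].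
Proof.
move=> two0; have [v0 v0C] : exists v, v \in C.
  by apply/card_gt0P; rewrite card_C expn_gt0; case: (q) q_ge7.
have [v1 v1C v01] : exists2 v, v \in C & v0 != v.
  have : (0 < #|C :\ v0|)%N.
    have := cardsD1 v0 C; rewrite v0C card_C; move: #|C :\ v0| q_ge7; clear => m.
    by rewrite expnS expn1; case: m => // ? E; nia.
  by case/card_gt0P=> v /setD1P[vv0 vC]; exists v; rewrite // eq_sym.
have [p [pP _ _]] := joinP v0C v1C v01.
have [n [K1 [K2 [G _]]]] := grid_exists pP.
have [o [e1 [e2 [e3 [oC he ind [f [PtC CPt RP SP]]]]]]] := grid_coords G.
have [n0 hn KP _ [_ _ mt]] := G.
have [R RR] := fin_all_exists (fun x => let: ex_intro2 r a b := RP x in ex_intro (fun r => r \in K1 /\ forall y, _ \in r) r (conj a b)).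
have [S SS] := fin_all_exists (fun x => let: ex_intro2 r a b := SP x in ex_intro (fun r => r \in K2 /\ forall y, _ \in r) r (conj a b)).
have RP' x : [/\ R x \in P, n \in R x & forall y, o + comb e1 e2 e3 n x y (x * y) (f x y) \in R x].
  by have [rK Pr] := RR x; have [] := KP (R x); rewrite ?inE ?rK.
have SP' y : [/\ S y \in P, n \in S y & forall x, o + comb e1 e2 e3 n x y (x * y) (f x y) \in S y].
  by have [sK Ps] := SS y; have [] := KP (S y); rewrite ?inE ?sK ?orbT.
have RS x y : R x != S y by have [rK _] := RR x; have [sK _] := SS y; have [] := mt _ _ rK sK.
have [a [b1 [b2 [d [e [c [e0 c0 fE]]]]]]] := f_quadratic n0 hn he ind PtC CPt RP' SP' RS two0.
have ho : h o = 1 := C_aff oC; have [he1 he2 he3] := he.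
exists (o + a *: n), (e1 + b1 *: n), (e2 + b2 *: n), (e3 + d *: n), (e *: n), c.
have E x y z t : comb (e1 + b1 *: n) (e2 + b2 *: n) (e3 + d *: n) (e *: n) x y z t =
   comb e1 e2 e3 n x y z (x * b1 + y * b2 + z * d + t * e).
  by apply/rowP => i; rewrite !mxE; ring.
split.
- by rewrite !hD !hZ hn he1 he2 he3 ho !mulr0 !addr0.
- move=> x y z t; rewrite E => /ind[-> -> ->]; rewrite !mul0r !add0r => /eqP.
  by rewrite mulf_eq0 (negbTE e0) orbF => /eqP->.
- by move=> mu; exact: (nonsquare n0 hn he ind PtC CPt RP' SP' RS two0 mu e0 c0 fE).
have E' x y : o + a *: n + comb (e1 + b1 *: n) (e2 + b2 *: n) (e3 + d *: n) (e *: n) x y (x * y) (y ^+ 2 + c * x ^+ 2) =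
  o + comb e1 e2 e3 n x y (x * y) (f x y).
  by rewrite E fE; apply/rowP => i; rewrite !mxE; ring.
by move=> v; split=> [/CPt[x [y ->]]|[x [y ->]]]; [exists x, y; rewrite E' | rewrite E'].
Qed.

End Geometry.

(** X^2 - c has no root, hence is irreducible; [theta] is the class of X in the quotient. *)
Lemma quadratic_extension (F : finFieldType) (c : F) : (forall m, m ^+ 2 != c) ->
  exists (K : finFieldType) (io : {rmorphism F -> K}) (theta : K),
    #|K| = (#|F| ^ 2)%N /\ theta ^+ 2 = io c.
Proof.
move=> nsq; pose p : {poly F} := 'X^2 - c%:P.
have sp : size p = 3%N by rewrite size_XnsubC.
have mp : p \is monic by rewrite monicXnsubC.
have ip : irreducible_poly p.
  apply: cubic_irreducible => [|x]; first by rewrite sp.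
  by rewrite /root !hornerE subr_eq0 (negbTE (nsq x)).
have mi : monic_irreducible_poly p by split.
exists {poly %/ p with mi}, (in_alg {poly %/ p with mi}), ('qX : {poly %/ p with mi}).
split; first by rewrite card_qfpoly sp.
have hE : mk_monic p = p by rewrite /mk_monic sp mp.
have E (g : {poly F}) : in_qpoly g ('X^2 - c%:P) = ('qX : {poly %/ g}) ^+ 2 - c *: 1.
  by rewrite rmorphB rmorphXn /= -[c%:P]mulr1 mul_polyC in_qpolyZ in_qpoly1.
have Z : in_qpoly p p = 0 by apply/val_inj; rewrite /= hE Pdiv.RingMonic.rmodpp.
apply/eqP; rewrite -subr_eq0; apply/eqP.
exact: etrans (esym (E p)) Z.
Qed.

Lemma dim_flat (F : finFieldType) n d (U : flat F n d) : \dim U = d.+1.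
Proof. by case: U => U /= /eqP. Qed.

Lemma flat_eq (F : finFieldType) n d (U W : flat F n d) : (U : {vspace _}) = W -> U = W.
Proof. exact: val_inj. Qed.

(** * The conic over the quadratic extension *)

Section Model.

Variables (F K : finFieldType) (q : nat) (io : {rmorphism F -> K}) (theta : K) (c : F).
Notation V := 'rV[F]_5.
Variables (h : V -> F) (X Y : V -> K) (mk : F -> K -> K -> V).
Hypothesis card_F : #|F| = q.
Hypothesis q_ge7 : (7 <= q)%N.
Hypothesis two0 : (2 : F) != 0.
Hypothesis card_K : #|K| = (q ^ 2)%N.
Hypothesis theta2 : theta ^+ 2 = io c.
Hypothesis nsq : forall m, m ^+ 2 != c.
Hypothesis h_lin : forall a u v, h (a *: u + v) = a * h u + h v.
Hypothesis X_lin : forall a u v, X (a *: u + v) = io a * X u + X v.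
Hypothesis Y_lin : forall a u v, Y (a *: u + v) = io a * Y u + Y v.
Hypothesis mkh : forall a x y, h (mk a x y) = a.
Hypothesis mkX : forall a x y, X (mk a x y) = x.
Hypothesis mkY : forall a x y, Y (mk a x y) = y.
Hypothesis mkK : forall v, mk (h v) (X v) (Y v) = v.

Implicit Types (u v w : V) (k : K).

Lemma V_eq u v : h u = h v -> X u = X v -> Y u = Y v -> u = v.
Proof. by move=> hE XE YE; rewrite -(mkK u) hE XE YE mkK. Qed.

Let h0 : h 0 = 0 := h0 h_lin.
Let hZ : forall a v, h (a *: v) = a * h v := hZ h_lin.
Let hD : forall u v, h (u + v) = h u + h v := hD h_lin.
Let hN : forall v, h (- v) = - h v := hN h_lin.

Lemma X0 : X 0 = 0.
Proof. by have := X_lin (-1) 0 0; rewrite scaler0 addr0 rmorphN1 mulN1r addNr. Qed.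
Lemma Y0 : Y 0 = 0.
Proof. by have := Y_lin (-1) 0 0; rewrite scaler0 addr0 rmorphN1 mulN1r addNr. Qed.
Lemma XZ a v : X (a *: v) = io a * X v.
Proof. by have := X_lin a v 0; rewrite X0 !addr0. Qed.
Lemma YZ a v : Y (a *: v) = io a * Y v.
Proof. by have := Y_lin a v 0; rewrite Y0 !addr0. Qed.
Lemma XD u v : X (u + v) = X u + X v.
Proof. by have := X_lin 1 u v; rewrite scale1r rmorph1 mul1r. Qed.
Lemma YD u v : Y (u + v) = Y u + Y v.
Proof. by have := Y_lin 1 u v; rewrite scale1r rmorph1 mul1r. Qed.
Lemma XN v : X (- v) = - X v.
Proof. by rewrite -scaleN1r XZ rmorphN1 mulN1r. Qed.
Lemma YN v : Y (- v) = - Y v.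
Proof. by rewrite -scaleN1r YZ rmorphN1 mulN1r. Qed.
Let linE := (hD, XD, YD, hN, XN, YN, hZ, XZ, YZ, h0, X0, Y0, mkh, mkX, mkY).

Lemma basis_free (a b : F) : io a + io b * theta = 0 -> a = 0 /\ b = 0.
Proof.
have [->|b0] := eqVneq b 0.
  by rewrite rmorph0 mul0r addr0 => /eqP; rewrite fmorph_eq0 => /eqP.
move=> E; have tE : theta = io (- a / b).
  apply: (mulfI (x := io b)); first by rewrite fmorph_eq0.
  by rewrite -rmorphM [b * _]mulrC divfK // rmorphN; apply/eqP; rewrite -addr_eq0 addrC E.
by move: theta2; rewrite tE -rmorphXn => /fmorph_inj/eqP; rewrite (negbTE (nsq _)).
Qed.

Lemma basis_inj (a b a' b' : F) : io a + io b * theta = io a' + io b' * theta -> a = a' /\ b = b'.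
Proof.
move=> /eqP; rewrite -subr_eq0 opprD addrACA -mulrBl -!rmorphB => /eqP/basis_free.
by case=> /subr0_eq-> /subr0_eq->.
Qed.

Lemma basis_span k : exists a b, k = io a + io b * theta.
Proof.
pose g (ab : F * F) := io ab.1 + io ab.2 * theta.
have g_inj : injective g by move=> [a b] [a' b'] /basis_inj[/= -> ->].
have [|g' _ gK] := inj_card_bij g_inj; first by rewrite card_prod card_F card_K expnS expn1.
by exists (g' k).1, (g' k).2; rewrite -[LHS]gK.
Qed.

(** The coordinates [X] and [Y] make the kernel of [h] a copy of K^2. This is its scalar
    multiplication, extended to all vectors by dropping the [h]-component. *)
Definition kmul k v := mk 0 (k * X v) (k * Y v).

Lemma kmulA k k' v : kmul k (kmul k' v) = kmul (k * k') v.
Proof. by rewrite /kmul !linE !mulrA. Qed.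

Lemma kmul1 v : h v = 0 -> kmul 1 v = v.
Proof. by move=> hv; apply: V_eq; rewrite !linE ?mul1r. Qed.

Lemma kmul_io a v : h v = 0 -> kmul (io a) v = a *: v.
Proof. by move=> hv; apply: V_eq; rewrite !linE // hv mulr0. Qed.

Lemma kmulD k k' v : kmul (k + k') v = kmul k v + kmul k' v.
Proof. by apply: V_eq; rewrite !linE ?addr0 // mulrDl. Qed.

Lemma kmulDr k v w : kmul k (v + w) = kmul k v + kmul k w.
Proof. by apply: V_eq; rewrite !linE ?addr0 // mulrDr. Qed.

Lemma h_kmul k v : h (kmul k v) = 0. Proof. by rewrite linE. Qed.

Lemma kmul_eq0 k v : h v = 0 -> (kmul k v == 0) = (k == 0) || (v == 0).
Proof.
move=> hv; apply/eqP/orP => [E|[/eqP->|/eqP->]]; last 2 first.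
- by apply: V_eq; rewrite !linE ?mul0r.
- by apply: V_eq; rewrite !linE ?mulr0.
have [k0|k0] := eqVneq k 0; [by left; apply/eqP | right].
by apply/eqP; rewrite -(kmul1 hv) -(mulVf k0) -kmulA E; apply: V_eq; rewrite !linE ?mulr0.
Qed.

(** For [u] in the kernel of [h], the 1-dimensional K-subspace of [u], written over [F] with the
    basis 1, theta of [K]. *)
Definition kline u : {vspace V} := (<[u]> + <[kmul theta u]>)%VS.

Lemma klineP u w : h u = 0 -> reflect (exists k, w = kmul k u) (w \in kline u).
Proof.
move=> hu; apply: (iffP idP) => [/memv_addP[_ /vlineP[a ->] [_ /vlineP[b ->] ->]]|[k ->]].
  exists (io a + io b * theta).
  by rewrite kmulD kmul_io // -kmulA kmul_io ?h_kmul.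
have [a [b ->]] := basis_span k; rewrite kmulD kmul_io // -kmulA kmul_io ?h_kmul //.
by rewrite memv_add ?memvZ ?memv_line.
Qed.

Lemma kline_id u : h u = 0 -> u \in kline u.
Proof. by move=> hu; apply/klineP => //; exists 1; rewrite kmul1. Qed.

Lemma dim_kline u : h u = 0 -> u != 0 -> \dim (kline u) = 2%N.
Proof.
move=> hu u0; apply: dimv_line2 => //; apply/negP => /vlineP[a E].
have : kmul (theta - io a) u = 0.
  by rewrite kmulD -rmorphN kmul_io // E scaleNr subrr.
move/eqP; rewrite kmul_eq0 // (negbTE u0) orbF => /eqP E'.
have [_ /eqP] : - a = 0 /\ 1 = 0 :> F by apply: basis_free; rewrite rmorphN rmorph1 mul1r addrC.
by rewrite oner_eq0.
Qed.

Lemma kline_eq u w : h u = 0 -> w \in kline u -> w != 0 -> kline w = kline u.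
Proof.
move=> hu /(klineP _ hu)[k ->]; rewrite kmul_eq0 // negb_or => /andP[k0 _].
have hk := h_kmul k u.
apply/vspaceP => x; apply/(klineP _ hk)/(klineP _ hu) => [[k' ->]|[k' ->]].
  by exists (k' * k); rewrite kmulA.
by exists (k' / k); rewrite kmulA divfK.
Qed.

Variable Sigma : flat F 4 3.
Hypothesis in_Sigma : forall v, (v \in (Sigma : {vspace V})) = (h v == 0).

(** * The regular spread of K-lines *)

Definition kspread : {set flat F 4 1} :=
  [set s : flat F 4 1 | [exists u, [&& h u == 0, u != 0 & (s : {vspace V}) == kline u]]].

Lemma kspreadP (s : flat F 4 1) : reflect (exists u, [/\ h u = 0, u != 0 & (s : {vspace V}) = kline u])
  (s \in kspread).
Proof.
rewrite inE; apply: (iffP existsP) => -[u]; first by case/and3P=> /eqP ? ? /eqP ?; exists u.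
by case=> /eqP ? ? /eqP ?; exists u; apply/and3P.
Qed.

Lemma kspread_line u : h u = 0 -> u != 0 -> exists s : flat F 4 1, s \in kspread /\ (s : {vspace V}) = kline u.
Proof.
move=> hu u0; exists (Flat (introT eqP (dim_kline hu u0))); split=> //.
by apply/kspreadP; exists u.
Qed.

Lemma kspread_mem s u : s \in kspread -> u \in (s : {vspace V}) -> u != 0 -> h u = 0 /\ (s : {vspace V}) = kline u.
Proof.
move=> /kspreadP[w [hw w0 ->]] us u0; have [k uE] := klineP _ hw us.
by split; [rewrite uE h_kmul | rewrite (kline_eq hw)].
Qed.

Lemma kspread_sub s : s \in kspread -> (s <= Sigma)%VS.
Proof.
move=> sS; apply/subvP => v vs; rewrite in_Sigma; apply/eqP.
by have [->|v0] := eqVneq v 0; [exact: h0 | case: (kspread_mem sS vs v0)].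
Qed.

Lemma kspread_uniq s t u : s \in kspread -> t \in kspread -> u != 0 ->
  u \in (s : {vspace V}) -> u \in (t : {vspace V}) -> s = t.
Proof.
move=> sS tS u0 us ut; apply: flat_eq.
by have [_ ->] := kspread_mem sS us u0; have [_ ->] := kspread_mem tS ut u0.
Qed.

Lemma card_flat_vectors d (U : flat F 4 d) : #|[set v : V | v \in (U : {vspace V})]| = (q ^ d.+1)%N.
Proof.
by rewrite -card_F -(dim_flat U) -card_vspace; apply: eq_card => v; rewrite inE.
Qed.

Lemma card_nonzero (U : flat F 4 1) : #|[set v : V | v \in (U : {vspace V})] :\ 0| = (q ^ 2).-1.
Proof.
have := cardsD1 0 [set v : V | v \in (U : {vspace V})].
by rewrite card_flat_vectors inE mem0v => ->.
Qed.

(** A nonzero vector is on at most one line of [T], so vectors can be counted line by line.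
    Uniqueness will need the count restricted to the vectors [A] with X = 0. *)
Lemma card_partial_spread (T : {set flat F 4 1}) (A : {set V}) m :
  (forall s t, s \in T -> t \in T -> s != t -> (s :&: t)%VS = 0%VS) ->
  (forall s, s \in T -> #|[set v in A | (v != 0%R) && (v \in (s : {vspace V}))]| = m) ->
  (#|T| * m = #|[set v in A | (v != 0%R) && [exists s in T, v \in (s : {vspace V})]]|)%N.
Proof.
move=> dis cm; rewrite -sum_nat_const.
transitivity (\sum_(s in T) \sum_(v in [set v in A | (v != 0)%R] | v \in (s : {vspace V})) 1)%N.
  apply: eq_bigr => s sT; rewrite -(cm s sT) -sum1_card; apply: eq_bigl => v.
  by rewrite !inE andbA.
rewrite (exchange_big_dep (fun v => (v \in A) && (v != 0) && [exists s in T, v \in (s : {vspace V})])) /=.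
  rewrite -sum1_card; apply: eq_big => [v|v /andP[/andP[vA v0] /existsP[s /andP[sT vs]]]].
    by rewrite inE andbA.
  rewrite (big_pred1 s) // => t; rewrite !inE vA v0 /=; apply/andP/eqP => [[tT vt]|-> //].
  apply/eqP; apply: contraT => ts; have := dis t s tT sT ts => /vspaceP/(_ v).
  by rewrite memv_cap vt vs memv0 (negbTE v0).
by move=> s v sT; rewrite inE => /andP[-> vs]; apply/existsP; exists s; rewrite sT.
Qed.

Lemma kspread_spread : spread Sigma kspread.
Proof.
have dis s t : s \in kspread -> t \in kspread -> s != t -> (s :&: t)%VS = 0%VS.
  move=> sS tS st; apply/eqP; rewrite -subv0; apply/subvP => u; rewrite memv_cap memv0.
  case/andP=> us ut; apply: contraNT st => u0; apply/eqP; exact: kspread_uniq sS tS u0 us ut.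
split=> //.
(* The q^4 - 1 nonzero vectors of [Sigma] are divided among lines with q^2 - 1 of them each. *)
- have := card_partial_spread (A := setT) dis (m := (q ^ 2).-1).
  have -> : [set v in setT | (v != 0) && [exists s in kspread, v \in (s : {vspace V})]] =
      [set v : V | v \in (Sigma : {vspace V})] :\ 0.
    apply/setP => v; rewrite !inE andTb in_Sigma andbC; have [v0|v0] := eqVneq v 0; rewrite ?andbF ?andbT //.
    apply/existsP/eqP => [[s /andP[sS vs]]|hv]; first by case: (kspread_mem sS vs v0).
    by have [s [sS sE]] := kspread_line hv v0; exists s; rewrite sS sE kline_id.
  have := cardsD1 0 [set v : V | v \in (Sigma : {vspace V})].
  rewrite card_flat_vectors inE mem0v => E.
  have cm s : s \in kspread -> #|[set v in setT | (v != 0) && (v \in (s : {vspace V}))]| = (q ^ 2).-1.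
    move=> _; rewrite -(card_nonzero s); apply: eq_card => v; by rewrite !inE.
  move=> /(_ cm); move: E; rewrite card_F; move: #|_ :\ 0| #|kspread| => a b.
  rewrite !expnS expn0; move: q_ge7; clear; case: q => // k ? E E'; nia.
- exact: kspread_sub.
- move=> x xS; have [v vx v0] : exists2 v, v \in (x : {vspace V}) & v != 0.
    by apply: dimv_gt0_mem; rewrite dim_flat.
  have hv : h v = 0 by apply/eqP; rewrite -in_Sigma (subvP xS).
  have [s [sS sE]] := kspread_line hv v0; exists s => //; rewrite sE.
  have -> : (x : {vspace V}) = <[v]>%VS.
    by apply/esym/eqP; rewrite eqEdim -memvE vx dim_flat dim_vline v0.
  by rewrite -memvE kline_id.
Qed.

(** Choose [w3 = w1 + w2] with one vector on each line. For nonzero k in [K] the F-span of k w1 and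
    k w2 is a transversal, so [m] meets it in a vector k (a w1 + b w2) with a, b in [F]. If the
    ratio of a and b is the same for k = 1 and k = theta, then [m] is a K-line. *)
Lemma kspread_regular : regular kspread.
Proof.
move=> s1 s2 s3 S1 S2 S3 s12 s23 s13; apply/subsetP => m; rewrite inE => /forallP m_meet.
have [c3 sub dis cov] := kspread_spread.
have dS : (s1 + s2)%VS = Sigma.
  have d12 : \dim (s1 + s2)%VS = 4%N.
    by rewrite (dimv_disjoint_sum (dis _ _ S1 S2 s12)) (dim_flat s1) (dim_flat s2).
  by apply/eqP; rewrite eqEdim subv_add (sub _ S1) (sub _ S2) d12 (dim_flat Sigma).
have [w3 w3s w30] : exists2 v, v \in (s3 : {vspace V}) & v != 0.
  by apply: dimv_gt0_mem; rewrite dim_flat.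
have : w3 \in (s1 + s2)%VS by rewrite dS (subvP (sub _ S3)).
case/memv_addP=> w1 w1s [w2 w2s wE].
have w10 : w1 != 0.
  apply: contraNneq s23 => w0; rewrite w0 add0r in wE; rewrite wE in w3s w30.
  by apply/eqP; apply: (kspread_uniq S2 S3 w30).
have w20 : w2 != 0.
  apply: contraNneq s13 => w0; rewrite w0 addr0 in wE; rewrite wE in w3s w30.
  by apply/eqP; apply: (kspread_uniq S1 S3 w30).
have [hw1 s1E] := kspread_mem S1 w1s w10.
have [hw2 s2E] := kspread_mem S2 w2s w20.
have [hw3 s3E] := kspread_mem S3 w3s w30.
have ind k k' : kmul k w1 + kmul k' w2 = 0 -> k = 0 /\ k' = 0.
  move=> E; have z1 : kmul k w1 = 0.
    apply/eqP; rewrite -memv0 -(dis s1 s2 S1 S2 s12) memv_cap s1E; apply/andP; split.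
      by apply/klineP => //; exists k.
    move/eqP: E; rewrite addr_eq0 => /eqP->; rewrite memvN s2E.
    by apply/klineP => //; exists k'.
  move: E; rewrite z1 add0r => z2.
  by move/eqP: z1; rewrite kmul_eq0 // (negbTE w10) orbF => /eqP->;
     move/eqP: z2; rewrite kmul_eq0 // (negbTE w20) orbF => /eqP->.
have trans k : k != 0 -> exists a b : F,
    let p := kmul (io a * k) w1 + kmul (io b * k) w2 in p != 0 /\ p \in (m : {vspace V}).
  move=> k0; have kw1 : kmul k w1 != 0 by rewrite kmul_eq0 // negb_or k0.
  have kw2 : kmul k w2 \notin <[kmul k w1]>%VS.
    apply/negP => /vlineP[a E]; have : kmul (io a * k) w1 + kmul (- k) w2 = 0.
      by rewrite -kmulA kmul_io ?h_kmul // -E -mulN1r -(rmorphN1 io) -kmulA kmul_io ?h_kmul // scaleN1r subrr.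
    by case/ind=> _ /eqP; rewrite oppr_eq0 (negbTE k0).
  pose t : flat F 4 1 := Flat (introT eqP (dimv_line2 kw1 kw2)).
  have meetI (l : flat F 4 1) u : u != 0 -> u \in (t : {vspace V}) -> u \in (l : {vspace V}) -> meets t l.
    by move=> u0 ut ul; apply: contraNneq u0 => E; rewrite -memv0 -E memv_cap ut.
  have t1 : kmul k w1 \in (t : {vspace V}) by rewrite (subvP (addvSl _ _)) ?memv_line.
  have t2 : kmul k w2 \in (t : {vspace V}) by rewrite (subvP (addvSr _ _)) ?memv_line.
  have := m_meet t; rewrite (meetI s1 (kmul k w1)) //; last first.
    by rewrite s1E; apply/klineP => //; exists k.
  rewrite (meetI s2 (kmul k w2)) ?kmul_eq0 ?negb_or ?k0 //; last first.
    by rewrite s2E; apply/klineP => //; exists k.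
  rewrite (meetI s3 (kmul k w3)) ?kmul_eq0 ?negb_or ?k0 //; last 2 first.
  - by rewrite wE kmulDr; exact: memvD t1 t2.
  - by rewrite s3E; apply/klineP => //; exists k.
  move=> /= tm; have [p] : exists2 p, p \in (t :&: m)%VS & p != 0.
    by apply: dimv_gt0_mem; rewrite lt0n dimv_eq0.
  rewrite memv_cap => /andP[/memv_addP[_ /vlineP[a ->] [_ /vlineP[b ->] ->]] pm] p0.
  by exists a, b; rewrite /= -!kmulA !kmul_io ?h_kmul.
have theta0 : theta != 0.
  apply/eqP => t0; have [_ /eqP] : 0 = 0 :> F /\ 1 = 0 :> F.
    by apply: basis_free; rewrite rmorph0 t0 mulr0 addr0.
  by rewrite oner_eq0.
have theta10 : 1 + theta != 0.
  apply/eqP => t0; have [/eqP _ /eqP] : 1 = 0 :> F /\ 1 = 0 :> F.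
    by apply: basis_free; rewrite rmorph1 mul1r.
  by rewrite oner_eq0.
(* [p1] and [p2] span [m]. Expressing [p3] by them and comparing the coefficients of 1 and theta
   shows that [p2] is an F-multiple of [kmul theta p1]. *)
have [a1 [b1 [p10 p1m]]] := trans 1 (oner_neq0 _).
have [a2 [b2 [p20 p2m]]] := trans theta theta0.
have [a3 [b3 [p30 p3m]]] := trans (1 + theta) theta10.
move: p10 p1m p20 p2m p30 p3m.
set p1 := (X in X != 0); move=> p10 p1m; set p2 := (X in X != 0); move=> p20 p2m.
set p3 := (X in X != 0); move=> p30 p3m.
have coef (k1 k2 k1' k2' : K) : kmul k1 w1 + kmul k2 w2 = kmul k1' w1 + kmul k2' w2 -> k1 = k1' /\ k2 = k2'.
  move=> E; have : kmul (k1 - k1') w1 + kmul (k2 - k2') w2 = 0.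
    have kmulN (k0 : K) w0 : kmul (- k0) w0 = - kmul k0 w0.
      by apply: V_eq; rewrite !linE ?oppr0 // mulNr.
    by rewrite !kmulD !kmulN addrACA -opprD E subrr.
  by case/ind=> /subr0_eq-> /subr0_eq->.
have p2n : p2 \notin <[p1]>%VS.
  apply/negP => /vlineP[a E]; case/negP: p20.
  move: E; rewrite /p1 /p2 scalerDr -!kmul_io ?h_kmul // !kmulA !mulr1 -!rmorphM => /coef[E1 E2].
  have E1' : io 0 + io a2 * theta = io (a * a1) + io 0 * theta by rewrite rmorph0 add0r mul0r addr0.
  have E2' : io 0 + io b2 * theta = io (a * b1) + io 0 * theta by rewrite rmorph0 add0r mul0r addr0.
  rewrite /p2; have [_ ->] := basis_inj E1'; have [_ ->] := basis_inj E2'.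
  by rewrite rmorph0 mul0r; apply/eqP; apply: V_eq; rewrite !linE ?mul0r ?addr0.
have mE : (m : {vspace V}) = (<[p1]> + <[p2]>)%VS.
  by apply/esym/eqP; rewrite eqEdim dimv_line2 // dim_flat subv_add -!memvE p1m p2m.
move: p3m; rewrite mE => /memv_addP[_ /vlineP[x ->] [_ /vlineP[y ->] p3E]].
have [Ea Eb] : io a3 * (1 + theta) = io (x * a1) + io (y * a2) * theta /\
               io b3 * (1 + theta) = io (x * b1) + io (y * b2) * theta.
  apply: coef; rewrite p3E /p1 /p2 !scalerDr -!kmul_io ?h_kmul // !kmulA !mulr1 !kmulD !mulrA -!rmorphM.
  by rewrite addrACA.
rewrite !mulrDr !mulr1 in Ea Eb.
have [xa1 ya2] := basis_inj Ea; have [xb1 yb2] := basis_inj Eb.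
have y0 : y != 0.
  apply: contraNneq p30 => y0; rewrite /p3 ya2 yb2 y0 !mul0r rmorph0 !mul0r.
  by apply/eqP; apply: V_eq; rewrite !linE ?mul0r ?addr0.
have hp1 : h p1 = 0 by rewrite /p1 !linE addr0.
have dk := dim_kline hp1 p10; have d12 := dimv_line2 p10 p2n.
apply/kspreadP; exists p1; split=> //.
apply/esym/eqP; rewrite mE eqEdim dk d12 leqnn andbT.
rewrite subv_add -!memvE (subvP (addvSl _ _)) ?memv_line //=.
have -> : kmul theta p1 = (y / x) *: p2; last by rewrite memvZ // (subvP (addvSr _ _)) ?memv_line.
have x0 : x != 0.
  apply: contraNneq p30 => x0; rewrite /p3 xa1 xb1 x0 !mul0r rmorph0 !mul0r.
  by apply/eqP; apply: V_eq; rewrite !linE ?mul0r ?addr0.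
have hp2 : h p2 = 0 by rewrite /p2 !linE addr0.
rewrite -(kmul_io _ hp2) /p1 /p2 !kmulDr !kmulA !mulr1 !mulrA -!rmorphM.
have -> : y / x * a2 = a1 by apply: (mulfI x0); rewrite -xa1 ya2; field.
have -> : y / x * b2 = b1 by apply: (mulfI x0); rewrite -xb1 yb2; field.
by rewrite ![theta * _]mulrC.
Qed.


(** * The arc and the uniqueness of the spread *)

Definition cpt k := mk 1 k (k ^+ 2).

Variable C : {set flat F 4 0}.
Hypothesis C_P : forall x, x \in C -> exists k, (x : {vspace V}) = <[cpt k]>%VS.
Hypothesis P_C : forall k, exists2 x, x \in C & (x : {vspace V}) = <[cpt k]>%VS.
Hypothesis card_C : #|C| = (q ^ 2)%N.

Lemma C_affine x : x \in C -> affine Sigma x.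
Proof.
case/C_P=> k xE; apply/negP => /subvP/(_ (cpt k)).
by rewrite xE memv_line in_Sigma mkh oner_eq0 => /(_ isT).
Qed.

Lemma card_bb_set (T : {set flat F 4 1}) : #|bb_set Sigma T C| = (q ^ 2)%N.
Proof.
pose D := [set y : {x : flat F 4 0 | affine Sigma x} | val y \in C].
have -> : bb_set Sigma T C = [set inl y | y in D].
  apply/setP => x; rewrite inE; apply/idP/imsetP => [|[y]]; last by rewrite inE => yC ->.
  by case: x => [y yC|//]; exists y; rewrite ?inE.
rewrite card_imset => [|y y' [//]]; rewrite -(card_imset _ val_inj) -card_C.
congr #|pred_of_set _|; apply/setP => x; apply/imsetP/idP => [[y]|xC]; first by rewrite inE => ? ->.
by exists (Sub x (C_affine xC)); rewrite ?inE SubK.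
Qed.

Lemma cpt_inj : injective cpt.
Proof. by move=> k k' E; rewrite -(mkX 1 k (k ^+ 2)) -/(cpt k) E mkX. Qed.

Lemma cpt_sub k k' : cpt k - cpt k' = mk 0 (k - k') (k ^+ 2 - k' ^+ 2).
Proof. by apply: V_eq; rewrite !linE ?subrr. Qed.

Lemma bb_setP (T : {set flat F 4 1}) (x : point (bruck_bose Sigma T)) : x \in bb_set Sigma T C ->
  exists y k, x = inl y /\ ((val y : flat F 4 0) : {vspace V}) = <[cpt k]>%VS.
Proof. by rewrite inE; case: x => [y /C_P[k yE]|//]; exists y, k. Qed.

(** Over [K] the chord from k1 to k2 has slope k1 + k2; a third point k3 on it would satisfy k1 + k3
    = k1 + k2. *)
Lemma kspread_arc : k_arc (bruck_bose Sigma kspread) (q ^ 2) (bb_set Sigma kspread C).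
Proof.
split=> [|x1 x2 x3 /bb_setP[y1 [k1 [-> E1]]] /bb_setP[y2 [k2 [-> E2]]] /bb_setP[y3 [k3 [-> E3]]]].
  exact: card_bb_set.
move=> n12 n23 n13 [[[L /= LP]|] []] //=; rewrite E1 E2 E3 -!memvE => L1 L2 L3.
have k12 : k1 != k2.
  apply: contraNneq n12 => k12; apply/eqP; congr inl; apply/val_inj/flat_eq.
  by rewrite /= E1 E2 k12.
have k23 : k2 != k3.
  apply: contraNneq n23 => k23; apply/eqP; congr inl; apply/val_inj/flat_eq.
  by rewrite /= E2 E3 k23.
have /andP[_ /exists_inP[s sS /eqP sE]] := LP.
have ds k : cpt k \in (L : {vspace V}) -> cpt k1 - cpt k \in (s : {vspace V}).
  by move=> Lk; rewrite -sE memv_cap memvB // in_Sigma !linE subrr eqxx.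
have d12 : cpt k1 - cpt k2 != 0 by rewrite subr_eq0 (inj_eq cpt_inj).
have [hd sE'] := kspread_mem sS (ds _ L2) d12.
have := ds _ L3; rewrite sE' => /(klineP _ hd)[k].
rewrite !cpt_sub /kmul !linE => E.
have EX := congr1 X E; have EY := congr1 Y E; rewrite !mkX in EX; rewrite !mkY in EY.
case/negP: k23; apply/eqP; apply: (addrI k1).
have k0 : k1 - k3 != 0.
  apply: contraNneq n13 => /subr0_eq k13; apply/eqP; congr inl; apply/val_inj/flat_eq.
  by rewrite /= E1 E3 k13.
apply: (mulfI k0); rewrite -[RHS]subr_sqr EY subr_sqr EX; ring.
Qed.

Lemma two0K : (2 : K) != 0.
Proof. by rewrite -(rmorph_nat io) fmorph_eq0. Qed.

(* The chords of [C] from the point [cpt k] have direction [u] exactly when [Y u / X u - X u = 2 k]. *)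
Definition chord_inj (s : {vspace V}) := forall u u', u \in s -> u' \in s -> X u != 0 -> X u' != 0 ->
  Y u / X u - X u = Y u' / X u' - X u' -> u = u'.

(** With 2 k the common value, [cpt (k + X u)] is [cpt k + u], and likewise for [u']. If [u != u'],
    the plane spanned by [cpt k] and [s] is a line of the Bruck-Bose plane with three points of the
    arc. *)
Lemma arc_chord_inj (T : {set flat F 4 1}) s : spread Sigma T ->
  k_arc (bruck_bose Sigma T) (q ^ 2) (bb_set Sigma T C) -> s \in T -> chord_inj s.
Proof.
move=> [_ sub _ _] [_ arc] sT u u' us u's Xu Xu' E.
have hs w : w \in (s : {vspace V}) -> h w = 0.
  by move=> ws; apply/eqP; rewrite -in_Sigma (subvP (sub s sT)).
apply/eqP; apply: contraT => uu.
pose k := (Y u / X u - X u) / 2.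
have PD w : w \in (s : {vspace V}) -> X w != 0 -> Y w / X w - X w = 2 * k -> cpt (k + X w) = cpt k + w.
  move=> ws Xw wE; apply: V_eq; rewrite !linE ?(hs w) ?addr0 //.
  have -> : Y w = (2 * k + X w) * X w by rewrite -wE subrK divfK.
  ring.
have kE : 2 * k = Y u / X u - X u by rewrite /k mulrC divfK // two0K.
have kE' : 2 * k = Y u' / X u' - X u' by rewrite kE E.
have P1 := PD u us Xu (esym kE); have P2 := PD u' u's Xu' (esym kE').
have hPk : h (cpt k) = 1 by rewrite linE.
have Pks : cpt k \notin (s : {vspace V}).
  by apply/negP => /hs; rewrite hPk => /eqP; rewrite oner_eq0.
pose U := (<[cpt k]> + s)%VS.
have dU : \dim U == 3%N.
  apply/eqP; rewrite dimv_disjoint_sum ?dim_vline ?(dim_flat s).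
    by rewrite (_ : cpt k != 0) //; apply: contraNneq Pks => ->; rewrite mem0v.
  apply/eqP; rewrite -subv0; apply/subvP => w; rewrite memv_cap => /andP[/vlineP[a ->] as_].
  have := hs _ as_; rewrite !linE mulr1 => ->; by rewrite scale0r mem0v.
pose L : flat F 4 2 := Flat dU.
have LP : affine Sigma L && [exists t in T, (L :&: Sigma)%VS == t].
  apply/andP; split.
    apply/negP => /subvP/(_ (cpt k)); rewrite in_Sigma hPk oner_eq0.
    by rewrite (subvP (addvSl _ _)) ?memv_line // => /(_ isT).
  apply/exists_inP; exists s => //; apply/eqP/vspaceP => w; rewrite memv_cap in_Sigma.
  apply/andP/idP => [[/memv_addP[_ /vlineP[a ->] [v vs ->]] /eqP]|ws].
    by rewrite hD hZ hPk (hs v vs) addr0 mulr1 => ->; rewrite scale0r add0r.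
  by rewrite (subvP (addvSr _ _)) // (hs w ws).
have pt k' : cpt k' \in U -> exists y : {x : flat F 4 0 | affine Sigma x},
   [/\ val y \in C, ((val y : flat F 4 0) : {vspace V}) = <[cpt k']>%VS &
       bb_incident (inl y : bb_point Sigma T) (Some (exist _ L LP))].
  move=> k'U; have [x xC xE] := P_C k'.
  by exists (exist _ x (C_affine xC)); split=> //=; rewrite xE -memvE.
have U0 : cpt k \in U by rewrite (subvP (addvSl _ _)) ?memv_line.
have Us w : w \in (s : {vspace V}) -> cpt k + w \in U.
  by move=> ws; rewrite memvD // (subvP (addvSr _ _)).
have U1 : cpt (k + X u) \in U by rewrite P1 Us.
have U2 : cpt (k + X u') \in U by rewrite P2 Us.
have [[y0 [C0 E0 I0]] [y1 [C1 E1 I1]] [y2 [C2 E2 I2]]] := And3 (pt _ U0) (pt _ U1) (pt _ U2).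
have ne (y y' : {x : flat F 4 0 | affine Sigma x}) k1 k2 : ((val y : flat F 4 0) : {vspace V}) = <[cpt k1]>%VS ->
    ((val y' : flat F 4 0) : {vspace V}) = <[cpt k2]>%VS -> k1 != k2 ->
    (inl y : bb_point Sigma T) != inl y'.
  move=> yE y'E; apply: contraNneq => -[yy]; rewrite yy y'E in yE.
  have : cpt k2 \in <[cpt k1]>%VS by rewrite -yE memv_line.
  case/vlineP=> a aE; have := congr1 h aE; rewrite !linE mulr1 => a1.
  by apply/eqP/cpt_inj; rewrite aE -a1 scale1r.
case: (arc (inl y0) (inl y1) (inl y2)); rewrite ?inE //.
- by apply: (ne _ _ _ _ E0 E1); rewrite -subr_eq0 opprD addrA subrr sub0r oppr_eq0.
- apply: (ne _ _ _ _ E1 E2); apply: contraNneq uu => /addrI XX; apply/eqP/V_eq => //.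
    by rewrite (hs u us) (hs u' u's).
  by move: E; rewrite XX => /addIr/(mulIf _)->; rewrite // invr_eq0.
- by apply: (ne _ _ _ _ E0 E2); rewrite -subr_eq0 opprD addrA subrr sub0r oppr_eq0.
by exists (Some (exist _ L LP)).
Qed.

(* A line of [Sigma] skew to [X = 0] is the graph of some [a |-> k a + w b], where [b] is the
   [theta]-coordinate of [a]; injectivity on chords forces [w = 0]. *)
Lemma skew_kspread (s : flat F 4 1) : (s <= Sigma)%VS -> chord_inj s ->
  (forall u, u \in (s : {vspace V}) -> X u = 0 -> u = 0) -> s \in kspread.
Proof.
move=> sub inj skew.
have hs w : w \in (s : {vspace V}) -> h w = 0 by move=> ws; apply/eqP; rewrite -in_Sigma (subvP sub).
have X_inj : {in [set v : V | v \in (s : {vspace V})] &, injective X}.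
  move=> u v; rewrite !inE => us vs E; apply/eqP; rewrite -subr_eq0; apply/eqP.
  by apply: skew; rewrite ?memvB // !linE E subrr.
have : X @: [set v : V | v \in (s : {vspace V})] = [set: K].
  by apply/eqP; rewrite eqEcard subsetT cardsT card_in_imset // card_flat_vectors card_K leqnn.
move=> imX; have ex a : exists2 u, u \in (s : {vspace V}) & X u = a.
  by move/setP/(_ a): imX; rewrite in_setT => /imsetP[u]; rewrite inE => us ->; exists u.
have [u1 u1s Xu1] := ex 1; have [u2 u2s Xu2] := ex theta.
(* The defect from K-linearity: [s] is a K-line exactly when [u2] is theta times [u1], that is w0 =
   w1 = 0. *)
have [w0 [w1 wE]] := basis_span (Y u2 - Y u1 * theta).
have Yu2 : Y u2 = Y u1 * theta + (io w0 + io w1 * theta) by rewrite -wE addrC subrK.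
have c_ne r : c - r ^+ 2 != 0 by rewrite subr_eq0 eq_sym nsq.
have key r : (w0 - w1 * r == 0) || (w1 * r ^+ 2 - 2 * w0 * r + w1 * c == 0).
  apply/negPn/negP; rewrite negb_or => /andP[A0 B0].
  (* The vectors t (r u1 + u2) and p u1 have the same value of Y / X - X when w0 + w1 theta = t b^2
     - p b with b = r + theta. Comparing the coefficients of 1 and theta gives these [t] and [p]; if
     both are nonzero, [chord_inj] equates two distinct vectors. *)
  pose t := (w0 - w1 * r) / (c - r ^+ 2).
  pose p := - (w1 * r ^+ 2 - 2 * w0 * r + w1 * c) / (c - r ^+ 2).
  have t0 : t != 0 by rewrite mulf_neq0 // invr_eq0.
  have p0 : p != 0 by rewrite mulf_neq0 ?invr_eq0 // oppr_eq0.
  have w1E : w1 = 2 * t * r - p by rewrite /t /p; field.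
  have w0E : w0 = t * (r ^+ 2 + c) - p * r by rewrite /t /p; field.
  pose b := io r + theta.
  have b0 : b != 0.
    apply/eqP => b0; have [_ /eqP] : r = 0 /\ 1 = 0 :> F by apply: basis_free; rewrite rmorph1 mul1r.
    by rewrite oner_eq0.
  pose u := t *: (r *: u1 + u2); pose v := p *: u1.
  have us : u \in (s : {vspace V}) by rewrite memvZ // memvD // memvZ.
  have vs : v \in (s : {vspace V}) by rewrite memvZ.
  have Xu : X u = io t * b by rewrite /u !linE Xu1 Xu2 mulr1.
  have Xv : X v = io p by rewrite /v !linE Xu1 mulr1.
  have it0 : io t != 0 by rewrite fmorph_eq0.
  have ip0 : io p != 0 by rewrite fmorph_eq0.
  have wb : io w0 + io w1 * theta = io t * b ^+ 2 - io p * b.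
    rewrite w0E w1E !(rmorphB, rmorphD, rmorphM, rmorphXn) /= -theta2 ?(rmorph_nat io 2) ?rmorph1 /b; ring.
  have : u = v.
    apply: inj => //; first by rewrite Xu mulf_neq0.
      by rewrite Xv.
    have Yu : Y u = io t * ((Y u1 + io t * b - io p) * b).
      by rewrite /u !linE Yu2 wb /b; ring.
    have Yv : Y v = io p * Y u1 by rewrite /v !linE.
    by rewrite Xu Xv Yu Yv; field; rewrite it0 ip0 b0.
  move/(congr1 X); rewrite Xu Xv => E.
  have [_ /eqP] : t * r - p = 0 /\ t = 0.
    by apply: basis_free; rewrite rmorphB rmorphM -E /b; ring.
  by rewrite (negbTE t0).
have c0 : c != 0 by have := nsq 0; rewrite expr0n eq_sym.
have w00 : w0 = 0 /\ w1 = 0.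
  have [w1z|w1z] := eqVneq w1 0.
    split=> //; have := key 1; rewrite w1z !mul0r subr0 addr0 sub0r mulr1 oppr_eq0.
    by rewrite mulf_eq0 (negbTE two0) /= orbb => /eqP.
  have w0z : w0 = 0.
    have := key 0; rewrite expr0n /= !mulr0 !subr0 add0r mulf_eq0 (negbTE w1z) (negbTE c0) /=.
    by rewrite orbF => /eqP.
  (* 1 is such a value unless - c = 1, in which case any r other than 0, 1 and - 1 will do. *)
  have [r r0 rc] : exists2 r : F, r != 0 & r ^+ 2 != - c.
    have : (0 < #|~: (0%R |: [set 1%R; (-1)%R : F])|)%N.
      rewrite cardsCs setCK card_F subn_gt0 (leq_trans _ q_ge7) // ltnS.
      by rewrite (leq_trans (leq_card_setU _ _)) // cards1 cards2; case: (_ != _).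
    case/card_gt0P=> r; rewrite !inE !negb_or => /and3P[r0 r1 rN].
    have [c1|c1] := eqVneq (- c) 1; last by exists 1; rewrite ?oner_neq0 // expr1n eq_sym.
    by exists r; rewrite // c1 -subr_eq0 subr_sqr_1 mulf_neq0 // ?subr_eq0 // addr_eq0.
  have := key r; rewrite w0z sub0r mulr0 mul0r subr0 oppr_eq0 mulf_eq0 (negbTE w1z) (negbTE r0) /=.
  by rewrite -mulrDr mulf_eq0 (negbTE w1z) /= addr_eq0 (negbTE rc).
have u10 : u1 != 0 by apply: contraNneq (oner_neq0 K) => u10; rewrite -Xu1 u10 !linE.
have hu1 := hs _ u1s.
apply/kspreadP; exists u1; split=> //.
apply/esym/eqP; rewrite eqEdim (dim_kline hu1 u10) (dim_flat s) leqnn andbT subv_add -!memvE u1s.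
have -> // : kmul theta u1 = u2.
apply: V_eq; rewrite !linE ?(hs u2) ?Xu1 ?Xu2 ?mulr1 //.
by rewrite Yu2; case: w00 => -> ->; rewrite !rmorph0 mul0r !addr0 mulrC.
Qed.

(** Lines of [T] skew to the K-line [Li] given by X = 0 are in [kspread], so it suffices that [Li]
    is in [T]. Otherwise only the few lines [T1] that meet [Li] can fail to be K-lines, and the
    slopes Y v / X v of their vectors are confined to q values. Two lines of [T1] then contradict
    [chord_inj]. *)
Lemma kspread_unique T : spread Sigma T -> k_arc (bruck_bose Sigma T) (q ^ 2) (bb_set Sigma T C) ->
  kspread = T.
Proof.
move=> Tsp arcT; have ci s := arc_chord_inj Tsp arcT (s := s).
have [cT subT disT covT] := Tsp; have [cS _ _ _] := kspread_spread.
have hT s w : s \in T -> w \in (s : {vspace V}) -> h w = 0.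
  by move=> sT ws; apply/eqP; rewrite -in_Sigma (subvP (subT s sT)).
have disT' s t w : s \in T -> t \in T -> w \in (s : {vspace V}) -> w \in (t : {vspace V}) -> w != 0 -> s = t.
  move=> sT tT ws wt w0; apply/eqP; apply: contraT => st.
  by have /vspaceP/(_ w) := disT s t sT tT st; rewrite memv_cap ws wt memv0 (negbTE w0).
have covT' w : h w = 0 -> w != 0 -> exists2 s, s \in T & w \in (s : {vspace V}).
  move=> hw w0; have dw : \dim <[w]> == 1%N by rewrite dim_vline w0.
  have [|s sT ws] := covT (Flat dw); first by rewrite /= -memvE in_Sigma hw.
  by exists s; rewrite // memvE.
have h01 x y : h (mk 0 x y) = 0 by rewrite mkh.
pose e := mk 0 0 1.
have e0 : e != 0 by apply: contraNneq (oner_neq0 K) => e0; rewrite -(mkY 0 0 1) -/e e0 !linE.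
have [Li [LiS LiE]] := kspread_line (h01 0 1) e0.
have inLi w : h w = 0 -> X w = 0 -> w \in (Li : {vspace V}).
  move=> hw Xw; rewrite LiE; apply/klineP => //; exists (Y w).
  by apply: V_eq; rewrite !linE ?mulr0 ?mulr1.
have Li0 w : w \in (Li : {vspace V}) -> X w = 0.
  by rewrite LiE => /(klineP _ (h01 0 1))[k ->]; rewrite !linE mulr0.
suff LiT : Li \in T.
  apply/esym/eqP; rewrite eqEcard cS cT leqnn andbT; apply/subsetP => s sT.
  have [->//|sLi] := eqVneq s Li.
  apply: skew_kspread; [exact: subT | exact: ci |] => u us Xu.
  apply/eqP; apply: contraT => u0; case/eqP: sLi.
  by apply: (disT' _ _ u) => //; apply: inLi => //; exact: hT us.
apply: contraT => LiT.
have Xs s : s \in T -> exists2 u, u \in (s : {vspace V}) & X u != 0.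
  move=> sT; apply/exists_inP; apply: contraT => /exists_inPn nX; case/negP: LiT.
  suff <- : s = Li by [].
  apply: flat_eq; apply/eqP; rewrite eqEdim (dim_flat s) (dim_flat Li) leqnn andbT.
  apply/subvP => u us; apply: inLi; first exact: hT us.
  by have := nX u us; rewrite negbK => /eqP.
pose A := [set v : V | (h v == 0) && (X v == 0)].
pose T1 := [set s in T | [exists u in (s : {vspace V}), (u != 0) && (X u == 0)]].
have T1P s : s \in T1 -> s \in T /\ exists u, [/\ u \in (s : {vspace V}), u != 0 & X u = 0].
  by rewrite inE => /andP[-> /existsP[u /and3P[us u0 /eqP Xu]]]; split=> //; exists u.
have T2S s : s \in T -> s \notin T1 -> s \in kspread.
  move=> sT; rewrite inE sT /= => nu; apply: skew_kspread; [exact: subT | exact: ci |] => u us Xu.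
  apply/eqP; apply: contraNT nu => u0; apply/existsP; exists u.
  by rewrite us u0 Xu /=.
(* Each line of [T1], being distinct from [Li], contains q - 1 of the q^2 - 1 nonzero vectors of
   [Li]. *)
have cT1 : (#|T1| <= q.+1)%N.
  have dis1 s t : s \in T1 -> t \in T1 -> s != t -> (s :&: t)%VS = 0%VS.
    by move=> /T1P[sT _] /T1P[tT _]; exact: disT.
  have c1 s : s \in T1 -> #|[set v in A | (v != 0) && (v \in (s : {vspace V}))]| = q.-1.
    move=> /T1P[sT [u [us u0 Xu]]].
    have : #|[set v : V | v \in <[u]>%VS]| = q.
      have d1 : \dim <[u]> = 1%N by rewrite dim_vline u0.
      have := card_vspace <[u]>%VS; rewrite d1 expn1 card_F => <-.
      by apply: eq_card => v; rewrite inE.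
    rewrite (cardsD1 0) inE mem0v => <- /=; apply: eq_card => v; rewrite !inE.
    apply/andP/andP => [[/andP[/eqP hv /eqP Xv] /andP[v0 vs]]|[v0 /vlineP[a vE]]].
      split=> //; apply: contraT => vu; case/negP: LiT.
      suff <- : s = Li by [].
      apply: flat_eq; apply/eqP; rewrite eqEdim (dim_flat s) (dim_flat Li) leqnn andbT.
      have -> : (s : {vspace V}) = (<[u]> + <[v]>)%VS.
        apply/esym/eqP; rewrite eqEdim (dim_flat s) (dimv_line2 u0 vu) leqnn andbT.
        by rewrite subv_add -!memvE us vs.
      by rewrite subv_add -!memvE !inLi // (hT s).
    by rewrite v0 vE !linE (hT s u sT us) Xu !mulr0 !eqxx memvZ.
  have := card_partial_spread dis1 c1.
  set B := [set v in A | _]; have : (#|B| <= (q ^ 2).-1)%N.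
    have -> : (q ^ 2).-1 = #|[set: K] :\ 0|.
      by have := cardsD1 0 [set: K]; rewrite cardsT card_K in_setT => ->.
    rewrite -(card_in_imset (f := Y) (D := mem B)).
      apply/subset_leq_card/subsetP => _ /imsetP[v + ->].
      rewrite !inE andbT => /andP[/andP[/eqP hv /eqP Xv] /andP[v0 _]].
      by apply: contraNneq v0 => Yv; apply/eqP/V_eq; rewrite !linE.
    move=> v w; rewrite !inE => /andP[/andP[/eqP hv /eqP Xv] _] /andP[/andP[/eqP hw /eqP Xw] _] E.
    by apply: V_eq; rewrite ?hv ?hw ?Xv ?Xw.
  move=> + E; rewrite -E; move: #|T1| q_ge7; clear => t.
  by rewrite expnS expn1; case: q => // k /= ? ?; nia.
(* The K-line of slope k belongs to [T]. At least q^2 - q lines of [T] are outside [T1], and they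
   have distinct slopes, which leaves at most q slopes. *)
pose good k := [exists s in T :\: T1, mk 0 1 k \in (s : {vspace V})].
have cM : (#|[set k | ~~ good k]| <= q)%N.
  have ex s : s \in T :\: T1 -> exists k, mk 0 1 k \in (s : {vspace V}).
    rewrite in_setD => /andP[sT1 sT]; have sS := T2S s sT sT1; have [u us Xu] := Xs s sT.
    have u0 : u != 0 by apply: contraNneq Xu => ->; rewrite !linE.
    have [hu sE] := kspread_mem sS us u0; exists (Y u / X u); rewrite sE.
    by apply/klineP => //; exists (X u)^-1; apply: V_eq; rewrite !linE ?mulVf // mulrC.
  pose sl s := odflt 0 [pick k | mk 0 1 k \in ((s : flat F 4 1) : {vspace V})].
  have slP s : s \in T :\: T1 -> mk 0 1 (sl s) \in (s : {vspace V}).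
    by move/ex=> [k kP]; rewrite /sl; case: pickP => [//|/(_ k)]; rewrite kP.
  have m0 k : mk 0 1 k != 0.
    by apply: contraNneq (oner_neq0 K) => m0; rewrite -(mkX 0 1 k) m0 !linE.
  have cg : (#|T :\: T1| <= #|[set k | good k]|)%N.
    rewrite -(card_in_imset (f := sl) (D := mem (T :\: T1))).
      apply/subset_leq_card/subsetP => _ /imsetP[s sD ->]; rewrite inE.
      by apply/exists_inP; exists s => //; exact: slP.
    move=> s t sD tD E; have := slP s sD; rewrite E => st.
    move: (sD) (tD); rewrite !in_setD => /andP[_ sT] /andP[_ tT].
    exact: disT' sT tT st (slP t tD) (m0 _).
  have := cardsC [set k | good k].
  rewrite (_ : ~: _ = [set k | ~~ good k]); last by apply/setP => k; rewrite !inE.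
  move: cg; rewrite cardsD (setIidPr _); last by apply/subsetP => s /T1P[].
  rewrite cT card_F card_K; move: cT1; move: #|T1| #|[set k | good k]| #|[set k | ~~ good k]| q_ge7; clear.
  by move=> a b m; rewrite expnS expn1; case: q => // k; nia.
have badP s v : s \in T1 -> v \in (s : {vspace V}) -> X v != 0 -> ~~ good (Y v / X v).
  move=> sT1 vs Xv; have [sT _] := T1P s sT1; apply/negP => /exists_inP[t tD tv].
  move: tD; rewrite in_setD => /andP[tT1 tT]; have tS := T2S t tT tT1.
  have m0 : mk 0 1 (Y v / X v) != 0.
    by apply: contraNneq (oner_neq0 K) => m0; rewrite -(mkX 0 1 (Y v / X v)) m0 !linE.
  have [hm tE] := kspread_mem tS tv m0.
  have vt : v \in (t : {vspace V}).
    rewrite tE; apply/klineP => //; exists (X v).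
    by apply: V_eq; rewrite !linE ?mulr1 ?(hT s v) // mulrC divfK.
  have v0 : v != 0 by apply: contraNneq Xv => ->; rewrite !linE.
  by case/negP: tT1; rewrite -(disT' s t v sT tT vs vt v0).
have [s sT es] := covT' e (h01 0 1) e0.
have sT1 : s \in T1.
  by rewrite inE sT; apply/existsP; exists e; rewrite es e0 mkX eqxx.
have [a as_ Xa] := Xs s sT.
pose m := (X a)^-1; pose k0 := Y a / X a.
have m0 : m != 0 by rewrite invr_eq0.
(* Adding F-multiples of [e] to [a] within [s] produces q slopes that are not good, hence all of
   them. *)
pose line := [set k0 + io y * m | y : F].
have bad_line : line = [set k | ~~ good k].
  apply/eqP; rewrite eqEcard; apply/andP; split.
    apply/subsetP => _ /imsetP[y _ ->]; rewrite inE.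
    have v_s : a + y *: e \in (s : {vspace V}) by rewrite memvD // memvZ.
    have Xv : X (a + y *: e) = X a by rewrite !linE mulr0 addr0.
    have := badP s _ sT1 v_s; rewrite Xv => /(_ Xa).
    by rewrite !linE mulr1 mulrDl.
  rewrite card_imset ?card_F // => y y' /addrI/(mulIf m0); exact: fmorph_inj.
have bad0 : ~~ good k0 by apply: (badP s a).
(* A vector of slope k0 whose X-coordinate is the step [m] of [line]. With this scaling a vector [u]
   of [t] with X u = 0 has Y u in F m^2. *)
pose b := mk 0 m (k0 * m).
have b0 : b != 0 by apply: contraNneq m0 => b0; rewrite -(mkX 0 m (k0 * m)) -/b b0 !linE.
have [t tT bt] := covT' b (h01 _ _) b0.
have Xb : X b = m by rewrite mkX.
have Yb : Y b / X b = k0 by rewrite mkX mkY mulfK.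
have tT1 : t \in T1.
  apply: contraT => tT1; have tS := T2S t tT tT1; case/negP: bad0.
  apply/exists_inP; exists t; first by rewrite in_setD tT1.
  have [hb tE] := kspread_mem tS bt b0; rewrite tE; apply/klineP => //.
  by exists m^-1; apply: V_eq; rewrite !linE ?mulVf // mulrCA mulVf ?mulr1.
have [_ [u [ut u0 Xu]]] := T1P t tT1.
have hu := hT t u tT ut.
have Yu0 : Y u != 0 by apply: contraNneq u0 => Yu; apply/eqP/V_eq; rewrite !linE.
have : k0 + Y u / m \in line.
  rewrite bad_line inE; have bu : b + u \in (t : {vspace V}) by rewrite memvD.
  have := badP t _ tT1 bu; rewrite !linE Xu addr0 => /(_ m0).
  by rewrite mulrDl mulfK.
case/imsetP=> y _ /addrI yE.
have YE : Y u = io y * m ^+ 2 by rewrite expr2 mulrA -yE divfK.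
have y0 : y != 0 by apply: contraNneq Yu0 => y0; rewrite YE y0 rmorph0 mul0r.
have iy0 : io y != 0 by rewrite fmorph_eq0.
(* Both sides have the value k0 - 2 m of Y / X - X. *)
have E : 2 *: b = b - y^-1 *: u.
  apply: (ci t tT); rewrite ?memvB ?memvZ // !linE ?Xu ?mulr0 ?subr0 ?Xb //.
    by rewrite (rmorph_nat io) mulf_neq0 ?two0K.
  rewrite YE (rmorph_nat io) fmorphV; field; by rewrite two0K m0 iy0.
have := congr1 X E; rewrite !linE Xu mulr0 subr0 (rmorph_nat io) => /eqP.
by rewrite -subr_eq0 mulr_natl mulr2n addrK (negbTE m0).
Qed.

(** * The isomorphism with PG(2, K) and the conic *)

Definition hom v : 'rV[K]_3 := \row_(i < 3) (if i == 0 then io (h v) else if i == 1 then X v else Y v).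

Lemma hom0 v : hom v 0 0 = io (h v). Proof. by rewrite mxE. Qed.
Lemma hom1 v : hom v 0 1 = X v. Proof. by rewrite mxE. Qed.
Lemma hom2 v : hom v 0 2 = Y v. Proof. by rewrite mxE. Qed.

Lemma row3_eq (r r' : 'rV[K]_3) : r 0 0 = r' 0 0 -> r 0 1 = r' 0 1 -> r 0 2 = r' 0 2 -> r = r'.
Proof.
move=> E0 E1 E2; apply/rowP => i; case: i => -[|[|[|//]]] p.
- by rewrite (_ : Ordinal p = 0) //; apply/val_inj.
- by rewrite (_ : Ordinal p = 1) //; apply/val_inj.
- by rewrite (_ : Ordinal p = 2) //; apply/val_inj.
Qed.

Lemma homD u v : hom (u + v) = hom u + hom v.
Proof. by apply: row3_eq; rewrite !mxE /= !linE // rmorphD. Qed.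

Lemma homZ a v : hom (a *: v) = io a *: hom v.
Proof. by apply: row3_eq; rewrite !mxE /= !linE // rmorphM. Qed.

Lemma hom_kmul k v : h v = 0 -> hom (kmul k v) = k *: hom v.
Proof. by move=> hv; apply: row3_eq; rewrite !mxE /= !linE // hv rmorph0 mulr0. Qed.

Lemma hom_inj : injective hom.
Proof.
move=> u v E; apply: V_eq; last 2 first.
- by rewrite -!hom1 E.
- by rewrite -!hom2 E.
by apply: (fmorph_inj io); rewrite -!hom0 E.
Qed.

Lemma hom_eq0 v : (hom v == 0) = (v == 0).
Proof. by rewrite -(inj_eq hom_inj); congr (_ == _); apply: row3_eq; rewrite !mxE /= !linE ?rmorph0. Qed.

(** The K-span of the image of [U] in K^3: of dimension 1 for affine points and lines of [kspread],
    of dimension 2 for [Sigma] and for affine planes through a line of the spread. *)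
Definition kspan (U : {vspace V}) : {vspace 'rV[K]_3} := <<[seq hom v | v <- enum U]>>%VS.

Lemma hom_kspan (U : {vspace V}) v : v \in U -> hom v \in kspan U.
Proof. by move=> vU; apply/memv_span/map_f; rewrite mem_enum. Qed.

Lemma kspan_sub (U : {vspace V}) (W : {vspace 'rV[K]_3}) :
  (forall v, v \in U -> hom v \in W) -> (kspan U <= W)%VS.
Proof. by move=> UW; apply/span_subvP => _ /mapP[v + ->]; rewrite mem_enum; apply: UW. Qed.

Lemma kspan_line v : kspan <[v]> = <[hom v]>%VS.
Proof.
apply/eqP; rewrite eqEsubv; apply/andP; split.
  by apply: kspan_sub => _ /vlineP[a ->]; rewrite homZ memvZ ?memv_line.
by rewrite -memvE hom_kspan ?memv_line.
Qed.

Lemma kspan_kline u : h u = 0 -> kspan (kline u) = <[hom u]>%VS.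
Proof.
move=> hu; apply/eqP; rewrite eqEsubv; apply/andP; split.
  by apply: kspan_sub => _ /(klineP _ hu)[k ->]; rewrite hom_kmul // memvZ ?memv_line.
by rewrite -memvE hom_kspan ?kline_id.
Qed.

Lemma kspan_add U W : kspan (U + W) = (kspan U + kspan W)%VS.
Proof.
apply/eqP; rewrite eqEsubv; apply/andP; split.
  by apply: kspan_sub => _ /memv_addP[u uU [w wW ->]]; rewrite homD memv_add ?hom_kspan.
rewrite subv_add; apply/andP; split; apply: kspan_sub => v vU; rewrite hom_kspan //.
  by rewrite (subvP (addvSl _ _)).
by rewrite (subvP (addvSr _ _)).
Qed.

Lemma dim_kspan_plane v u : h v = 1 -> h u = 0 -> u != 0 ->
  \dim (<[hom v]> + <[hom u]>) = 2%N.
Proof.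
move=> hv hu u0; rewrite addvC; apply: dimv_line2; rewrite ?hom_eq0 //.
apply/negP => /vlineP[k /(congr1 (fun r : 'rV[K]_3 => r 0 0))].
by rewrite !mxE /= hu hv rmorph0 rmorph1 mulr0 => /eqP; rewrite oner_eq0.
Qed.

Lemma Sigma_kline : (Sigma : {vspace V}) = (kline (mk 0 1 0)%R + kline (mk 0 0 1)%R)%VS.
Proof.
apply/vspaceP => v; rewrite in_Sigma; apply/eqP/memv_addP => [hv|[x + [y + ->]]].
  exists (mk 0 (X v) 0).
    by apply/klineP; rewrite ?mkh //; exists (X v); apply: V_eq; rewrite !linE ?mulr1 ?mulr0.
  exists (mk 0 0 (Y v)).
    by apply/klineP; rewrite ?mkh //; exists (Y v); apply: V_eq; rewrite !linE ?mulr1 ?mulr0.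
  by apply: V_eq; rewrite !linE ?addr0 ?add0r.
move=> /klineP-/(_ (mkh _ _ _))[k ->] /klineP-/(_ (mkh _ _ _))[k' ->].
by rewrite hD !h_kmul addr0.
Qed.

Lemma kspan_Sigma : kspan Sigma = (<[hom (mk 0 1 0)%R]> + <[hom (mk 0 0 1)%R]>)%VS.
Proof. by rewrite Sigma_kline kspan_add !kspan_kline ?mkh. Qed.

Lemma mem_kspan_Sigma r : (r \in kspan Sigma) = (r 0 0 == 0).
Proof.
rewrite kspan_Sigma; apply/memv_addP/eqP => [[_ /vlineP[a ->] [_ /vlineP[b ->] ->]]|r0].
  by rewrite !mxE /= !mkh rmorph0 !mulr0 addr0.
exists (r 0 1 *: hom (mk 0 1 0)); first by rewrite memvZ ?memv_line.
exists (r 0 2 *: hom (mk 0 0 1)); first by rewrite memvZ ?memv_line.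
by apply: row3_eq; rewrite !mxE /= ?mkh ?mkX ?mkY ?rmorph0 ?mulr0 ?mulr1 ?addr0 ?add0r.
Qed.

Lemma dim_kspan_Sigma : \dim (kspan Sigma) = 2%N.
Proof.
rewrite kspan_Sigma; apply: dimv_line2.
  rewrite hom_eq0; apply: contraNneq (oner_neq0 K) => E; by rewrite -(mkX 0 1 0) E !linE.
apply/negP => /vlineP[k /(congr1 (fun r : 'rV[K]_3 => r 0 2))].
by rewrite !mxE /= !mkY mulr0 => /eqP; rewrite oner_eq0.
Qed.

Notation BB := (bruck_bose Sigma kspread).

(** Affine and infinite elements of the Bruck-Bose plane are treated alike as subspaces of [V]; with
    the line at infinity sent to [Sigma], incidence becomes inclusion. *)
Definition pt_space (x : point BB) : {vspace V} :=
  match x with inl y => (val y : flat F 4 0) | inr s => (val s : flat F 4 1) end.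
Definition ln_space (l : line BB) : {vspace V} :=
  match l with Some L => (val L : flat F 4 2) | None => Sigma end.

Lemma incident_sub (x : point BB) (l : line BB) : incident x l = (pt_space x <= ln_space l)%VS.
Proof.
case: x l => [y|s] [L|] //=; apply/esym; first by apply/negbTE; case: y.
by case: s => s sS; apply: kspread_sub.
Qed.

Lemma flat0P (x : flat F 4 0) : affine Sigma x -> exists2 v, h v = 1 & (x : {vspace V}) = <[v]>%VS.
Proof.
move=> /subvPn[v vx]; rewrite in_Sigma => hv; exists ((h v)^-1 *: v); first by rewrite hZ mulVf.
apply/esym/eqP; rewrite eqEdim -memvE memvZ // (dim_flat x) dim_vline.
by rewrite scaler_eq0 invr_eq0 (negbTE hv); case: eqP => // v0; rewrite v0 h0 eqxx in hv.
Qed.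

Lemma pt_spaceP (x : point BB) :
  (exists2 v, h v = 1 & pt_space x = <[v]>%VS) \/
  (exists u, [/\ h u = 0, u != 0 & pt_space x = kline u]).
Proof. by case: x => [[x xa]|[s sS]] /=; [left; exact: flat0P | right; exact/kspreadP]. Qed.

Lemma affine_plane v u : h v = 1 -> h u = 0 -> u != 0 ->
  \dim (<[v]> + kline u) = 3%N /\ forall w, w \in (<[v]> + kline u)%VS -> h w = 0 -> w \in kline u.
Proof.
move=> hv hu u0.
have mem w : w \in (<[v]> + kline u)%VS -> h w = 0 -> w \in kline u.
  case/memv_addP=> _ /vlineP[a ->] [x xu ->]; have [k xE] := klineP _ hu xu.
  by rewrite !linE hv {1}xE !linE mulr1 addr0 => ->; rewrite scale0r add0r.
split=> //; rewrite dimv_disjoint_sum ?dim_kline ?dim_vline //.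
  by case: eqP => // v0; move: hv (oner_neq0 F); rewrite v0 h0 => ->; rewrite eqxx.
apply/eqP; rewrite -subv0; apply/subvP => w; rewrite memv_cap => /andP[/vlineP[a ->]].
by move=> /(klineP _ hu)[k /(congr1 h)]; rewrite !linE hv mulr1 => ->; rewrite scale0r mem0v.
Qed.

Lemma ln_spaceP (l : line BB) : l = None \/
  exists v u, [/\ h v = 1, h u = 0, u != 0 & ln_space l = (<[v]> + kline u)%VS].
Proof.
case: l => [[L LP]|]; [right => /= | by left].
have /andP[/subvPn[v vL] + /exists_inP[s sS /eqP sE]] := LP; rewrite in_Sigma => hv.
have [u [hu u0 sE']] := kspreadP _ sS.
have hw : h ((h v)^-1 *: v) = 1 by rewrite hZ mulVf.
exists ((h v)^-1 *: v), u; split=> //; apply/esym/eqP; rewrite eqEdim.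
have [-> _] := affine_plane hw hu u0; rewrite (dim_flat L) leqnn andbT subv_add -memvE memvZ //=.
by rewrite -sE' -sE capvSl.
Qed.

Lemma mem_kspan_pt (x : point BB) w : (hom w \in kspan (pt_space x)) = (w \in pt_space x).
Proof.
apply/idP/idP; last exact: hom_kspan.
have [[v hv ->]|[u [hu u0 ->]]] := pt_spaceP x.
  rewrite kspan_line => /vlineP[k E].
  have kE : k = io (h w) by rewrite -hom0 E mxE hom0 hv rmorph1 mulr1.
  by apply/vlineP; exists (h w); apply: hom_inj; rewrite homZ -kE.
rewrite kspan_kline // => /vlineP[k E]; apply/klineP => //; exists k.
by apply: hom_inj; rewrite hom_kmul.
Qed.

(** Besides the injectivity of [ln_map], this yields that incidence in PG(2, K) implies incidence in
    the Bruck-Bose plane. *)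
Lemma mem_kspan_ln (l : line BB) w : (hom w \in kspan (ln_space l)) = (w \in ln_space l).
Proof.
apply/idP/idP; last exact: hom_kspan.
have [->|[v [u [hv hu u0 ->]]]] := ln_spaceP l.
  by rewrite mem_kspan_Sigma hom0 fmorph_eq0 in_Sigma.
rewrite kspan_add kspan_line kspan_kline // => /memv_addP[_ /vlineP[k ->] [_ /vlineP[k' ->] E]].
have kE : k = io (h w) by rewrite -hom0 E !mxE /= hv hu rmorph1 rmorph0 mulr1 mulr0 addr0.
have -> : w = h w *: v + kmul k' u by apply: hom_inj; rewrite homD homZ hom_kmul // -kE.
by rewrite memv_add ?memvZ ?memv_line //; apply/klineP => //; exists k'.
Qed.

Lemma dim_kspan_pt (x : point BB) : \dim (kspan (pt_space x)) == 1%N.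
Proof.
have [[v hv ->]|[u [hu u0 ->]]] := pt_spaceP x.
  have v0 : v != 0.
    by apply/eqP => v0; move: hv (oner_neq0 F); rewrite v0 h0 => ->; rewrite eqxx.
  by rewrite kspan_line dim_vline hom_eq0 v0.
by rewrite kspan_kline // dim_vline hom_eq0 u0.
Qed.

Lemma dim_kspan_ln (l : line BB) : \dim (kspan (ln_space l)) == 2%N.
Proof.
have [->|[v [u [hv hu u0 ->]]]] := ln_spaceP l; first by rewrite dim_kspan_Sigma.
by rewrite kspan_add kspan_line kspan_kline // dim_kspan_plane.
Qed.

Definition pt_map (x : point BB) : point (PG 2 K) := Flat (dim_kspan_pt x).
Definition ln_map (l : line BB) : line (PG 2 K) := Flat (dim_kspan_ln l).

Lemma pt_map_inj : injective pt_map.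
Proof.
move=> x x' /(congr1 (fun y : flat K 2 0 => (y : {vspace _}))) /= E.
have {E} : pt_space x = pt_space x' by apply/vspaceP => w; rewrite -!mem_kspan_pt E.
case: x x' => [y|s] [y'|s'] /= E.
- by congr inl; apply/val_inj/flat_eq.
- by have := dim_flat (val y); rewrite E (dim_flat (val s')).
- by have := dim_flat (val s); rewrite E (dim_flat (val y')).
- by congr inr; apply/val_inj/flat_eq.
Qed.

Lemma ln_map_inj : injective ln_map.
Proof.
move=> l l' /(congr1 (fun y : flat K 2 1 => (y : {vspace _}))) /= E.
have {E} : ln_space l = ln_space l' by apply/vspaceP => w; rewrite -!mem_kspan_ln E.
case: l l' => [L|] [L'|] //= E.
- by congr Some; apply/val_inj/flat_eq.
- by have := dim_flat (val L); rewrite E (dim_flat Sigma).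
- by have := dim_flat (val L'); rewrite -E (dim_flat Sigma).
Qed.

Lemma hom_surj0 (r : 'rV[K]_3) : r 0 0 = 0 -> exists2 u, h u = 0 & hom u = r.
Proof.
move=> r0; exists (mk 0 (r 0 1) (r 0 2)); first by rewrite mkh.
by apply: row3_eq; rewrite !mxE /= !linE ?rmorph0 ?r0.
Qed.

Lemma hom_surj1 (r : 'rV[K]_3) : r 0 0 = 1 -> exists2 v, h v = 1 & hom v = r.
Proof.
move=> r0; exists (mk 1 (r 0 1) (r 0 2)); first by rewrite mkh.
by apply: row3_eq; rewrite !mxE /= !linE ?rmorph1 ?r0.
Qed.

Lemma pt_map_surj y : exists x, pt_map x = y.
Proof.
have [r ry r0] : exists2 r, r \in (y : {vspace 'rV[K]_3}) & r != 0.
  by apply: dimv_gt0_mem; rewrite (dim_flat y).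
have yE r' : r' \in (y : {vspace 'rV[K]_3}) -> r' != 0 -> (y : {vspace 'rV[K]_3}) = <[r']>%VS.
  by move=> r'y r'0; apply/esym/eqP; rewrite eqEdim -memvE r'y (dim_flat y) dim_vline r'0.
have [r00|r00] := eqVneq (r 0 0) 0.
  have [u hu uE] := hom_surj0 r00.
  have u0 : u != 0 by rewrite -hom_eq0 uE.
  have [s [sS sE]] := kspread_line hu u0.
  exists (inr (exist _ s sS)); apply: flat_eq => /=.
  by rewrite sE kspan_kline // uE -yE.
have [|v hv vE] := hom_surj1 (r := (r 0 0)^-1 *: r); first by rewrite mxE mulVf.
have v0 : v != 0 by rewrite -hom_eq0 vE scaler_eq0 invr_eq0 negb_or r00.
have dv : \dim <[v]> == 1%N by rewrite dim_vline v0.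
pose x : flat F 4 0 := Flat dv; have va : affine Sigma x.
  apply/negP => /subvP/(_ v); rewrite in_Sigma hv oner_eq0 /= memv_line.
  by move=> /(_ isT).
exists (inl (exist _ x va)); apply: flat_eq => /=.
by rewrite kspan_line vE -yE ?memvZ // scaler_eq0 invr_eq0 negb_or r00.
Qed.

(** A line other than the image of [Sigma] is spanned by a vector with first coordinate 1 and one
    with first coordinate 0; they give an affine point and a spread line, which span the plane
    sought. *)
Lemma ln_map_surj l : exists L, ln_map L = l.
Proof.
have [/subvP lS|/subvPn[r rl]] := boolP (l <= kspan Sigma)%VS.
  exists None; apply: flat_eq => /=; apply/esym/eqP; rewrite eqEdim dim_kspan_Sigma (dim_flat l).
  by rewrite andbT; apply/subvP.
rewrite mem_kspan_Sigma => r00.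
have [|v hv vE] := hom_surj1 (r := (r 0 0)^-1 *: r); first by rewrite mxE mulVf.
have vl : hom v \in (l : {vspace 'rV[K]_3}) by rewrite vE memvZ.
have [r' r'l r'v] : exists2 r', r' \in (l : {vspace 'rV[K]_3}) & r' \notin <[hom v]>%VS.
  apply/subvPn/negP => /dimvS; rewrite (dim_flat l) dim_vline; by case: (_ != 0).
have [|u hu uE] := hom_surj0 (r := r' - r' 0 0 *: hom v).
  by rewrite !mxE /= hv rmorph1 mulr1 subrr.
have ul : hom u \in (l : {vspace 'rV[K]_3}) by rewrite uE memvB ?memvZ.
have u0 : u != 0.
  rewrite -hom_eq0 uE; apply: contraNneq r'v => /subr0_eq ->.
  by rewrite memvZ ?memv_line.
have [dU memU] := affine_plane hv hu u0.
have dU' : \dim (<[v]> + kline u) == 3%N by rewrite dU.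
have [s [sS sE]] := kspread_line hu u0.
pose L : flat F 4 2 := Flat dU'.
have LP : affine Sigma L && [exists t in kspread, (L :&: Sigma)%VS == t].
  apply/andP; split.
    apply/negP => /subvP/(_ v); rewrite in_Sigma hv oner_eq0 /=.
    by rewrite (subvP (addvSl _ _)) ?memv_line // => /(_ isT).
  apply/exists_inP; exists s => //; rewrite sE; apply/eqP/vspaceP => w; rewrite memv_cap in_Sigma /=.
  apply/andP/idP => [[wU /eqP hw]|wu]; first exact: memU.
  by rewrite (subvP (addvSr _ _)) //; have [k ->] := klineP _ hu wu; rewrite h_kmul.
exists (Some (exist _ L LP)); apply: flat_eq => /=; apply/eqP.
rewrite kspan_add kspan_line kspan_kline // eqEdim dim_kspan_plane // (dim_flat l) leqnn andbT.
by rewrite subv_add -!memvE vl ul.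
Qed.

Lemma BB_isomorphism : is_isomorphism pt_map ln_map.
Proof.
split.
- exact: injective_onto_bijective pt_map_inj pt_map_surj.
- exact: injective_onto_bijective ln_map_inj ln_map_surj.
move=> x l; rewrite incident_sub /=; apply/idP/idP => [/subvP sub|/subvP sub].
  by apply/subvP => w wx; rewrite -mem_kspan_ln sub // hom_kspan.
by apply: kspan_sub => w wx; rewrite hom_kspan // sub.
Qed.

(** The symmetric matrix of twice the form X^2 - h Y; the factor 2 avoids halves. *)
Definition conic_mx : 'M[K]_3 := \matrix_(i, j)
  (if (i == 1) && (j == 1) then 2 else if (i == 0) && (j == 2) || (i == 2) && (j == 0) then -1 else 0).

Lemma conic_mxE (r : 'rV[K]_3) : (r *m conic_mx *m r^T) 0 0 = 2 * (r 0 1 ^+ 2 - r 0 0 * r 0 2).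
Proof.
rewrite !mxE !big_ord_recl big_ord0 !mxE !big_ord_recl !big_ord0 !mxE /=.
have -> : lift ord0 ord0 = 1 :> 'I_3 by apply/val_inj.
have -> : lift ord0 (lift ord0 ord0) = 2 :> 'I_3 by apply/val_inj.
have -> : ord0 = 0 :> 'I_3 by apply/val_inj.
ring.
Qed.

Lemma conic_mx_unit : \det conic_mx != 0.
Proof.
pose B : 'M[K]_3 := \matrix_(i, j)
  (if (i == 1) && (j == 1) then 2^-1 else if (i == 0) && (j == 2) || (i == 2) && (j == 0) then -1 else 0).
have E : conic_mx *m B = 1%:M.
  apply/matrixP => i j; rewrite !mxE !big_ord_recl big_ord0 !mxE /=.
  case: i => -[|[|[|//]]] ?; case: j => -[|[|[|//]]] ?;
    rewrite /= ?mulr0 ?mul0r ?mulrNN ?mulr1 ?addr0 ?add0r ?mulfV ?two0K //.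
apply/eqP => d0; have := congr1 determinant E; rewrite det_mulmx d0 mul0r det1 => /esym/eqP.
by rewrite oner_eq0.
Qed.

Lemma kspread_conic : exists2 O : {set point (PG 2 K)}, conic O & pt_map @: bb_set Sigma kspread C \subset O.
Proof.
exists [set x : flat K 2 0 | [forall v : 'rV[K]_3, (v \in (x : {vspace _})) ==>
                                (v *m conic_mx *m v^T == 0)]].
  exists conic_mx; split=> //; last exact: conic_mx_unit.
  by apply/matrixP => i j; rewrite !mxE andbC [(j == 0) && _]andbC [(j == 2) && _]andbC orbC.
apply/subsetP => _ /imsetP[x xC ->]; rewrite inE; apply/forallP => r; apply/implyP.
have [y [k [-> yE]]] := bb_setP xC.
rewrite /= yE kspan_line => /vlineP[a ->]; apply/eqP/matrixP => i j; rewrite !ord1 conic_mxE !mxE /=.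
by rewrite !linE rmorph1; ring.
Qed.

Lemma kspread_theorem : exists S : {set flat F 4 1},
  [/\ unique (fun T : {set flat F 4 1} =>
                spread Sigma T /\ k_arc (bruck_bose Sigma T) (q ^ 2) (bb_set Sigma T C)) S,
      regular S &
      exists (L : finFieldType)
             (f : point (bruck_bose Sigma S) -> point (PG 2 L))
             (g : line (bruck_bose Sigma S) -> line (PG 2 L)),
        [/\ #|L| = (q ^ 2)%N,
            is_isomorphism f g &
            exists2 O : {set point (PG 2 L)}, conic O & f @: bb_set Sigma S C \subset O]].
Proof.
exists kspread; split; last 2 first.
- exact: kspread_regular.
- exists K, pt_map, ln_map; split; [exact: card_K | exact: BB_isomorphism | exact: kspread_conic].
split=> [|T [Tsp Tarc]]; last exact: kspread_unique.
by split; [exact: kspread_spread | exact: kspread_arc].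
Qed.

End Model.

(** * From PG(4, q) to vectors and coordinates *)

Lemma hyperplane_form (F : finFieldType) (Sigma : flat F 4 3) :
  exists h : 'rV[F]_5 -> F, (forall a u v, h (a *: u + v) = a * h u + h v) /\
    forall v, (v \in (Sigma : {vspace 'rV[F]_5})) = (h v == 0).
Proof.
(* [h v] will be the coefficient of [o] in the decomposition of [v] along [<[o]> + Sigma]. *)
have [o _ oS] : exists2 o, o \in fullv & o \notin (Sigma : {vspace 'rV[F]_5}).
  by apply/subvPn/negP => /dimvS; rewrite (dim_flat Sigma) dimvf /dim /= mul1n.
have o0 : o != 0 by apply: contraNneq oS => ->; rewrite mem0v.
have full : (<[o]> + Sigma)%VS = fullv.
  apply/eqP; rewrite eqEdim subvf dimvf /dim /= mul1n dimv_disjoint_sum ?dim_vline ?o0 ?(dim_flat Sigma) //.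
  apply/eqP; rewrite -subv0; apply/subvP => w; rewrite memv_cap => /andP[/vlineP[k ->] kS].
  rewrite memv0 scaler_eq0; apply/orP; left; apply: contraNT oS => k0.
  by rewrite -(scalerK k0 o) memvZ.
have ex v : exists a, v - a *: o \in (Sigma : {vspace 'rV[F]_5}).
  have : v \in (<[o]> + Sigma)%VS by rewrite full memvf.
  by case/memv_addP=> _ /vlineP[a ->] [w wS ->]; exists a; rewrite addrC addKr.
have [h hP] := fin_all_exists ex.
have uniq v a : v - a *: o \in (Sigma : {vspace 'rV[F]_5}) -> h v = a.
  move=> aS; have dS : (h v - a) *: o \in (Sigma : {vspace 'rV[F]_5}).
    have -> : (h v - a) *: o = (v - a *: o) - (v - h v *: o).
      by apply/rowP => i; rewrite !mxE; ring.
    by rewrite memvB.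
  apply/eqP; rewrite -subr_eq0; apply: contraNT oS => d0.
  by rewrite -(scalerK d0 o) memvZ.
exists h; split=> [a u v|v].
  apply: uniq; have -> : a *: u + v - (a * h u + h v) *: o = a *: (u - h u *: o) + (v - h v *: o).
    by apply/rowP => i; rewrite !mxE; ring.
  by rewrite memvD ?memvZ.
apply/idP/eqP => [vS|h0]; first by apply: uniq; rewrite scale0r subr0.
by have := hP v; rewrite h0 scale0r subr0.
Qed.

Lemma two_neq0 (F : finFieldType) : odd #|F| -> (2 : F) != 0.
Proof.
move=> oF; apply/eqP => two0.
have ch : 2%N \in [pchar F] by rewrite inE /= two0 eqxx.
have cF := card_pprimeChar ch.
move: oF; rewrite cF oddX orbF => /eqP n0.
by have := finNzRing_gt1 F; rewrite cF n0.
Qed.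

(** With X = y + x theta and Y = t + 2 z theta, the identity X^2 = y^2 + c x^2 + 2 x y theta turns z
    = x y, t = y^2 + c x^2 into Y = X^2. *)
Lemma coordinate_model (F : finFieldType) (h : 'rV[F]_5 -> F) (o e1 e2 e3 n : 'rV[F]_5) (c : F)
    (K : finFieldType) (io : {rmorphism F -> K}) (theta : K) :
  (forall a u v, h (a *: u + v) = a * h u + h v) -> (2 : F) != 0 ->
  [/\ h o = 1, h e1 = 0, h e2 = 0, h e3 = 0 & h n = 0] -> indep e1 e2 e3 n ->
  #|K| = (#|F| ^ 2)%N -> theta ^+ 2 = io c -> (forall m, m ^+ 2 != c) ->
  exists (X Y : 'rV[F]_5 -> K) (mk : F -> K -> K -> 'rV[F]_5),
    [/\ forall a u v, X (a *: u + v) = io a * X u + X v,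
        forall a u v, Y (a *: u + v) = io a * Y u + Y v,
        [/\ forall a x y, h (mk a x y) = a, forall a x y, X (mk a x y) = x &
            forall a x y, Y (mk a x y) = y],
        forall v, mk (h v) (X v) (Y v) = v &
        forall x y, o + comb e1 e2 e3 n x y (x * y) (y ^+ 2 + c * x ^+ 2) = cpt mk (io y + io x * theta)].
Proof.
move=> h_lin two0 [ho h1 h2 h3 hn] ind cK theta2 nsq.
have hc x y z t : h (comb e1 e2 e3 n x y z t) = 0.
  by rewrite /comb !(hD h_lin) !(hZ h_lin) h1 h2 h3 hn !mulr0 !addr0.
have ex v : exists g : F * F * F * F, v = h v *: o + comb e1 e2 e3 n g.1.1.1 g.1.1.2 g.1.2 g.2.
  have [x [y [z [t E]]]] := indep_span h_lin v ho h1 h2 h3 hn ind.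
  by exists (x, y, z, t).
have [g gP] := fin_all_exists ex.
have gE a x y z t : g (a *: o + comb e1 e2 e3 n x y z t) = (x, y, z, t).
  have := gP (a *: o + comb e1 e2 e3 n x y z t); rewrite h_lin ho hc mulr1 addr0.
  by move/addrI/(indep_inj ind); case: (g _) => [[[x' y'] z'] t'] /= [-> -> -> ->].
have g_lin a u v : g (a *: u + v) = (a * (g u).1.1.1 + (g v).1.1.1, a * (g u).1.1.2 + (g v).1.1.2,
    a * (g u).1.2 + (g v).1.2, a * (g u).2 + (g v).2).
  rewrite -(gE (a * h u + h v)); congr g; rewrite {1}(gP u) {1}(gP v).
  by apply/rowP => i; rewrite !mxE; ring.
have ex_d k : exists ab : F * F, k = io ab.1 + io ab.2 * theta.
  by have [a [b E]] := basis_span erefl cK theta2 nsq k; exists (a, b).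
have [d dP] := fin_all_exists ex_d.
have dE a b : d (io a + io b * theta) = (a, b).
  have := dP (io a + io b * theta) => /(basis_inj theta2 nsq).
  by case: (d _) => a' b' /= [-> ->].
pose X v := io (g v).1.1.2 + io (g v).1.1.1 * theta.
pose Y v := io (g v).2 + io (2 * (g v).1.2) * theta.
pose mk a x y := a *: o + comb e1 e2 e3 n (d x).2 (d x).1 (2^-1 * (d y).2) (d y).1.
have mkh a x y : h (mk a x y) = a by rewrite /mk h_lin ho hc mulr1 addr0.
have mkX a x y : X (mk a x y) = x by rewrite /X /mk gE /= -dP.
have mkY a x y : Y (mk a x y) = y by rewrite /Y /mk gE /= mulrA mulfV // mul1r -dP.
have mkK v : mk (h v) (X v) (Y v) = v.
  by rewrite /mk /X /Y !dE /= mulrA mulVf // mul1r -gP.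
exists X, Y, mk; split=> //.
- by move=> a u v; rewrite /X g_lin /= !rmorphD !rmorphM; ring.
- by move=> a u v; rewrite /Y g_lin /= !(rmorphD, rmorphM); ring.
move=> x y; rewrite -[LHS]mkK.
have -> : h (o + comb e1 e2 e3 n x y (x * y) (y ^+ 2 + c * x ^+ 2)) = 1.
  by rewrite (hD h_lin) ho hc addr0.
have E := gE 1 x y (x * y) (y ^+ 2 + c * x ^+ 2); rewrite scale1r in E.
rewrite /cpt /X /Y E /=; congr mk.
rewrite sqrrD exprMn theta2 !(rmorphD, rmorphM, rmorphXn) /= ?rmorph1; ring.
Qed.

Local Close Scope ring_scope.

Theorem theorem1p2 (q : nat) (F : finFieldType) (Sigma : flat F 4 3)
    (C : {set flat F 4 0}) (Cplanes : {set flat F 4 2})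
    (card_F : #|F| = q) (q_ge7 : (7 <= q)%N) (q_odd : odd q)
    (card_C : #|C| = (q ^ 2)%N)
    (C_affine : forall x, x \in C -> affine Sigma x)
    (Cplanes_affine : forall P, P \in Cplanes -> affine Sigma P)
    (A1_arc : forall P, P \in Cplanes ->
       k_arc (PG 4 F) q [set x in C | (x <= P)%VS])
    (A1_five : forall P : flat F 4 2,
       (4 < #|[set x in C | (x <= P)%VS]|)%N -> P \in Cplanes)
    (A2 : forall x y, x \in C -> y \in C -> x != y ->
       exists! P, P \in Cplanes /\ (x <= P)%VS /\ (y <= P)%VS)
    (A3 : forall x : flat F 4 0, affine Sigma x ->
       [\/ x \in C,
           #|[set P in Cplanes | (x <= P)%VS]| = 0%N |
           #|[set P in Cplanes | (x <= P)%VS]| = 2%N]) :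
  exists S : {set flat F 4 1},
    [/\ unique (fun T : {set flat F 4 1} =>
                  spread Sigma T /\
                  k_arc (bruck_bose Sigma T) (q ^ 2) (bb_set Sigma T C)) S,
        regular S &
        exists (K : finFieldType)
               (f : point (bruck_bose Sigma S) -> point (PG 2 K))
               (g : line (bruck_bose Sigma S) -> line (PG 2 K)),
          [/\ #|K| = (q ^ 2)%N,
              is_isomorphism f g &
              exists2 O : {set point (PG 2 K)},
                conic O & f @: bb_set Sigma S C \subset O]].
Proof.
have [h [h_lin in_Sigma]] := hyperplane_form Sigma.
have two0 : ((2 : F) != 0)%R by apply: two_neq0; rewrite card_F.
have flatP (x : flat F 4 0) : affine Sigma x -> exists2 v, h v = 1%R & (x : {vspace 'rV[F]_5}) = <[v]>%VS.
  by move=> xa; exact: (flat0P h_lin in_Sigma xa).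
(* The representative of [x] on which [h] is 1; points at infinity get an arbitrary value. *)
have exr (x : flat F 4 0) : exists v, affine Sigma x -> h v = 1%R /\ (x : {vspace 'rV[F]_5}) = <[v]>%VS.
  have [/flatP[v hv vE]|_] := boolP (affine Sigma x); last by exists 0%R.
  by exists v.
have [r rP] := fin_all_exists exr.
have rC x : x \in C -> h (r x) = 1%R /\ (x : {vspace 'rV[F]_5}) = <[r x]>%VS by move/C_affine/rP.
have line_uniq u v : h u = 1%R -> h v = 1%R -> v \in <[u]>%VS -> v = u.
  move=> hu hv /vlineP[k vE]; move: hv.
  by rewrite vE (hZ h_lin) hu GRing.mulr1 => ->; rewrite GRing.scale1r.
have r_inj : {in C &, injective r}.
  move=> x y xC yC E; apply: flat_eq; have [_ ->] := rC x xC; by have [_ ->] := rC y yC; rewrite E.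
pose Cv := r @: C.
pose Pv := @flat_space F 4 2 @: Cplanes.
have PvP p : p \in Pv -> exists2 p' : flat F 4 2, p' \in Cplanes & p = p'.
  by case/imsetP=> p' ? ->; exists p'.
have rsub x p : x \in C -> (x <= p)%VS = (r x \in p).
  by move=> xC; have [_ ->] := rC x xC; rewrite memvE.
have cardCv : #|Cv| = q ^ 2 by rewrite card_in_imset.
have Cv_aff v : v \in Cv -> h v = 1%R by case/imsetP=> x xC ->; case: (rC x xC).
have dimPv p : p \in Pv -> \dim p = 3 by case/PvP=> p' _ ->; exact: dim_flat.
have blkE p : blk Cv p = r @: [set x in C | (x <= p)%VS].
  apply/setP => v; rewrite inE; apply/andP/imsetP => [[/imsetP[x xC ->] xp]|[x /setIdP[xC xp] ->]].
    by exists x; rewrite // inE xC rsub.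
  by rewrite imset_f // -rsub.
have card_blkv p : p \in Pv -> #|blk Cv p| = q.
  case/PvP=> p' pP ->; rewrite blkE card_in_imset; first by case: (A1_arc p' pP).
  by move=> x y /setIdP[xC _] /setIdP[yC _]; exact: r_inj.
have neq0 v : h v = 1%R -> v != 0%R by exact: aff_neq0.
have arcv p u v w : p \in Pv -> u \in blk Cv p -> v \in blk Cv p -> w \in blk Cv p ->
    u != v -> u != w -> v != w -> (w - u)%R \notin <[(v - u)%R]>%VS.
  case/PvP=> p' pP ->; rewrite !blkE => /imsetP[x xp ->] /imsetP[y yp ->] /imsetP[z zp ->] uv uw vw.
  apply/negP => /vlineP[k E].
  have [_ arc] := A1_arc p' pP.
  have [xC yC zC] : [/\ x \in C, y \in C & z \in C] by move: xp yp zp; rewrite !inE => /andP[-> _] /andP[-> _] /andP[-> _].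
  have ne x' y' : r x' != r y' -> x' != y' by apply: contraNneq => ->.
  apply: (arc x y z xp yp zp (ne _ _ uv) (ne _ _ vw) (ne _ _ uw)).
  have [hx _] := rC x xC; have [hy _] := rC y yC.
  have ryx : r y \notin <[r x]>%VS.
    by apply: contraNN uv => /(line_uniq _ _ hx hy) ->.
  (* Dependent differences put the third point on the line spanned by the first two. *)
  have dl : \dim (<[r x]> + <[r y]>) == 2 by rewrite dimv_line2 // neq0.
  exists (Flat dl); split; rewrite /= rsub //.
  - by rewrite (subvP (addvSl _ _)) ?memv_line.
  - by rewrite (subvP (addvSr _ _)) ?memv_line.
  rewrite -(GRing.subrK (r x) (r z)) E memvD ?memvZ ?memvB //.
  - by rewrite (subvP (addvSr _ _)) ?memv_line.
  - by rewrite (subvP (addvSl _ _)) ?memv_line.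
  by rewrite (subvP (addvSl _ _)) ?memv_line.
have joinv u v : u \in Cv -> v \in Cv -> u != v -> exists p, [/\ p \in Pv, u \in p & v \in p].
  move=> /imsetP[x xC ->] /imsetP[y yC ->] uv.
  have xy : x != y by apply: contraNneq uv => ->.
  have [p [[pP [xp yp]] _]] := A2 x y xC yC xy.
  by exists (flat_space p); split; rewrite -?rsub // imset_f.
have join_uniqv u v p s : u != v -> u \in Cv -> v \in Cv -> p \in Pv -> s \in Pv ->
    u \in p -> v \in p -> u \in s -> v \in s -> p = s.
  move=> uv /imsetP[x xC uE] /imsetP[y yC vE] /PvP[p' pP ->] /PvP[s' sP ->].
  rewrite uE vE -!rsub // => xp yp xs ys.
  have xy : x != y by apply: contraNneq uv => xy; rewrite uE vE xy.
  have [t [_ tu]] := A2 x y xC yC xy.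
  by rewrite -(tu p') // -(tu s').
(* The last two cases of (A3) in terms of vectors; the value 2 gives both a second plane and the
   absence of a third. *)
have on_planes v : h v = 1%R -> v \notin Cv -> #|[set p in Pv | v \in p]| = 0 \/ #|[set p in Pv | v \in p]| = 2.
  move=> hv vC; have dv : \dim <[v]> == 1 by rewrite dim_vline neq0.
  pose x : flat F 4 0 := Flat dv.
  have xa : affine Sigma x.
    apply/negP => /subvP/(_ v (memv_line v)); rewrite in_Sigma hv GRing.oner_eq0 //.
  have -> : #|[set p in Pv | v \in p]| = #|[set p in Cplanes | (x <= p)%VS]|.
    have inj : injective (@flat_space F 4 2) by move=> p p'; exact: flat_eq.
    rewrite -[RHS](card_imset _ inj); apply: eq_card => p; rewrite inE.
    apply/andP/imsetP => [[/PvP[p' pP ->] vp]|[p' /setIdP[pP xp] ->]].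
      by exists p'; rewrite // inE pP -memvE.
    by rewrite imset_f //= memvE.
  have [xC|->|->] := A3 x xa; [|by left|by right].
  case/negP: vC; apply/imsetP; exists x => //.
  have [hr xE] := rC x xC; apply: line_uniq => //.
  by rewrite -xE /= memv_line.
have twov v p : h v = 1%R -> v \notin Cv -> p \in Pv -> v \in p -> exists s, [/\ s \in Pv, s != p & v \in s].
  move=> hv vC pP vp; have pS : p \in [set p in Pv | v \in p] by rewrite inE pP.
  have [/eqP|c2] := on_planes v hv vC; first by rewrite cards_eq0 => /eqP E; rewrite E inE in pS.
  have : 0 < #|[set p in Pv | v \in p] :\ p| by have := cardsD1 p [set p in Pv | v \in p]; rewrite c2 pS add1n => -[<-].
  by case/card_gt0P=> s /setD1P[sp /setIdP[sP vs]]; exists s.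
have threev v p s t : h v = 1%R -> v \notin Cv -> p \in Pv -> s \in Pv -> t \in Pv ->
    v \in p -> v \in s -> v \in t -> [|| p == s, p == t | s == t].
  move=> hv vC pP sP tP vp vs vt; apply: contraT; rewrite !negb_or => /and3P[ps pt st].
  have : 2 < #|[set p in Pv | v \in p]|.
    by apply/card_gt2P; exists p, s, t; rewrite !inE pP sP tP vp vs vt [t == p]eq_sym.
  by have [->|->] := on_planes v hv vC.
have [o [e1 [e2 [e3 [n [c [hs ind nsq CvE]]]]]]] := canonical_form card_F h_lin q_ge7 cardCv Cv_aff
  dimPv card_blkv arcv joinv join_uniqv twov threev two0.
have [K [io [theta [cK theta2]]]] := quadratic_extension nsq.
have [X [Y [mk [X_lin Y_lin [mkh mkX mkY] mkK PE]]]] := coordinate_model h_lin two0 hs ind cK theta2 nsq.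
have cK' : #|K| = q ^ 2 by rewrite cK card_F.
have C_P x : x \in C -> exists k, (x : {vspace 'rV[F]_5}) = <[cpt mk k]>%VS.
  move=> xC; have [_ ->] := rC x xC; have /CvE[a [b ->]] : r x \in Cv by rewrite imset_f.
  by rewrite PE; eexists.
have P_C k : exists2 x, x \in C & (x : {vspace 'rV[F]_5}) = <[cpt mk k]>%VS.
  have [b [a ->]] := basis_span card_F cK' theta2 nsq k; rewrite -PE.
  have /imsetP[x xC ->] : (o + comb e1 e2 e3 n a b (a * b) (b ^+ 2 + c * a ^+ 2))%R \in Cv by apply/CvE; exists a, b.
  by exists x => //; have [] := rC x xC.
exact: (kspread_theorem card_F q_ge7 two0 cK' theta2 nsq h_lin X_lin Y_lin mkh mkX mkY mkK in_Sigma C_P P_C card_C).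
Qed.
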